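(* Let $S$ be the surface implicitly defined by $F(x,y,z)=0$, let $\mathcal{L}$ be the homogeneous linear system in the unknowns $(\beta,\alpha)=(\beta_1,\beta_2,\beta_3,\alpha_1,\alpha_2,\alpha_3)$ expressing that $\alpha\cdot(\boldsymbol{P}\times\gamma(\boldsymbol{P}))+\beta\cdot\gamma(\boldsymbol{P})=0$ for points $\boldsymbol{P}=(x,y,z)\in\mathbb{R}^3$, and let $D$ be the dimension of its solution space. Suppose that $D=1$. Let $\mathcal{A}$ be the line whose Plücker coordinates correspond to the solution space of $\mathcal{L}$, and let $\Pi$ be a generic plane normal to $\mathcal{A}$. (1) If $S\cap\Pi$ factors into concentric circles, then $S$ is an elliptic affine rotation surface with axis $\mathcal{A}$. (2) If $S\cap\Pi$ factors into rectangular hyperbolas with the same center and asymptotes, then $S$ is a hyperbolic affine rotation surface with axis $\mathcal{A}$.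
   Context: Standing assumptions: $S$ is the zero set in $\mathbb{R}^3$ of an irreducible real polynomial $F$, the real part of $S$ is 2-dimensional, and the Gaussian curvature of $S$ is not identically zero. Canonical groups about the $z$-axis (parameter $t\in\mathbb{R}$): elliptic $\begin{pmatrix}\cos t&-\sin t&0\\ \sin t&\cos t&0\\0&0&1\end{pmatrix}$, hyperbolic $\begin{pmatrix}\cosh t&\sinh t&0\\ \sinh t&\cosh t&0\\0&0&1\end{pmatrix}$. $S$ is an elliptic (hyperbolic) affine rotation surface with axis $\mathcal{A}$ if there is a rigid motion $T$ of $\mathbb{R}^3$ carrying $\mathcal{A}$ to the $z$-axis such that $T(S)$ is invariant under the elliptic (hyperbolic) group. Plücker coordinates: a line through a point $Q$ (identified with its position vector) with direction vector $\mathbf{w}\ne0$ has Plücker coordinates $(\bar{\mathbf{w}},\mathbf{w})\in\mathbb{R}^6$, $\bar{\mathbf{w}}=Q\times\mathbf{w}$, unique up to a nonzero constant. The solution of $\mathcal{L}$ is read as Plücker coordinates $(\beta,\alpha)$, with $\alpha$ the direction vector. Affine normal: for a local parametrization $\mathbf{x}(u,v)$ of a surface with unit Euclidean normal $\mathbf{N}$ and Gaussian curvature $K\ne0$, set $\nu=|K|^{-1/4}\mathbf{N}$; the affine normal vector is $\xi=[\nu,\nu_u,\nu_v]^{-1}(\nu_u\times\nu_v)$, with $[\cdot,\cdot,\cdot]$ the determinant. For surfaces given implicitly through $F$, $\xi(x,y,z)=a(x,y,z)\gamma(x,y,z)$ with $a$ a nonzero scalar function and $\gamma=(\gamma_1,\gamma_2,\gamma_3)$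 a vector of rational functions of $x,y,z$, so that at a generic point of $\mathbb{R}^3$ the vector $\gamma$ is a direction vector of the affine normal line at that point to the level surface of $F$ through it. The system $\mathcal{L}$ consists of the equations obtained by substituting generic points $\boldsymbol{P}$, so that its solutions are the $(\beta,\alpha)\in\mathbb{R}^6$ for which the expression vanishes identically in $x,y,z$. ''$S\cap\Pi$ factors into'' curves of a given kind means that the polynomial defining $S\cap\Pi$ in $\Pi$ factors completely into polynomials defining curves of that kind. *)

(* Defs.v *)
(* The notations of mpoly and complex are not imported: they clash with those
   of mathcomp-analysis. *)
From HB Require Import structures.
From mathcomp Require Import all_boot all_order all_algebra.
From mathcomp Require Import all_classical all_reals all_analysis.
From mathcomp Require mpoly complex.
Export -(notations) mpoly.
Export -(notations) complex.
Set Implicit Arguments.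
Unset Strict Implicit.
Unset Printing Implicit Defensive.
Import Order.TTheory GRing.Theory Num.Theory.
Import numFieldNormedType.Exports.
Local Open Scope classical_set_scope.
Local Open Scope ring_scope.

Notation "{ 'mpoly' T [ n ] }" := (mpoly n T) (format "{ 'mpoly'  T [ n ] }").

Section Vectors.
Variable K : comNzRingType.
Implicit Types u v w : 'cV[K]_3.

Definition i0 : 'I_3 := @Ordinal 3 0 isT.
Definition i1 : 'I_3 := @Ordinal 3 1 isT.
Definition i2 : 'I_3 := @Ordinal 3 2 isT.

Definition mx3 (l : seq (seq K)) : 'M[K]_3 :=
  \matrix_(i < 3, j < 3) nth 0 (nth [::] l i) j.

Definition vec3 (x y z : K) : 'cV[K]_3 := \col_(i < 3) nth 0 [:: x; y; z] i.

Definition dot u v : K := \sum_(i < 3) u i 0 * v i 0.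

Definition cross u v : 'cV[K]_3 :=
  vec3 (u i1 0 * v i2 0 - u i2 0 * v i1 0)
       (u i2 0 * v i0 0 - u i0 0 * v i2 0)
       (u i0 0 * v i1 0 - u i1 0 * v i0 0).

Definition det3 u v w : K :=
  \det (mx3 [:: [:: u i0 0; u i1 0; u i2 0];
                [:: v i0 0; v i1 0; v i2 0];
                [:: w i0 0; w i1 0; w i2 0]]).

End Vectors.

Section Surfaces.
Variable R : realType.
Local Notation point := 'cV[R]_3.
Local Notation plane := (R * R)%type.
Local Notation poly3 := {mpoly R[3]}.
Implicit Types (F : poly3) (P Q w : point) (X f : plane -> point).
Implicit Types (S A : set point).

Definition evalP F P : R := meval (fun i => P i 0) F.

Definition zero_set F : set point := [set P | evalP F P = 0].

Definition irreducible_mpoly F : Prop :=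
  [/\ F != 0, F \isn't a GRing.unit &
      forall G H : poly3, F = G * H ->
        G \is a GRing.unit \/ H \is a GRing.unit].

(* The dimension of a semialgebraic set is the largest d such that the set
   contains a continuous injective image of an open d-cube. *)
Definition contains_cell S (d : nat) : Prop :=
  let cube := [set x : 'rV[R]_d | forall j, 0 < x 0 j < 1] in
  exists f : 'rV[R]_d -> point,
    [/\ {within cube, continuous f}, set_inj cube f & f @` cube `<=` S].

Definition has_dim S (d : nat) : Prop :=
  contains_cell S d /\ forall e, (d < e)%N -> ~ contains_cell S e.

Definition du (V : normedModType R) (f : plane -> V) : plane -> V :=
  'D_((1, 0) : plane) f.
Definition dv (V : normedModType R) (f : plane -> V) : plane -> V :=
  'D_((0, 1) : plane) f.

Fixpoint Ck (k : nat) (U : set plane) f : Prop :=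
  (forall p, U p -> {for p, continuous f}) /\
  if k is k'.+1 then
    [/\ forall p, U p -> derivable f p ((1, 0) : plane),
        forall p, U p -> derivable f p ((0, 1) : plane),
        Ck k' U (du f) & Ck k' U (dv f)]
  else True.

(* X parametrizes, near its value P at p0, the level surface of F through P. *)
Definition local_parametrization F P X (p0 : plane) : Prop :=
  exists U : set plane,
    [/\ open U, U p0, X p0 = P & set_inj U X] /\
    [/\ forall k, Ck k U X,
        forall p, U p -> cross (du X p) (dv X p) != 0 &
        forall p, U p -> evalP F (X p) = evalP F P].

(* `|_| on column vectors is the max norm, hence the explicit square root. *)
Definition unit_normal X (p : plane) : point :=
  let n := cross (du X p) (dv X p) in (Num.sqrt (dot n n))^-1 *: n.

Definition gaussian_curvature X (p : plane) : R :=
  let E := dot (du X p) (du X p) in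
  let F := dot (du X p) (dv X p) in
  let G := dot (dv X p) (dv X p) in
  let N := unit_normal X p in
  let e := dot (du (du X) p) N in
  let f := dot (dv (du X) p) N in
  let g := dot (dv (dv X) p) N in
  (e * g - f ^+ 2) / (E * G - F ^+ 2).

Definition conormal X (p : plane) : point :=
  (`|gaussian_curvature X p| `^ (- (4%:R^-1))) *: unit_normal X p.

Definition affine_normal X (p : plane) : point :=
  let nu := conormal X in
  (det3 (nu p) (du nu p) (dv nu p))^-1 *: cross (du nu p) (dv nu p).

Definition curvature_not_identically_zero F : Prop :=
  exists P X p0, [/\ zero_set F P, local_parametrization F P X p0 &
                     gaussian_curvature X p0 != 0].

(* The rational function r is defined at P, with value x. *)
Definition frac_value (r : {fraction poly3}) P (x : R) : Prop :=
  exists n d : poly3,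
    [/\ evalP d P != 0, r = tofrac n / tofrac d & x = evalP n P / evalP d P].

Definition generic_point (prop : point -> Prop) : Prop :=
  exists2 G : poly3, G != 0 & forall P, evalP G P != 0 -> prop P.

Definition affine_normal_field F (gamma : 'cV[{fraction poly3}]_3) : Prop :=
  generic_point (fun P =>
    exists g : point, (forall i, frac_value (gamma i 0) P (g i 0)) /\
      exists X p0,
        [/\ local_parametrization F P X p0, gaussian_curvature X p0 != 0 &
            exists2 a : R, a != 0 & affine_normal X p0 = a *: g]).

Definition frac_const (x : R) : {fraction poly3} := tofrac (mpolyC 3 x).

(* The point (x, y, z) whose coordinates are the indeterminates. *)
Definition indeterminate_point : 'cV[{fraction poly3}]_3 :=
  \col_(i < 3) tofrac (mpolyX R (mnm1 i)).

Definition solves_L (gamma : 'cV[{fraction poly3}]_3) (ba : point * point)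
    : Prop :=
  let beta := map_mx frac_const ba.1 in
  let alpha := map_mx frac_const ba.2 in
  dot alpha (cross indeterminate_point gamma) + dot beta gamma = 0.

Definition solution_dim (gamma : 'cV[{fraction poly3}]_3) (D : nat) : Prop :=
  exists U : {vspace (point * point)%type},
    (forall ba, ba \in U <-> solves_L gamma ba) /\ \dim U = D.

Definition line Q w : set point := [set Q + t *: w | t in [set: R]].

Definition plucker Q w : point * point := (cross Q w, w).

Definition z_axis : set point := line 0 (vec3 0 0 1).

Definition coshR (t : R) : R := (expR t + expR (- t)) / 2.
Definition sinhR (t : R) : R := (expR t - expR (- t)) / 2.

Definition elliptic_mx (t : R) : 'M[R]_3 :=
  mx3 [:: [:: cos t; - sin t; 0];
          [:: sin t;   cos t; 0];
          [:: 0;       0;     1]].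

Definition hyperbolic_mx (t : R) : 'M[R]_3 :=
  mx3 [:: [:: coshR t; sinhR t; 0];
          [:: sinhR t; coshR t; 0];
          [:: 0;       0;       1]].

Definition rigid_motion (T : point -> point) : Prop :=
  exists (M : 'M[R]_3) (b : point),
    [/\ M^T *m M = 1%:M, \det M = 1 & forall P, T P = M *m P + b].

Definition rotation_surface (group : R -> 'M[R]_3) A S : Prop :=
  exists T : point -> point,
    [/\ rigid_motion T, T @` A = z_axis &
        forall t, mulmx (group t) @` (T @` S) = T @` S].

Definition elliptic_rotation_surface := rotation_surface elliptic_mx.
Definition hyperbolic_rotation_surface := rotation_surface hyperbolic_mx.

(* The planes normal to line Q w are the planes through Q + h w normal to w. *)
Definition normal_plane Q w (h : R) : set point :=
  [set P | dot (P - (Q + h *: w)) w = 0].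

Definition generic_normal_plane (prop : R -> Prop) : Prop :=
  exists2 q : {poly R}, q != 0 & forall h, q.[h] != 0 -> prop h.

(* O is in the plane, and e1, e2 are an orthonormal basis of its directions. *)
Definition plane_frame Q w h (O e1 e2 : point) : Prop :=
  [/\ normal_plane Q w h O, dot e1 w = 0 & dot e2 w = 0] /\
  [/\ dot e1 e1 = 1, dot e2 e2 = 1 & dot e1 e2 = 0].

Definition X0 (K : nzRingType) : {mpoly K[2]} := mpolyX K (mnm1 ord0).
Definition X1 (K : nzRingType) : {mpoly K[2]} := mpolyX K (mnm1 ord_max).

(* F (O + s e1 + t e2) as a polynomial in s, t. *)
Definition section F (O e1 e2 : point) : {mpoly R[2]} :=
  comp_mpoly [tuple mpolyC 2 (O i 0) + e1 i 0 *: X0 R + e2 i 0 *: X1 R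
             | i < 3] F.

(* Complete factorization is over the complex numbers: the factors are
   q - rho, with q the given quadratic form in the coordinates of a real
   frame centred at the common centre O, and rho nonzero, possibly not real.
   For instance the sections of the unit sphere are s^2 + t^2 - rho with rho
   negative for infinitely many planes, and (x^2 + y^2)^3 = z has sections with three factors,
   of which only one has rho real. *)
Definition factors_into (q : {mpoly (complex R)[2]}) F (O e1 e2 : point)
    : Prop :=
  exists (c : complex R) (rhos : seq (complex R)),
    [/\ c != 0, (0 < size rhos)%N, 0 \notin rhos &
        map_mpoly (real_complex R) (section F O e1 e2) =
        c *: \prod_(rho <- rhos) (q - mpolyC 2 rho)].

Definition section_concentric_circles F Q w h : Prop :=
  exists O e1 e2, plane_frame Q w h O e1 e2 /\
    factors_into (X0 _ ^+ 2 + X1 _ ^+ 2) F O e1 e2.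

(* The common asymptotes are the perpendicular lines through O directed by
   e1 and e2. *)
Definition section_rectangular_hyperbolas F Q w h : Prop :=
  exists O e1 e2, plane_frame Q w h O e1 e2 /\
    factors_into (X0 _ * X1 _) F O e1 e2.

End Surfaces.

(* Main.v *)
Require Import Defs.
From HB Require Import structures.
From mathcomp Require Import all_boot all_order all_algebra.
From mathcomp Require Import all_classical all_reals all_analysis.
From mathcomp Require Import ring lra zify.
Set Implicit Arguments.
Unset Strict Implicit.
Unset Printing Implicit Defensive.
Import Order.TTheory GRing.Theory Num.Theory.
Import numFieldNormedType.Exports.
Local Open Scope classical_set_scope.
Local Open Scope ring_scope.

(** Fix an orthonormal frame E1, E2 of the directions orthogonal to w and write
    points as Q + x E1 + y E2 + z w.  If only finitely many heights z carry a
    section of the required kind, a polynomial vanishing at these heights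
    witnesses genericity.  So assume that they are infinitely many; then
    polynomials in z may be compared at these heights.

    _The shape of F._  At such a height h the polynomial F(., ., h) is
    p(S[x - o1, y - o2]) for a quadratic form S and a centre (o1, o2).  Its
    gradient is orthogonal to the field of tangents of the conics, which is
    linear in the five coefficients of S[x - o1, y - o2].  Linear algebra over
    the field of rational functions of z ([poly_kernel]) then gives coefficients
    that are polynomials in z ([conic_polys]), and a second use of it gives
    D(z) F = Phi(z, S(z)[x - a(z), y - b(z)]) with a, b rational
    ([central_level]).

    _The affine normal._  Along a parametrized surface let N be any smooth normal
    field, and let W be proportional to |N|^4 times the Gaussian curvature, with
    a constant factor.  The affine conormal is W^(-1/4) N up to a constant factor,
    so the affine normal is parallel to
    (4 W N_u - W_u N) x (4 W N_v - W_v N) ([affine_normal_dot]).  For a level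
    surface of F in the above shape, N and W are explicit in the derivatives at z
    of S, a, b and of the radius r(z) of the level Phi(z, r) = c D(z), up to the
    third order.  Hence the affine normal is orthogonal to a given vector exactly
    when an explicit polynomial, [jdefect], vanishes ([affine_normal_defect],
    [defect_at]).

    _Letting the point go to infinity._  The hypothesis on the axis says that the
    affine normal at P is orthogonal to w x (P - Q) ([axis_defect]).  On one conic
    z = h, r = const, all the data of [jdefect] except the point are constant, so
    the equation holds on the whole conic, and its leading term at infinity
    vanishes too.  For hyperbolas the point goes to infinity along an asymptote:
    the first consequence is that S has constant direction
    ([rotating_direction]), and once the axes are the asymptotes, it is
    b (b'')^2 = 0 and a (a'')^2 = 0 ([hyperbola_center]).  For circles the point
    goes to a circular point at infinity, which gives
    (a'' + i b'')^2 (a + i b) = 0 ([circle_center]).  In both cases a and b are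
    affine functions of z, so the centres of the sections run on a line.

    _Uniqueness._  When S is constant and the centres are on a line, the affine
    normals meet that line ([center_line]), so it is a solution of the system as
    well ([center_solves]).  The solution space has dimension 1, so the line is
    the axis and a = b = 0 ([center_trivial]).  Therefore F depends only on z and
    on x^2 + y^2, or x^2 - y^2, hence its zero set is invariant under the group
    ([invariant_rotation_surface]). *)

(** * The defect of a vector and its terms at infinity *)

Section Spatial.
Variable K : comNzRingType.
Implicit Types (u v n o : K * K * K).

Definition dot3 u v : K := u.1.1 * v.1.1 + u.1.2 * v.1.2 + u.2 * v.2.
Definition cross3 u v : K * K * K :=
  (u.1.2 * v.2 - u.2 * v.1.2, u.2 * v.1.1 - u.1.1 * v.2,
   u.1.1 * v.1.2 - u.1.2 * v.1.1).
Definition lin3 (a : K) u (b : K) v : K * K * K :=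
  (a * u.1.1 + b * v.1.1, a * u.1.2 + b * v.1.2, a * u.2 + b * v.2).

Record sym3 := Sym3 { c11 : K; c12 : K; c13 : K; c22 : K; c23 : K; c33 : K }.

Definition app3 (H : sym3) u : K * K * K :=
  (c11 H * u.1.1 + c12 H * u.1.2 + c13 H * u.2,
   c12 H * u.1.1 + c22 H * u.1.2 + c23 H * u.2,
   c13 H * u.1.1 + c23 H * u.1.2 + c33 H * u.2).
Definition adj3 (H : sym3) : sym3 :=
  Sym3 (c22 H * c33 H - c23 H ^+ 2) (c13 H * c23 H - c12 H * c33 H)
       (c12 H * c23 H - c13 H * c22 H) (c11 H * c33 H - c13 H ^+ 2)
       (c12 H * c13 H - c11 H * c23 H) (c11 H * c22 H - c12 H ^+ 2).

(** Let n be a normal with n_u = H a, n_v = H b, let W_u = o.a, W_v = o.b, and let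
    a x b = k n, as for tangent vectors.  Then the determinant of v,
    4W n_u - W_u n and 4W n_v - W_v n is 4 W k times the defect ([det_defect]).
    The vectors a and b disappear because n_u x n_v = adj(H)(a x b). *)
Definition defect (W : K) n (H : sym3) o v : K :=
  4 * W * dot3 v (app3 (adj3 H) n)
  - dot3 v (cross3 n (app3 H (cross3 n o))).

Lemma defectE (W n1 n2 n3 h11 h12 h13 h22 h23 h33 o1 o2 o3 v1 v2 v3 : K) :
  defect W (n1, n2, n3) (Sym3 h11 h12 h13 h22 h23 h33) (o1, o2, o3) (v1, v2, v3) =
  4 * W * (v1 * ((h22 * h33 - h23 ^+ 2) * n1 + (h13 * h23 - h12 * h33) * n2 + (h12 * h23 - h13 * h22) * n3)
   + v2 * ((h13 * h23 - h12 * h33) * n1 + (h11 * h33 - h13 ^+ 2) * n2 + (h12 * h13 - h11 * h23) * n3)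
   + v3 * ((h12 * h23 - h13 * h22) * n1 + (h12 * h13 - h11 * h23) * n2 + (h11 * h22 - h12 ^+ 2) * n3))
  - (let c1 := n2 * o3 - n3 * o2 in let c2 := n3 * o1 - n1 * o3 in
     let c3 := n1 * o2 - n2 * o1 in
     let d1 := h11 * c1 + h12 * c2 + h13 * c3 in
     let d2 := h12 * c1 + h22 * c2 + h23 * c3 in
     let d3 := h13 * c1 + h23 * c2 + h33 * c3 in
     v1 * (n2 * d3 - n3 * d2) + v2 * (n3 * d1 - n1 * d3) + v3 * (n1 * d2 - n2 * d1)).
Proof. by []. Qed.

Lemma det_defect (W k : K) n H o v a b :
  cross3 a b = lin3 k n 0 n ->
  dot3 v (cross3 (lin3 (4 * W) (app3 H a) (- dot3 o a) n)
                 (lin3 (4 * W) (app3 H b) (- dot3 o b) n))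
  = 4 * W * k * defect W n H o v.
Proof.
case: n => [[n1 n2] n3]; case: v => [[v1 v2] v3]; case: o => [[ o1 o2] o3].
case: a => [[a1 a2] a3]; case: b => [[b1 b2] b3]; case: H => h11 h12 h13 h22 h23 h33.
rewrite /defect /dot3 /cross3 /app3 /adj3 /lin3 /= => -[e1 e2 e3].
rewrite !mul0r !addr0 in e1 e2 e3.
set c1 := (a2 * b3 - a3 * b2); set c2 := (a3 * b1 - a1 * b3); set c3 := (a1 * b2 - a2 * b1).
rewrite -/c1 -/c2 -/c3 in e1 e2 e3.
transitivity (16 * W ^+ 2 * dot3 (v1,v2,v3) (app3 (adj3 (Sym3 h11 h12 h13 h22 h23 h33)) (c1,c2,c3))
  - 4 * W * dot3 (v1,v2,v3) (cross3 (n1,n2,n3) (app3 (Sym3 h11 h12 h13 h22 h23 h33) (cross3 (c1,c2,c3) (o1,o2,o3))))).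
  rewrite /dot3 /cross3 /app3 /adj3 /lin3 /= /c1 /c2 /c3; ring.
rewrite e1 e2 e3 /dot3 /cross3 /app3 /adj3 /lin3 /=; ring.
Qed.

(** Horizontal lengths have weight 1 and the radius r of a level has weight 2,
    like the square of a length. *)
Lemma defect_scale (u W n1 n2 n3 h11 h12 h13 h22 h23 h33 o1 o2 o3 v1 v2 v3 : K) :
  defect (u ^+ 4 * W) (u * n1, u * n2, u ^+ 2 * n3)
    (Sym3 h11 h12 (u * h13) h22 (u * h23) (u ^+ 2 * h33))
    (u ^+ 3 * o1, u ^+ 3 * o2, u ^+ 4 * o3) (u * v1, u * v2, u ^+ 2 * v3) =
  u ^+ 8 * defect W (n1, n2, n3) (Sym3 h11 h12 h13 h22 h23 h33)
    (o1, o2, o3) (v1, v2, v3).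
Proof. rewrite /defect /dot3 /cross3 /app3 /adj3 /=; ring. Qed.

End Spatial.

(** The data of a family of central conics S[X] = r at a height z: the derivatives
    of order 0 to 3 of S = (s11, s12, s22) and of the centre A, and those of order
    1 to 3 of the radius r. *)
Record jet (K : Type) := Jet {
  S0 : K * K * K; S1 : K * K * K; S2 : K * K * K; S3 : K * K * K;
  A0 : K * K; A1 : K * K; A2 : K * K; A3 : K * K;
  G1 : K; G2 : K; G3 : K }.

Section Jets.
Variable K : comNzRingType.
Implicit Types (J : jet K) (S : K * K * K) (X Y : K).
Definition qf S X Y := S.1.1 * X ^+ 2 + 2 * S.1.2 * X * Y + S.2 * Y ^+ 2.
Definition sx S X Y := S.1.1 * X + S.1.2 * Y.
Definition sy S X Y := S.1.2 * X + S.2 * Y.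
Definition dets S := S.1.1 * S.2 - S.1.2 ^+ 2.
Definition qadj S X Y := S.2 * X ^+ 2 - 2 * S.1.2 * X * Y + S.1.1 * Y ^+ 2.
Definition badj S X Y X' Y' := S.2 * X * X' - S.1.2 * (X * Y' + Y * X') + S.1.1 * Y * Y'.

(** The functions below are evaluated at the point (X, Y) of the conic, relative to
    its centre, in coordinates that move with the centre.  The normal [jn] is the
    gradient of S(z)[X, Y] - r(z); its derivative along a tangent vector T is
    [jH] T; the numerator of the Gaussian curvature is [jW], up to a constant, and
    its derivative along T is the product of [jo] with T. *)
Definition jn J X Y := (2 * sx (S0 J) X Y, 2 * sy (S0 J) X Y, qf (S1 J) X Y - G1 J).
Definition jh33 J X Y := qf (S2 J) X Y
  - 2 * (sx (S0 J) X Y * (A2 J).1 + sy (S0 J) X Y * (A2 J).2) - G2 J.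
Definition jH J X Y := Sym3 (2 * (S0 J).1.1) (2 * (S0 J).1.2) (2 * sx (S1 J) X Y)
  (2 * (S0 J).2) (2 * sy (S1 J) X Y) (jh33 J X Y).
Definition jQ J X Y := qf (S1 J) X Y + G1 J.
Definition jL J X Y := dets (S0 J) * jh33 J X Y
  - 2 * qadj (S0 J) (sx (S1 J) X Y) (sy (S1 J) X Y).
Definition jW J X Y := 2 * qf (S0 J) X Y * jL J X Y + dets (S0 J) * jQ J X Y ^+ 2.
Definition dets' J := (S1 J).1.1 * (S0 J).2 + (S0 J).1.1 * (S1 J).2 - 2 * (S0 J).1.2 * (S1 J).1.2.
Definition jo1 J X Y := 2 * qf (S0 J) X Y *
   (dets (S0 J) * (2 * sx (S2 J) X Y - 2 * sx (S0 J) (A2 J).1 (A2 J).2)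
   - 4 * badj (S0 J) (sx (S1 J) X Y) (sy (S1 J) X Y) (S1 J).1.1 (S1 J).1.2)
   + 4 * dets (S0 J) * jQ J X Y * sx (S1 J) X Y.
Definition jo2 J X Y := 2 * qf (S0 J) X Y *
   (dets (S0 J) * (2 * sy (S2 J) X Y - 2 * sy (S0 J) (A2 J).1 (A2 J).2)
   - 4 * badj (S0 J) (sx (S1 J) X Y) (sy (S1 J) X Y) (S1 J).1.2 (S1 J).2)
   + 4 * dets (S0 J) * jQ J X Y * sy (S1 J) X Y.
Definition jh33' J X Y := qf (S3 J) X Y
    - 2 * (sx (S0 J) X Y * (A3 J).1 + sy (S0 J) X Y * (A3 J).2)
    - 2 * (sx (S1 J) X Y * (A2 J).1 + sy (S1 J) X Y * (A2 J).2) - G3 J.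
Definition jo3 J X Y := 2 * G1 J * jL J X Y + 2 * qf (S0 J) X Y * (dets' J * jh33 J X Y
  + dets (S0 J) * jh33' J X Y
  - 4 * badj (S0 J) (sx (S1 J) X Y) (sy (S1 J) X Y) (sx (S2 J) X Y) (sy (S2 J) X Y)
  - 2 * qadj (S1 J) (sx (S1 J) X Y) (sy (S1 J) X Y))
  + dets' J * jQ J X Y ^+ 2 + 2 * dets (S0 J) * jQ J X Y * (qf (S2 J) X Y + G2 J).
Definition jo J X Y := (jo1 J X Y, jo2 J X Y, jo3 J X Y).
Definition jdefect J v X Y := defect (jW J X Y) (jn J X Y) (jH J X Y) (jo J X Y) v.
(** The field of rotations about the axis, of direction (0, 0, 1): the last
    component comes from the moving coordinates. *)
Definition axisv J X Y : K * K * K :=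
  (- (Y + (A0 J).2), X + (A0 J).1, - (Y + (A0 J).2) * (A1 J).1 + (X + (A0 J).1) * (A1 J).2).

Lemma jWE J X Y : 4 * jW J X Y = dot3 (jn J X Y) (app3 (adj3 (jH J X Y)) (jn J X Y)).
Proof.
rewrite /jW /jL /jQ /jn /jH; move: (jh33 J X Y) (G1 J) => h g.
case: (S0 J) (S1 J) => [[a b] c] [[a1 b1] c1].
rewrite /dot3 /app3 /adj3 /= /qf /sx /sy /dets /qadj /=; ring.
Qed.

(** The jet after all horizontal lengths are multiplied by u: a point at a distance
    of order 1 / u comes back to a finite place, and at u = 0 only S is left. *)
Definition jscale (u : K) J := Jet (S0 J) (S1 J) (S2 J) (S3 J)
  (u * (A0 J).1, u * (A0 J).2) (u * (A1 J).1, u * (A1 J).2)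
  (u * (A2 J).1, u * (A2 J).2) (u * (A3 J).1, u * (A3 J).2)
  (u ^+ 2 * G1 J) (u ^+ 2 * G2 J) (u ^+ 2 * G3 J).

Lemma qfZ u S X Y : qf S (u * X) (u * Y) = u ^+ 2 * qf S X Y.
Proof. rewrite /qf; ring. Qed.
Lemma sxZ u S X Y : sx S (u * X) (u * Y) = u * sx S X Y.
Proof. rewrite /sx; ring. Qed.
Lemma syZ u S X Y : sy S (u * X) (u * Y) = u * sy S X Y.
Proof. rewrite /sy; ring. Qed.
Lemma qadjZ u S X Y : qadj S (u * X) (u * Y) = u ^+ 2 * qadj S X Y.
Proof. rewrite /qadj; ring. Qed.
Lemma badjZl u S X Y X' Y' : badj S (u * X) (u * Y) X' Y' = u * badj S X Y X' Y'.
Proof. rewrite /badj; ring. Qed.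
Lemma badjZr u S X Y X' Y' : badj S X Y (u * X') (u * Y') = u * badj S X Y X' Y'.
Proof. rewrite /badj; ring. Qed.
Definition jZ := (qfZ, sxZ, syZ, qadjZ, badjZl, badjZr).

Lemma jdefect_scale u J X Y :
  jdefect (jscale u J) (axisv (jscale u J) (u * X) (u * Y)) (u * X) (u * Y)
  = u ^+ 8 * jdefect J (axisv J X Y) X Y.
Proof.
rewrite /jdefect; case E: (jn J X Y) => [[n1 n2] n3].
case Eo: (jo J X Y) => [[ o1 o2] o3].
case Ev: (axisv J X Y) => [[v1 v2] v3].
case EH: (jH J X Y) => [h11 h12 h13 h22 h23 h33].
have h33E : jh33 (jscale u J) (u * X) (u * Y) = u ^+ 2 * jh33 J X Y.
  by rewrite /jh33 /= !jZ; ring.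
have LE : jL (jscale u J) (u * X) (u * Y) = u ^+ 2 * jL J X Y.
  by rewrite /jL h33E /= !jZ; ring.
have QE : jQ (jscale u J) (u * X) (u * Y) = u ^+ 2 * jQ J X Y.
  by rewrite /jQ /= !jZ; ring.
have h33E' : jh33' (jscale u J) (u * X) (u * Y) = u ^+ 2 * jh33' J X Y.
  by rewrite /jh33' /= !jZ; ring.
rewrite -defect_scale; congr defect.
- by rewrite /jW LE QE /= !jZ; ring.
- move: E; rewrite /jn /= => -[<- <- <-]; rewrite !jZ.
  by congr (_, _, _); ring.
- move: EH; rewrite /jH /= => -[<- <- <- <- <- <-]; rewrite !jZ h33E.
  by congr Sym3; ring.
- move: Eo; rewrite /jo /jo1 /jo2 /jo3 LE QE h33E h33E' /= => -[<- <- <-].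
  by rewrite !jZ; congr (_, _, _); ring.
- move: Ev; rewrite /axisv /= => -[<- <- <-].
  by congr (_, _, _); ring.
Qed.

Definition Jconst S a0 a1 a2 a3 g1 g2 g3 :=
  Jet S (0,0,0) (0,0,0) (0,0,0) a0 a1 a2 a3 g1 g2 g3.

(** If S is constant and the centres run on a line, a shear, which preserves affine
    normals, makes that line vertical; the surface is then invariant under the
    linear maps about it that preserve S, so the affine normals meet it.  In
    coordinates, the gradient of W is vertical. *)
Lemma center_line S a0 a1 a3 g1 g2 g3 X Y :
  jdefect (Jconst S a0 a1 (0,0) a3 g1 g2 g3) (- Y, X, 0) X Y = 0.
Proof.
case: S => [[a b] c].
set J := Jconst _ _ _ _ _ _ _ _; rewrite /jdefect.
have -> : jo J X Y = (0, 0, (jo J X Y).2).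
  rewrite /jo /jo1 /jo2 /= /jQ /= /badj /qf /sx /sy /=; congr (_, _, _); ring.
rewrite /jn /jH /=; move: (jW J X Y) (jo3 J X Y) (jh33 J X Y) => W o h.
rewrite defectE /= /sx /sy /=; ring.
Qed.
End Jets.

Section Limit1.
Variable K : comNzRingType.
Implicit Types (J : jet K).

(** The vector (c, n) is an asymptotic direction of S0, which leaves in W only
    det(S0) times the square of S1[c, n]. *)
Lemma lead_rotating (c n k s t : K) S2' S3' :
  jdefect (Jet (- (2 * c * n * k), (c ^+ 2 - n ^+ 2) * k, 2 * c * n * k) (s, t, - s)
            S2' S3' (0,0) (0,0) (0,0) (0,0) 0 0 0)
          (- n, c, 0) c n
  = 8 * k ^+ 3 * (s * (c ^+ 2 - n ^+ 2) + 2 * t * c * n) ^+ 4 * (c ^+ 2 + n ^+ 2) ^+ 3.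
Proof.
set J := Jet _ _ _ _ _ _ _ _ _ _ _; rewrite /jdefect.
have q0 : qf (S0 J) c n = 0 by rewrite /qf /=; ring.
rewrite /jo /jo1 /jo2 /jW q0 /jH /jn; move: (jh33 J c n) (jo3 J c n) => h o.
rewrite !(mulr0, mul0r, add0r) /jQ addr0 subr0 /=.
rewrite defectE /= /qf /sx /sy /dets /=; ring.
Qed.
End Limit1.

Section Limit2.
Variable K : comNzRingType.
Implicit Types (a : K * K) (g x y u z D r i : K).

(** For the hyperbolas 2XY = r, this is u^3 times the defect at (x / u, y u), freed
    of its denominators: the value at u = 0 belongs to the point at infinity of the
    first asymptote. *)
Definition hyp_defect a0 a1 a2 a3 g1 g2 g3 x y u : K :=
  let p := x * y in
  let h := - 2 * (y * u ^+ 2 * a2.1 + x * a2.2) - u * g2 in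
  let W := - (4 * p * h + u * g1 ^+ 2) in
  let v1 := - (u * y + a0.2) in
  let v2 := u * (x + u * a0.1) in
  let v3 := - (u * y + a0.2) * a1.1 * u + (x + u * a0.1) * a1.2 in
  let o1 := 8 * p * a2.2 in
  let o2 := 8 * p * a2.1 * u ^+ 2 in
  let o3 := - 2 * g1 * (h + u * g2) + 4 * p * (2 * (y * u ^+ 2 * a3.1 + x * a3.2) + u * g3) in
  let c1 := 2 * x * o3 + g1 * o2 in
  let c2 := - g1 * o1 - 2 * y * o3 in
  let c3 := 2 * y * o2 - 2 * x * o1 in
  4 * W * (- 2 * h * (2 * x * v1 + 2 * y * v2) + 4 * u * g1 * v3)
  - (v1 * (2 * x * h * c3 + g1 * (2 * u * c1))
     + v2 * (- g1 * (2 * u * c2) - 2 * y * h * c3)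
     + v3 * (2 * y * (2 * u * c1) - 2 * x * (2 * u * c2))).

Lemma hyp_defectE a0 a1 a2 a3 g1 g2 g3 x y u z : z * u = 1 ->
  let J := Jconst (0,1,0) a0 a1 a2 a3 g1 g2 g3 in
  hyp_defect a0 a1 a2 a3 g1 g2 g3 x y u =
  u ^+ 3 * jdefect J (axisv J (x * z) (y * u)) (x * z) (y * u).
Proof.
move=> zu /=.
set J := Jconst _ _ _ _ _ _ _ _.
have hE : u * jh33 J (x * z) (y * u) = - 2 * (y * u ^+ 2 * a2.1 + x * a2.2) - u * g2.
  by rewrite /jh33 /qf /sx /sy /=; ring: zu.
rewrite /jdefect.
have E : u ^+ 3 * defect (jW J (x * z) (y * u)) (2 * y * u, 2 * x * z, - g1)
   (Sym3 0 2 0 0 0 (jh33 J (x * z) (y * u)))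
   (8 * x * y * a2.2, 8 * x * y * a2.1, (jo J (x * z) (y * u)).2) (axisv J (x * z) (y * u))
   = hyp_defect a0 a1 a2 a3 g1 g2 g3 x y u.
  rewrite /jo /jo3 /jh33' /jW /jL /jQ /dets' /qadj /badj /qf /sx /sy /dets /=.
  set h := jh33 _ _ _ in hE *.
  rewrite /hyp_defect -hE.
  rewrite /axisv defectE /=. clearbody h.
  by ring: zu.
have En : jn J (x * z) (y * u) = (2 * y * u, 2 * x * z, - g1).
  by rewrite /jn /qf /sx /sy /=; congr (_, _, _); ring.
have EH : jH J (x * z) (y * u) = Sym3 0 2 0 0 0 (jh33 J (x * z) (y * u)).
  by rewrite /jH /sx /sy /=; congr Sym3; ring.
have Eo : jo J (x * z) (y * u) =
    (8 * x * y * a2.2, 8 * x * y * a2.1, (jo J (x * z) (y * u)).2).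
  by rewrite /jo /jo1 /jo2 /jQ /badj /qf /sx /sy /dets /=; congr (_, _, _); ring: zu.
by rewrite En EH Eo E.
Qed.

Lemma hyp_defect0 a0 a1 a2 a3 g1 g2 g3 x y :
  hyp_defect a0 a1 a2 a3 g1 g2 g3 x y 0 = - 192 * (x * y) * x ^+ 3 * a0.2 * a2.2 ^+ 2.
Proof. rewrite /hyp_defect /=; ring. Qed.

(** For the circles X^2 + Y^2 = r, this is D^3 times the defect at (x / D, y / D),
    freed of its denominators: D = 0 and y = i x is a circular point at
    infinity. *)
Definition circ_defect a0 a1 a2 a3 g1 g2 g3 r x y D : K :=
  let h := - 2 * (x * a2.1 + y * a2.2) - D * g2 in
  let W := 2 * r * h + D * g1 ^+ 2 in
  let v1 := - (y + D * a0.2) in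
  let v2 := x + D * a0.1 in
  let v3 := - (y + D * a0.2) * a1.1 + (x + D * a0.1) * a1.2 in
  let o1 := - 4 * r * a2.1 in
  let o2 := - 4 * r * a2.2 in
  let o3 := 2 * g1 * (h + D * g2) + 2 * r * (- 2 * (x * a3.1 + y * a3.2) - D * g3) in
  let c1 := 2 * y * o3 + g1 * o2 * D ^+ 2 in
  let c2 := - g1 * o1 * D ^+ 2 - 2 * x * o3 in
  let c3 := 2 * x * o2 - 2 * y * o1 in
  4 * W * (4 * h * (y * a0.1 - x * a0.2) - 4 * g1 * v3 * D)
  - (h * c3 * (- 2 * r * D - 2 * (a0.2 * y + a0.1 * x))
     - 2 * g1 * (v2 * c1 - v1 * c2)
     + 2 * v3 * D * (- g1 * (2 * x * o1 + 2 * y * o2) - 4 * r * o3)).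

Lemma circ_defectE a0 a1 a2 a3 g1 g2 g3 x y D z : z * D = 1 ->
  let J := Jconst (1,0,1) a0 a1 a2 a3 g1 g2 g3 in
  circ_defect a0 a1 a2 a3 g1 g2 g3 ((x * z) ^+ 2 + (y * z) ^+ 2) x y D =
  D ^+ 3 * jdefect J (axisv J (x * z) (y * z)) (x * z) (y * z).
Proof.
move=> zu /=.
set J := Jconst _ _ _ _ _ _ _ _.
have -> : x = D * (x * z) by rewrite mulrCA [D * z]mulrC zu mulr1.
have -> : y = D * (y * z) by rewrite mulrCA [D * z]mulrC zu mulr1.
have xz t : D * t * z = t by rewrite mulrC mulrA zu mul1r.
rewrite !xz; move: (x * z) (y * z) => {xz} {}x {}y.
have hE : D * jh33 J x y = - 2 * (D * x * a2.1 + D * y * a2.2) - D * g2.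
  by rewrite /jh33 /qf /sx /sy /=; ring.
rewrite /jdefect.
have E : D ^+ 3 * defect (jW J x y) (2 * x, 2 * y, - g1)
   (Sym3 2 0 0 2 0 (jh33 J x y))
   (- 4 * (x^+2+y^+2) * a2.1, - 4 * (x^+2+y^+2) * a2.2, (jo J x y).2) (axisv J x y)
   = circ_defect a0 a1 a2 a3 g1 g2 g3 (x ^+ 2 + y ^+ 2) (D * x) (D * y) D.
  rewrite /jo /jo3 /jh33' /jW /jL /jQ /dets' /qadj /badj /qf /sx /sy /dets /=.
  set h := jh33 _ _ _ in hE *.
  rewrite /circ_defect -hE.
  rewrite /axisv defectE /=. clearbody h.
  by ring.
have En : jn J x y = (2 * x, 2 * y, - g1).
  by rewrite /jn /qf /sx /sy /=; congr (_, _, _); ring.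
have EH : jH J x y = Sym3 2 0 0 2 0 (jh33 J x y).
  by rewrite /jH /sx /sy /=; congr Sym3; ring.
have Eo : jo J x y =
    (- 4 * (x^+2+y^+2) * a2.1, - 4 * (x^+2+y^+2) * a2.2, (jo J x y).2).
  by rewrite /jo /jo1 /jo2 /jQ /badj /qf /sx /sy /dets /=; congr (_, _, _); ring.
by rewrite En EH Eo E.
Qed.

Lemma circ_defect0 a0 a1 a2 a3 g1 g2 g3 r x i : i ^+ 2 = - 1 ->
  circ_defect a0 a1 a2 a3 g1 g2 g3 r x (x * i) 0 =
  96 * i * r * x ^+ 3 * (a2.1 + a2.2 * i) ^+ 2 * (a0.1 + a0.2 * i).
Proof. move=> i2; rewrite /circ_defect /=; ring: i2. Qed.

End Limit2.

(** * Vector algebra in space *)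

Section Coordinates.
Variable K : comNzRingType.
Implicit Types u v w : 'cV[K]_3.

Definition coords u : K * K * K := (u i0 0, u i1 0, u i2 0).

Lemma ord3P (P : 'I_3 -> Prop) : P i0 -> P i1 -> P i2 -> forall i, P i.
Proof.
move=> P0 P1 P2 [[|[|[|//]]] Hi].
- by rewrite (_ : Ordinal Hi = i0); last exact: val_inj.
- by rewrite (_ : Ordinal Hi = i1); last exact: val_inj.
- by rewrite (_ : Ordinal Hi = i2); last exact: val_inj.
Qed.

Lemma col3P u v : coords u = coords v -> u = v.
Proof.
by move=> [e0 e1 e2]; apply/colP; apply: ord3P.
Qed.

Lemma sum3E (f : 'I_3 -> K) : \sum_i f i = f i0 + f i1 + f i2.
Proof.
rewrite !big_ord_recl big_ord0 addr0 addrA.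
by congr (f _ + f _ + f _); apply: val_inj.
Qed.

Lemma dotE u v : dot u v = dot3 (coords u) (coords v).
Proof. exact: sum3E. Qed.

Lemma crossE u v : coords (cross u v) = cross3 (coords u) (coords v).
Proof. by rewrite /coords /cross !mxE. Qed.

Lemma det3E u v w : det3 u v w = dot u (cross v w).
Proof.
rewrite /det3 (expand_det_row _ i0) !big_ord_recl big_ord0 /cofactor.
rewrite !(expand_det_row _ ord0) !big_ord_recl !big_ord0 /cofactor !det_mx11 !mxE /=.
rewrite dotE crossE /dot3 /cross3 /= /bump /= !expr0 !expr1.
by ring.
Qed.

Lemma dotC u v : dot u v = dot v u.
Proof. by rewrite !dotE /dot3 ![_ * (coords u).1.1]mulrC; ring. Qed.
Lemma dotDl u v w : dot (u + v) w = dot u w + dot v w.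
Proof. by rewrite !dotE /dot3 /= !mxE; ring. Qed.
Lemma dotDr u v w : dot u (v + w) = dot u v + dot u w.
Proof. by rewrite !dotE /dot3 /= !mxE; ring. Qed.
Lemma dotNl u v : dot (- u) v = - dot u v.
Proof. by rewrite !dotE /dot3 /= !mxE; ring. Qed.
Lemma dotNr u v : dot u (- v) = - dot u v.
Proof. by rewrite !dotE /dot3 /= !mxE; ring. Qed.
Lemma dotZl a u v : dot (a *: u) v = a * dot u v.
Proof. by rewrite !dotE /dot3 /= !mxE; ring. Qed.
Lemma dotZr a u v : dot u (a *: v) = a * dot u v.
Proof. by rewrite !dotE /dot3 /= !mxE; ring. Qed.
Definition dot_lin := (dotDl, dotDr, dotNl, dotNr, dotZl, dotZr).

Lemma crossDl u v w : cross (u + v) w = cross u w + cross v w.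
Proof. by apply: col3P; rewrite /coords /cross !mxE /=; congr (_, _, _); ring. Qed.
Lemma crossDr u v w : cross w (u + v) = cross w u + cross w v.
Proof. by apply: col3P; rewrite /coords /cross !mxE /=; congr (_, _, _); ring. Qed.
Lemma crossZl a u v : cross (a *: u) v = a *: cross u v.
Proof. by apply: col3P; rewrite /coords /cross !mxE /=; congr (_, _, _); ring. Qed.
Lemma crossZr a u v : cross u (a *: v) = a *: cross u v.
Proof. by apply: col3P; rewrite /coords /cross !mxE /=; congr (_, _, _); ring. Qed.
Lemma cross0r u : cross u 0 = 0.
Proof. by apply: col3P; rewrite /coords /cross !mxE /=; congr (_, _, _); ring. Qed.
Lemma crossvv u : cross u u = 0.
Proof. by apply: col3P; rewrite /coords /cross !mxE /=; congr (_, _, _); ring. Qed.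
Lemma crossNC u v : cross u v = - cross v u.
Proof. by apply: col3P; rewrite /coords /cross !mxE /=; congr (_, _, _); ring. Qed.

Lemma dot_cross u v w z :
  dot (cross u v) (cross w z) = dot u w * dot v z - dot u z * dot v w.
Proof. rewrite !dotE !crossE /dot3 /cross3 /=; ring. Qed.

Lemma dot_cross2 u v :
  dot (cross u v) (cross u v) = dot u u * dot v v - dot u v ^+ 2.
Proof. by rewrite dot_cross [dot v u]dotC expr2. Qed.

Lemma cross_cross u v w : cross u (cross v w) = dot u w *: v - dot u v *: w.
Proof.
apply: col3P; rewrite /coords /cross !dotE /dot3 !mxE /=.
by congr (_, _, _); ring.
Qed.

Lemma cross_orthogonal u v w : dot u v = 0 -> dot u w = 0 -> cross u (cross v w) = 0.
Proof. by move=> uv uw; rewrite cross_cross uv uw !scale0r subrr. Qed.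

Lemma dot_cross_l u v : dot u (cross u v) = 0.
Proof. rewrite !dotE crossE /dot3 /cross3 /=; ring. Qed.
Lemma dot_cross_r u v : dot v (cross u v) = 0.
Proof. rewrite !dotE crossE /dot3 /cross3 /=; ring. Qed.
End Coordinates.

Section RealVec.
Variable R : realDomainType.
Implicit Types u v w n : 'cV[R]_3.
Lemma dotvv_ge0 u : 0 <= dot u u.
Proof. by rewrite dotE /dot3 !addr_ge0 // -expr2 sqr_ge0. Qed.
Lemma dotvv_eq0 u : (dot u u == 0) = (u == 0).
Proof.
apply/eqP/eqP => [|->]; last by rewrite dotE /dot3 /= !mxE !mul0r !addr0.
rewrite dotE /dot3 /= -!expr2 => /eqP.
rewrite paddr_eq0 ?addr_ge0 ?sqr_ge0 // paddr_eq0 ?sqr_ge0 // !sqrf_eq0.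
move=> /andP[/andP[/eqP e0 /eqP e1] /eqP e2].
by apply: col3P; rewrite /coords e0 e1 e2 !mxE.
Qed.
Lemma dotvv_gt0 u : (0 < dot u u) = (u != 0).
Proof. by rewrite lt_def dotvv_ge0 dotvv_eq0 andbT. Qed.
End RealVec.

(** * Derivatives of functions of two parameters *)

Section Derivatives.
Variable R : realType.
Local Notation plane := (R * R)%type.
Implicit Types (f g : plane -> R) (p v : plane).

Lemma is_derive_add f g p v df dg : is_derive p v f df -> is_derive p v g dg ->
  is_derive p v (fun q => f q + g q) (df + dg).
Proof. exact: is_deriveD. Qed.
Lemma is_derive_sub f g p v df dg : is_derive p v f df -> is_derive p v g dg ->
  is_derive p v (fun q => f q - g q) (df - dg).
Proof. exact: is_deriveB. Qed.
Lemma is_derive_mul f g p v df dg : is_derive p v f df -> is_derive p v g dg ->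
  is_derive p v (fun q => f q * g q) (df * g p + f p * dg).
Proof.
move=> hf hg.
have h : is_derive p v (fun q => f q * g q) _ := is_deriveM hf hg.
apply: (is_derive_eq h).
by rewrite /GRing.scale /= addrC mulrC.
Qed.

(** Restricted to the line through p directed by v, this is the chain rule in one
    variable. *)
Lemma is_derive_comp1 f p v df (h : R -> R) dh :
  is_derive p v f df -> is_derive (f p) 1 h dh ->
  is_derive p v (fun q => h (f q)) (dh * df).
Proof.
move=> [fd fE] hd.
pose l := fun t : R => f (t *: v + p).
have l0 : l 0 = f p by rewrite /l scale0r add0r.
have ld : is_derive (0 : R) 1 l df.
  apply: DeriveDef; first exact: ((derivable1P f p v).1 fd).
  rewrite -fE /derive; set g1 := fun h0 => h0^-1 *: _; set g2 := fun h0 => h0^-1 *: _.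
  suff -> : g1 = g2 by [].
  rewrite /g1 /g2.
  by apply: funext => t; rewrite /l /= addr0 scale0r add0r [_%:A]mulr1.
have hd' : is_derive (l 0) 1 h dh by rewrite l0.
have [cd cE] := is_derive1_comp hd' ld.
apply: DeriveDef; first exact: ((derivable1P (fun q => h (f q)) p v).2 cd).
rewrite -cE /derive; set g1 := fun h0 => h0^-1 *: _; set g2 := fun h0 => h0^-1 *: _.
  suff -> : g1 = g2 by [].
  rewrite /g1 /g2.
by apply: funext => t; rewrite /l /= addr0 scale0r add0r [_%:A]mulr1.
Qed.

Lemma is_derive_coord (X : plane -> 'cV[R]_3) p v dX i :
  is_derive p v X dX -> is_derive p v (fun q => X q i 0) (dX i 0).
Proof.
move=> [Xd <-]; apply: DeriveDef; first exact: ((derivable_mxP _ _ _).1 Xd).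
by rewrite derive_mx // mxE.
Qed.

Lemma is_derive_vec (X : plane -> 'cV[R]_3) p v (dX : 'cV[R]_3) :
  (forall i, is_derive p v (fun q => X q i 0) (dX i 0)) -> is_derive p v X dX.
Proof.
move=> h; have Xd : derivable X p v.
  by apply/derivable_mxP => i j; rewrite ord1; case: (h i).
apply: DeriveDef => //; rewrite derive_mx //; apply/colP => i.
by rewrite mxE; case: (h i).
Qed.

Lemma is_derive_dot (X Y : plane -> 'cV[R]_3) p v dX dY :
  is_derive p v X dX -> is_derive p v Y dY ->
  is_derive p v (fun q => dot (X q) (Y q)) (dot dX (Y p) + dot (X p) dY).
Proof.
move=> hX hY; pose m i := is_derive_mul (is_derive_coord i hX) (is_derive_coord i hY).
have h := is_derive_add (is_derive_add (m i0) (m i1)) (m i2).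
rewrite (_ : (fun q => dot (X q) (Y q)) =
    fun q => X q i0 0 * Y q i0 0 + X q i1 0 * Y q i1 0 + X q i2 0 * Y q i2 0);
    last by apply: funext => q; rewrite dotE.
apply: (is_derive_eq h); by rewrite !dotE /dot3 /=; ring.
Qed.

Lemma is_derive_scale f (X : plane -> 'cV[R]_3) p v df dX :
  is_derive p v f df -> is_derive p v X dX ->
  is_derive p v (fun q => f q *: X q) (df *: X p + f p *: dX).
Proof.
move=> hf hX; apply: is_derive_vec => i.
rewrite (_ : (fun q => (f q *: X q) i 0) = fun q => f q * X q i 0); last first.
  by apply: funext => q; rewrite mxE.
rewrite !mxE; apply: is_derive_mul => //; exact: is_derive_coord.
Qed.

Lemma is_derive_near0 f p v df : (\near p, f p = 0) -> is_derive p v f df -> df = 0.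
Proof.
move=> f0 hf; have : is_derive p v (cst 0 : plane -> R) df.
  exact: near_eq_is_derive hf.
by move=> [_ <-]; rewrite derive_cst.
Qed.

Lemma continuous_coord (X : plane -> 'cV[R]_3) p i :
  {for p, continuous X} -> {for p, continuous (fun q => X q i 0)}.
Proof.
move=> cX; apply: (@continuous_comp _ _ _ X (fun u : 'cV[R]_3 => u i 0)) => //.
exact: coord_continuous.
Qed.

Lemma continuous_dot (X Y : plane -> 'cV[R]_3) p :
  {for p, continuous X} -> {for p, continuous Y} ->
  {for p, continuous (fun q => dot (X q) (Y q))}.
Proof.
move=> cX cY.
rewrite (_ : (fun q => dot (X q) (Y q)) =
    fun q => X q i0 0 * Y q i0 0 + X q i1 0 * Y q i1 0 + X q i2 0 * Y q i2 0);
    last by apply: funext => q; rewrite dotE.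
by apply: continuousD; [apply: continuousD|]; apply: continuousM;
  apply: continuous_coord.
Qed.

Lemma continuous_vec (X : plane -> 'cV[R]_3) p :
  (forall i, {for p, continuous (fun q => X q i 0)}) -> {for p, continuous X}.
Proof.
move=> hX; apply/cvgrPdist_le => /= e e0; near=> q.
rewrite [leLHS]/Num.Def.normr /= mx_normrE (bigmax_le _ (ltW e0)) //= => -[i j] _.
rewrite ord1 !mxE /=; move: i {j}; near: q; apply: filter_forall => i.
exact: ((cvgrPdist_le _ _).1 (hX i)).
Unshelve. all: by end_near. Qed.

Lemma continuous_cross (X Y : plane -> 'cV[R]_3) p :
  {for p, continuous X} -> {for p, continuous Y} ->
  {for p, continuous (fun q => cross (X q) (Y q))}.
Proof.
move=> cX cY; have h i j k l : {for p, continuous (fun q =>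
    X q i 0 * Y q j 0 - X q k 0 * Y q l 0)}.
  by apply: continuousB; apply: continuousM; apply: continuous_coord.
apply: continuous_vec; apply: ord3P.
- rewrite (_ : (fun q => cross (X q) (Y q) i0 0) = fun q =>
    X q i1 0 * Y q i2 0 - X q i2 0 * Y q i1 0) //.
  by apply: funext => q; rewrite /cross mxE.
- rewrite (_ : (fun q => cross (X q) (Y q) i1 0) = fun q =>
    X q i2 0 * Y q i0 0 - X q i0 0 * Y q i2 0) //.
  by apply: funext => q; rewrite /cross mxE.
- rewrite (_ : (fun q => cross (X q) (Y q) i2 0) = fun q =>
    X q i0 0 * Y q i1 0 - X q i1 0 * Y q i0 0) //.
  by apply: funext => q; rewrite /cross mxE.
Qed.

Lemma continuous_sg f p : {for p, continuous f} -> f p != 0 ->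
  \forall q \near p, Num.sg (f q) = Num.sg (f p).
Proof.
move=> cf; case: (ltgtP (f p) 0) => // h _.
  near=> q; have hq : f q < 0 by near: q; exact: (cvgr_lt (f p) cf).
  by rewrite !ltr0_sg.
near=> q; have hq : 0 < f q by near: q; exact: (cvgr_gt (f p) cf).
by rewrite !gtr0_sg.
Unshelve. all: by end_near. Qed.
End Derivatives.

(** * The affine normal in terms of an arbitrary normal field *)

Lemma powR_quarter (R : realType) (x y : R) : 0 <= x -> 0 <= y ->
  (x * (y ^+ 2)^-1) `^ (- (4%:R^-1)) = x `^ (- (4%:R^-1)) * Num.sqrt y.
Proof.
move=> x0 y0; rewrite powRM ?invr_ge0 ?sqr_ge0 //.
rewrite -[(y ^+ 2)^-1]powR_invn // -powRrM -powR12_sqrt //.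
by congr (_ * _ `^ _); field.
Qed.

Section AffineNormal.
Variable R : realType.
Local Notation plane := (R * R)%type.
Local Notation point := 'cV[R]_3.
Variables (X N Nu Nv : plane -> point) (W : plane -> R) (U : set plane)
  (p0 : plane) (Wu Wv c : R).
Hypotheses (Uo : open U) (Up0 : U p0).
Hypothesis X_uu : forall p, U p -> derivable (du X) p ((1, 0) : plane).
Hypothesis X_uv : forall p, U p -> derivable (du X) p ((0, 1) : plane).
Hypothesis X_vv : forall p, U p -> derivable (dv X) p ((0, 1) : plane).
Hypothesis cXu : {for p0, continuous (du X)}.
Hypothesis cXv : {for p0, continuous (dv X)}.
Hypothesis cN : {for p0, continuous N}.
Hypothesis cW : {for p0, continuous W}.
Hypothesis N_u : forall p, U p -> is_derive p ((1, 0) : plane) N (Nu p).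
Hypothesis N_v : forall p, U p -> is_derive p ((0, 1) : plane) N (Nv p).
Hypothesis N_Xu : forall p, U p -> dot (N p) (du X p) = 0.
Hypothesis N_Xv : forall p, U p -> dot (N p) (dv X p) = 0.
Hypothesis N_neq0 : forall p, U p -> N p != 0.
Hypothesis X_reg : forall p, U p -> cross (du X p) (dv X p) != 0.
Hypothesis sym_N : forall p, U p -> dot (du X p) (Nv p) = dot (dv X p) (Nu p).
Hypothesis c_neq0 : c != 0.
Hypothesis W_E : forall p, U p ->
  c * W p * dot (cross (du X p) (dv X p)) (cross (du X p) (dv X p)) =
  (dot (du X p) (Nu p) * dot (dv X p) (Nv p) - dot (du X p) (Nv p) ^+ 2)
  * dot (N p) (N p).
Hypothesis W_u : is_derive p0 ((1, 0) : plane) W Wu.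
Hypothesis W_v : is_derive p0 ((0, 1) : plane) W Wv.
Hypothesis K_neq0 : gaussian_curvature X p0 != 0.

Let n p := cross (du X p) (dv X p).

Let near_U p : U p -> \near p, U p.
Proof. by move=> Up; apply: open_nbhs_nbhs; split. Qed.

Let normalE p : U p -> n p = (dot (N p) (n p) / dot (N p) (N p)) *: N p.
Proof.
move=> Up; have NN : dot (N p) (N p) != 0 by rewrite dotvv_eq0 N_neq0.
have h0 : cross (N p) (n p) = 0 := cross_orthogonal (N_Xu Up) (N_Xv Up).
have := cross_cross (N p) (N p) (n p); rewrite h0.
rewrite cross0r.
move=> /esym/eqP; rewrite subr_eq0 => /eqP h.
by rewrite mulrC -scalerA h scalerA mulVf // scale1r.
Qed.

Let dotNn p : U p -> dot (N p) (n p) ^+ 2 = dot (N p) (N p) * dot (n p) (n p).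
Proof.
move=> Up; have NN : dot (N p) (N p) != 0 by rewrite dotvv_eq0 N_neq0.
have -> : dot (n p) (n p) = dot (N p) (n p) * (dot (N p) (n p) / dot (N p) (N p)).
  by rewrite {1}normalE // dotZl mulrC.
by field.
Qed.

Let NN0 p : U p -> dot (N p) (N p) != 0.
Proof. by move=> Up; rewrite dotvv_eq0 N_neq0. Qed.
Let nn0 p : U p -> dot (n p) (n p) != 0.
Proof. by move=> Up; rewrite dotvv_eq0 X_reg. Qed.
Let Nn0 p : U p -> dot (N p) (n p) != 0.
Proof. by move=> Up; rewrite -sqrf_eq0 dotNn // mulf_neq0 // ?NN0 ?nn0. Qed.

Let unit_normalE p : U p ->
  unit_normal X p = (Num.sg (dot (N p) (n p)) / Num.sqrt (dot (N p) (N p))) *: N p.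
Proof.
move=> Up; rewrite /unit_normal -/(n p) {3}normalE // scalerA; congr (_ *: _).
have ha : dot (N p) (n p) = Num.sg (dot (N p) (n p)) *
    (Num.sqrt (dot (N p) (N p)) * Num.sqrt (dot (n p) (n p))).
  by rewrite -sqrtrM ?dotvv_ge0 // -dotNn // sqrtr_sqr -numEsg.
have s1 : Num.sqrt (dot (N p) (N p)) != 0.
  by rewrite sqrtr_eq0 -ltNge dotvv_gt0 N_neq0.
have s2 : Num.sqrt (dot (n p) (n p)) != 0.
  by rewrite sqrtr_eq0 -ltNge dotvv_gt0 X_reg.
have hN : dot (N p) (N p) = Num.sqrt (dot (N p) (N p)) ^+ 2.
  by rewrite sqr_sqrtr ?dotvv_ge0.
by rewrite {1}ha {2}hN; field; rewrite s1 s2.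
Qed.

Let second_form (Y : plane -> point) (dN : point) p v : U p ->
  (forall q, U q -> dot (N q) (Y q) = 0) ->
  derivable Y p v -> is_derive p v N dN -> dot ('D_v Y p) (N p) = - dot (Y p) dN.
Proof.
move=> Up h /derivableP dYp hN.
have := is_derive_dot hN dYp => /is_derive_near0 h0.
have := h0 _; rewrite dotC [dot (N p) _]dotC => /(_ _)/eqP.
rewrite addrC addr_eq0 => /(_ _)/eqP; apply.
by apply: filterS (near_U Up) => q /h.
Qed.

Let curvatureE p : U p ->
  gaussian_curvature X p = c * W p / dot (N p) (N p) ^+ 2.
Proof.
move=> Up; rewrite /gaussian_curvature /= (unit_normalE Up).
have W' := W_E Up; rewrite -/(n p) in W'.
have s2 : (Num.sg (dot (N p) (n p)) / Num.sqrt (dot (N p) (N p))) ^+ 2 = (dot (N p) (N p))^-1.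
  by rewrite expr_div_n sqr_sqrtr ?dotvv_ge0 // sqr_sg Nn0 // mul1r.
have nnE : dot (n p) (n p) = _ := dot_cross2 (du X p) (dv X p).
have h3 : dot (du (du X) p) (N p) = - dot (du X p) (Nu p) :=
  second_form Up N_Xu (X_uu Up) (N_u Up).
have h2 : dot (dv (du X) p) (N p) = - dot (du X p) (Nv p) :=
  second_form Up N_Xu (X_uv Up) (N_v Up).
have h1 : dot (dv (dv X) p) (N p) = - dot (dv X p) (Nv p) :=
  second_form Up N_Xv (X_vv Up) (N_v Up).
rewrite -nnE; move: h1 h2 h3.
have := NN0 Up; have := nn0 Up.
move: (Num.sg (dot (N p) (n p)) / Num.sqrt (dot (N p) (N p))) s2 (du (du X) p) (dv (du X) p) (dv (dv X) p) => s s2 xuu xuv xvv.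
move: (dot (n p) (n p)) (du X p) (dv X p) (Nu p) (Nv p) (N p) (W p) W' s2.
move=> nn xu xv du dv N' W' W'E s2 nn0' NN0' h1 h2 h3.
rewrite !dotZr h1 h2 h3.
have -> : s * - dot xu du * (s * - dot xv dv) - (s * - dot xu dv) ^+ 2 =
   s ^+ 2 * (dot xu du * dot xv dv - dot xu dv ^+ 2) by ring.
have -> : dot xu du * dot xv dv - dot xu dv ^+ 2
  = c * W' * nn / dot N' N' by rewrite W'E mulfK.
by rewrite s2; field; rewrite NN0' nn0'.
Qed.

Lemma W_neq0 : W p0 != 0.
Proof.
by apply: contraNneq K_neq0 => w0; rewrite curvatureE // w0 mulr0 mul0r.
Qed.

Let eps := Num.sg (dot (N p0) (n p0)).
Let del := Num.sg (c * W p0).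
Let q : R := - (4%:R^-1).

Let cW0 : c * W p0 != 0. Proof. by rewrite mulf_neq0 // W_neq0. Qed.
Let cn : {for p0, continuous n}.
Proof. exact: (continuous_cross cXu cXv). Qed.

(** The curvature is c W / |N|^4, so in the product of its power -1/4 with N / |N|
    the norm of N cancels; the signs of N.n and of W are locally constant. *)
Let conormalE : \near p0, (eps * (del * (c * W p0)) `^ q) *: N p0 = conormal X p0.
Proof.
have e1 : \forall p \near p0, Num.sg (dot (N p) (n p)) = eps.
  by apply: continuous_sg; [apply: continuous_dot; [exact: cN|exact: cn]|exact: Nn0].
have e2 : \forall p \near p0, Num.sg (c * W p) = del.
  by apply: continuous_sg => //; apply: continuousM => //; exact: cvg_cst.
near=> p; have Up : U p by near: p; exact: near_U.
have E1 : Num.sg (dot (N p) (n p)) = eps by near: p.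
have E2 : Num.sg (c * W p) = del by near: p.
rewrite /conormal -/q (curvatureE Up) (unit_normalE Up) scalerA; congr (_ *: _).
have s1 : Num.sqrt (dot (N p) (N p)) != 0.
  by rewrite sqrtr_eq0 -ltNge dotvv_gt0 N_neq0.
have -> : `|c * W p / dot (N p) (N p) ^+ 2| = `|c * W p| * (dot (N p) (N p) ^+ 2)^-1.
  by rewrite normf_div [X in _ / X]ger0_norm ?sqr_ge0.
rewrite E1 -E2 -normrEsg.
rewrite (powR_quarter (normr_ge0 _) (dotvv_ge0 (N p))).
move: s1; move: (Num.sqrt _) ((_ `^ _)) => y x y0; field.
Unshelve. all: by end_near. Qed.

Let dconormal v Wv' dN : is_derive p0 v W Wv' -> is_derive p0 v N dN ->
  'D_v (conormal X) p0 = (eps * (del * (c * W p0)) `^ q / (4 * W p0)) *: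
     ((4 * W p0) *: dN - Wv' *: N p0).
Proof.
move=> hW hN.
have x0 : 0 < del * (c * W p0) by rewrite /del -normrEsg normr_gt0.
have h1 : is_derive p0 v (fun p => del * (c * W p)) (del * (c * Wv')).
  have := is_derive_mul (is_derive_cst del p0 v) (is_derive_mul (is_derive_cst c p0 v) hW).
  by rewrite !mul0r !add0r.
have h2 := is_derive_comp1 h1 (is_derive1_powR q x0).
have h3 := is_derive_mul (is_derive_cst eps p0 v) h2.
have h4 := is_derive_scale h3 hN.
have [_ h5] := near_eq_is_derive conormalE h4.
rewrite h5 /= powRB ?(gt_eqF x0) ?implybT // powRr1 ?ltW // mul0r add0r.
have d0 : del != 0 by rewrite sgr_eq0.
rewrite scalerBr !scalerA addrC -scaleNr; congr (_ *: _ + _ *: _).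
  by field; rewrite W_neq0.
by rewrite /q /cst; field; rewrite W_neq0 c_neq0 d0.
Qed.

(** By [conormalE] the conormal is a constant times |W|^(-1/4) N, so its derivatives
    are 4W N_u - W_u N and 4W N_v - W_v N up to one and the same factor. *)
Lemma affine_normal_dot V :
  dot (affine_normal X p0) V = 0 <->
  dot V (cross ((4 * W p0) *: Nu p0 - Wu *: N p0)
               ((4 * W p0) *: Nv p0 - Wv *: N p0)) = 0.
Proof.
rewrite /affine_normal /du /dv (dconormal W_u (N_u Up0)) (dconormal W_v (N_v Up0)).
rewrite -(nbhs_singleton conormalE).
set a := _ - _; set b := _ - _; set k := eps * _ / _.
have x0 : 0 < del * (c * W p0) by rewrite /del -normrEsg normr_gt0.
have e0 : eps * (del * (c * W p0)) `^ q != 0.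
  by rewrite mulf_neq0 ?sgr_eq0 ?Nn0 // gt_eqF // powR_gt0.
have k0 : k != 0 by rewrite /k mulf_neq0 // invr_neq0 // mulf_neq0 ?W_neq0.
rewrite crossZl crossZr scalerA dotZl.
rewrite det3E crossZl crossZr scalerA dotZl dotZr dotZl.
have D0 : dot (N p0) (cross a b) != 0.
  have -> : dot (N p0) (cross a b) = (4 * W p0) ^+ 2 * dot (N p0) (cross (Nu p0) (Nv p0)).
    by rewrite /a /b !dotE !crossE /dot3 /cross3 /= !mxE; ring.
  rewrite mulf_neq0 ?expf_neq0 ?mulf_neq0 ?W_neq0 //.
  have h : dot (n p0) (cross (Nu p0) (Nv p0)) != 0.
    rewrite /n dot_cross -sym_N // -expr2.
    have := W_E Up0; rewrite -/(n p0) => h.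
    apply: contraTneq (mulf_neq0 cW0 (nn0 Up0)) => h'.
    by rewrite h h' mul0r eqxx.
  by apply: contraNneq h => h; rewrite normalE // dotZl h mulr0.
split=> [/eqP|h]; last by rewrite (dotC (cross a b) V) h !mulr0.
move: k0 e0; clearbody k; move: (eps * _) => e k0 e0.
rewrite !(mulf_eq0, invr_eq0) (negPf k0) (negPf e0) (negPf D0) /=.
by rewrite dotC => /eqP.
Qed.

End AffineNormal.

Section Regular.
Variable R : realType.
Local Notation plane := (R * R)%type.
Implicit Types (f g : plane -> R) (p v : plane).

(** Both properties are inherited by the expressions built below: the derivatives
    enter the affine normal, and continuity keeps nonzero quantities nonzero near
    a point. *)
Definition reg p v f d := is_derive p v f d /\ {for p, continuous f}.

Lemma reg_eq p v f d d' : reg p v f d -> d = d' -> reg p v f d'.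
Proof. by move=> h <-. Qed.
Lemma reg_cst p v (c : R) : reg p v (fun=> c) 0.
Proof. by split; [exact: is_derive_cst|exact: cvg_cst]. Qed.
Lemma reg_add p v f g df dg : reg p v f df -> reg p v g dg ->
  reg p v (fun q => f q + g q) (df + dg).
Proof.
by move=> [df_ cf] [dg_ cg]; split; [exact: is_derive_add|exact: continuousD].
Qed.
Lemma reg_sub p v f g df dg : reg p v f df -> reg p v g dg ->
  reg p v (fun q => f q - g q) (df - dg).
Proof.
by move=> [df_ cf] [dg_ cg]; split; [exact: is_derive_sub|exact: continuousB].
Qed.
Lemma reg_mul p v f g df dg : reg p v f df -> reg p v g dg ->
  reg p v (fun q => f q * g q) (df * g p + f p * dg).
Proof.
by move=> [df_ cf] [dg_ cg]; split; [exact: is_derive_mul|exact: continuousM].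
Qed.
Lemma reg_opp p v f df : reg p v f df -> reg p v (fun q => - f q) (- df).
Proof.
move=> h; have := reg_sub (reg_cst p v 0) h; rewrite sub0r.
by rewrite (_ : (fun q => 0 - f q) = fun q => - f q) //; apply: funext => q; rewrite sub0r.
Qed.
Lemma reg_exp p v f df n : reg p v f df ->
  reg p v (fun q => f q ^+ n) (n%:R * f p ^+ n.-1 * df).
Proof.
move=> h; elim: n => [|n ih].
  by rewrite !mul0r; exact: reg_cst.
rewrite (_ : (fun q => f q ^+ n.+1) = fun q => f q * f q ^+ n); last first.
  by apply: funext => q; rewrite exprS.
apply: reg_eq (reg_mul h ih) _.
case: n {ih} => [|n]; first by rewrite /= !expr0; ring.
by rewrite /= !exprS -!natr1; ring.
Qed.
Lemma reg_inv p v f df : f p != 0 -> reg p v f df ->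
  reg p v (fun q => (f q)^-1) (- df / f p ^+ 2).
Proof.
move=> f0 [hf cf]; split; last exact: continuousV.
have h : is_derive (f p) 1 (fun y : R => y^-1) (- (f p) ^- 2).
  by have := @is_deriveV R id (f p) 1 1 f0 _; rewrite /GRing.scale /= mulr1; apply.
apply: is_derive_eq (is_derive_comp1 hf h) _.
by rewrite mulNr mulrC mulNr.
Qed.
Lemma reg_horner (s : {poly R}) p v f df : reg p v f df ->
  reg p v (fun q => s.[f q]) (s^`().[f p] * df).
Proof.
move=> [hf cf]; split.
  exact: (is_derive_comp1 hf (is_derive_poly s (f p))).
by apply: (@continuous_comp _ _ _ f (horner s)) => //; exact: continuous_horner.
Qed.

(** A rational function is a pair, numerator and denominator, so that its successive
    derivatives are again explicit pairs of polynomials. *)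
Definition evalr (r : {poly R} * {poly R}) (z : R) := r.1.[z] / r.2.[z].
Definition derivr (r : {poly R} * {poly R}) :=
  (r.1^`() * r.2 - r.1 * r.2^`(), r.2 ^+ 2).
Lemma reg_evalr r p v f df : r.2.[f p] != 0 -> reg p v f df ->
  reg p v (fun q => evalr r (f q)) (evalr (derivr r) (f p) * df).
Proof.
move=> r0 h.
apply: reg_eq (reg_mul (reg_horner r.1 h) (reg_inv r0 (reg_horner r.2 h))) _.
by rewrite /evalr /derivr /= !(hornerM, hornerD, hornerN, horner_exp); field.
Qed.

(** The inner variable is the height z, the outer one is the radius r. *)
Definition eval2 (A : {poly {poly R}}) (z r : R) := A.[r%:P].[z].
Lemma eval2D A B z r : eval2 (A + B) z r = eval2 A z r + eval2 B z r.
Proof. by rewrite /eval2 !hornerE. Qed.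
Lemma eval2N A z r : eval2 (- A) z r = - eval2 A z r.
Proof. by rewrite /eval2 !hornerE. Qed.
Lemma eval2M A B z r : eval2 (A * B) z r = eval2 A z r * eval2 B z r.
Proof. by rewrite /eval2 !hornerE. Qed.
Lemma eval2C (c : {poly R}) z r : eval2 c%:P z r = c.[z].
Proof. by rewrite /eval2 !hornerE. Qed.
Lemma eval2X z r : eval2 'X z r = r.
Proof. by rewrite /eval2 !hornerE. Qed.
Definition dz (A : {poly {poly R}}) : {poly {poly R}} := map_poly deriv A.
Lemma reg_eval2 A p v f g df dg : reg p v f df -> reg p v g dg ->
  reg p v (fun q => eval2 A (f q) (g q))
    (eval2 (dz A) (f p) (g p) * df + eval2 A^`() (f p) (g p) * dg).
Proof.
move=> hf hg; elim/poly_ind: A => [|A c ih].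
  rewrite (_ : (fun q => _) = fun=> 0); last by apply: funext => q; rewrite /eval2 !horner0.
  by rewrite /dz map_poly0 deriv0 /eval2 !horner0 !mul0r addr0; exact: reg_cst.
rewrite (_ : (fun q => _) = fun q => eval2 A (f q) (g q) * g q + c.[f q]); last first.
  by apply: funext => q; rewrite eval2D eval2M eval2X eval2C.
apply: reg_eq (reg_add (reg_mul ih hg) (reg_horner c hf)) _.
have -> : dz (A * 'X + c%:P) = dz A * 'X + (c^`())%:P.
  rewrite /dz raddfD /= map_polyC; congr (_ + _).
  apply/polyP => i; rewrite coef_map !coefMX coef_map /=.
  by case: eqP => //= _; rewrite deriv0.
rewrite derivD derivM derivX derivC !eval2D !eval2M !eval2X eval2C.
have e0 : eval2 0 (f p) (g p) = 0 by rewrite /eval2 !horner0.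
have e1 : eval2 1 (f p) (g p) = 1 by rewrite /eval2 !hornerC.
rewrite e0 e1; move: (eval2 _ _ _) (eval2 _ _ _) (eval2 _ _ _) => x y z.
by ring.
Qed.

Lemma reg_continuous p v f d : reg p v f d -> {for p, continuous f}.
Proof. by case. Qed.
End Regular.

(** * Derivatives of the explicit normal *)

Section JetDerivative.
Variable R : realType.
Local Notation plane := (R * R)%type.
Variables (p v : plane) (zv tx ty : R).
Variables (a b c a1 b1 c1 a2 b2 c2 a3 b3 c3 : plane -> R).
Variables (u0 w0 u1 w1 u2 w2 u3 w3 g1 g2 g3 x y r : plane -> R).
Hypothesis ha : reg p v a (a1 p * zv).
Hypothesis hb : reg p v b (b1 p * zv).
Hypothesis hc : reg p v c (c1 p * zv).
Hypothesis ha1 : reg p v a1 (a2 p * zv).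
Hypothesis hb1 : reg p v b1 (b2 p * zv).
Hypothesis hc1 : reg p v c1 (c2 p * zv).
Hypothesis ha2 : reg p v a2 (a3 p * zv).
Hypothesis hb2 : reg p v b2 (b3 p * zv).
Hypothesis hc2 : reg p v c2 (c3 p * zv).
Hypothesis hu1 : reg p v u1 (u2 p * zv).
Hypothesis hw1 : reg p v w1 (w2 p * zv).
Hypothesis hu2 : reg p v u2 (u3 p * zv).
Hypothesis hw2 : reg p v w2 (w3 p * zv).
Hypothesis hg1 : reg p v g1 (g2 p * zv).
Hypothesis hg2 : reg p v g2 (g3 p * zv).
Hypothesis hx : reg p v x tx.
Hypothesis hy : reg p v y ty.
Hypothesis hr : reg p v r (g1 p * zv).

Definition jetf q : jet R := Jet (a q, b q, c q) (a1 q, b1 q, c1 q)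
  (a2 q, b2 q, c2 q) (a3 q, b3 q, c3 q) (u0 q, w0 q) (u1 q, w1 q) (u2 q, w2 q)
  (u3 q, w3 q) (g1 q) (g2 q) (g3 q).

(** A covector of the coordinates (x - a(z), y - b(z), z) read in the fixed
    coordinates (x, y, z), with m = a' and n = b'. *)
Definition shear (m n : R) (o : R * R * R) : R * R * R :=
  (o.1.1, o.1.2, o.2 - m * o.1.1 - n * o.1.2).
Definition normf q := shear (u1 q) (w1 q) (jn (jetf q) (x q) (y q)).
Definition tang := (tx, ty, zv).
Definition dnorm := shear (u1 p) (w1 p) (app3 (jH (jetf p) (x p) (y p)) tang).

Ltac reg_tac := lazymatch goal with
  | |- reg _ _ (fun q => @?f q + - @?g q) _ =>
      refine (@reg_sub _ _ _ f g _ _ _ _); reg_tac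
  | |- reg _ _ (fun q => @?f q + @?g q) _ =>
      refine (@reg_add _ _ _ f g _ _ _ _); reg_tac
  | |- reg _ _ (fun q => @?f q * @?g q) _ =>
      refine (@reg_mul _ _ _ f g _ _ _ _); reg_tac
  | |- reg _ _ (fun q => @?f q ^+ ?n) _ =>
      refine (@reg_exp _ _ _ f _ n _); reg_tac
  | |- reg _ _ (fun q => - @?f q) _ =>
      refine (@reg_opp _ _ _ f _ _); reg_tac
  | |- reg _ _ (fun _ => ?c) _ => exact (@reg_cst _ _ _ c)
  | |- reg _ _ (fun q => ?f q) _ => match goal with H : reg _ _ f _ |- _ => exact H end
  end.

Lemma reg_norm : [/\ reg p v (fun q => (normf q).1.1) dnorm.1.1,
   reg p v (fun q => (normf q).1.2) dnorm.1.2 &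
   reg p v (fun q => (normf q).2) dnorm.2].
Proof.
rewrite /normf /dnorm /tang /shear /jn /jH /jh33 /jetf /app3 /qf /sx /sy /=.
split; (eapply reg_eq; [by reg_tac|rewrite /=; ring]).
Qed.

(** On the surface S[x, y] is r, a function of z alone.  Writing r for it in W keeps
    the gradient [jo] short. *)
Lemma reg_jW : qf (a p, b p, c p) (x p) (y p) = r p ->
  reg p v (fun q => 2 * r q * jL (jetf q) (x q) (y q)
            + dets (S0 (jetf q)) * jQ (jetf q) (x q) (y q) ^+ 2)
   (dot3 (jo (jetf p) (x p) (y p)) tang).
Proof.
move=> rE.
rewrite /jo /jo1 /jo2 /jo3 /= rE.
rewrite /dot3 /tang /jL /jh33' /jh33 /jQ /dets' /badj /qadj /qf /sx /sy /dets /jetf /=.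
eapply reg_eq.
  reg_tac.
rewrite /=.
ring.
Qed.
End JetDerivative.

(** * Orthonormal frames of the planes orthogonal to the axis *)

Section Frames.
Variable R : realType.
Local Notation point := 'cV[R]_3.
Implicit Types (E w u v : point).

Definition frame E1 E2 w :=
  [/\ dot E1 E1 = 1, dot E2 E2 = 1 & dot E1 E2 = 0] /\
  [/\ dot E1 w = 0, dot E2 w = 0 & w != 0].

Definition vol E1 E2 w : R := dot w (cross E1 E2).

Lemma parallel_cross E1 E2 u : dot E1 E1 = 1 -> dot E2 E2 = 1 -> dot E1 E2 = 0 ->
  dot E1 u = 0 -> dot E2 u = 0 -> u = vol E1 E2 u *: cross E1 E2.
Proof.
move=> e11 e22 e12 e1u e2u.
have mm : dot (cross E1 E2) (cross E1 E2) = 1.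
  by rewrite dot_cross2 e11 e22 e12; ring.
have h0 : cross u (cross E1 E2) = 0.
  by apply: cross_orthogonal; rewrite dotC.
have := cross_cross (cross E1 E2) (cross E1 E2) u.
rewrite [cross (cross E1 E2) u]crossNC h0 oppr0 cross0r mm scale1r.
move=> /esym/eqP; rewrite subr_eq0 => /eqP h; rewrite -{1}h /vol.
by rewrite [dot u _]dotC.
Qed.

Section OneFrame.
Variables E1 E2 w : point.
Hypothesis fr : frame E1 E2 w.
Let ww := dot w w.
Let d := vol E1 E2 w.

Lemma frame_ww : ww != 0.
Proof. by case: fr => _ [_ _ w0]; rewrite dotvv_eq0. Qed.

Lemma frame_w : w = d *: cross E1 E2.
Proof. by case: fr => -[? ? ?] [? ? ?]; exact: parallel_cross. Qed.

Lemma frame_vol2 : d ^+ 2 = ww.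
Proof.
transitivity (dot w (d *: cross E1 E2)); first by rewrite dotZr -expr2.
by rewrite -frame_w.
Qed.

Lemma frame_vol_neq0 : d != 0.
Proof. by rewrite -sqrf_eq0 frame_vol2 frame_ww. Qed.

Lemma cross_E1E2 : cross E1 E2 = (d / ww) *: w.
Proof.
transitivity ((d / ww) *: (d *: cross E1 E2)); last by rewrite -frame_w.
by rewrite scalerA -frame_vol2 (_ : d / d ^+ 2 * d = 1) ?scale1r //; field; exact: frame_vol_neq0.
Qed.

Lemma cross_E2w : cross E2 w = d *: E1.
Proof.
case: fr => -[e11 e22 e12] _.
transitivity (cross E2 (d *: cross E1 E2)); first by rewrite -frame_w.
rewrite crossZr cross_cross e22 [dot E2 E1]dotC e12.
by rewrite scale1r scale0r subr0.
Qed.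

Lemma cross_wE1 : cross w E1 = d *: E2.
Proof.
case: fr => -[e11 e22 e12] _; transitivity (- cross E1 (d *: cross E1 E2)); first by rewrite -frame_w crossNC.
rewrite crossZr cross_cross.
by rewrite e11 e12 scale1r scale0r sub0r scalerN opprK.
Qed.

Lemma frame_decomp u :
  u = dot E1 u *: E1 + dot E2 u *: E2 + (dot w u / ww) *: w.
Proof.
case: (fr) => -[e11 e22 e12] [e1w e2w w0].
set u' := _ + _ + _; apply/eqP; rewrite -subr_eq0; apply/eqP.
have h1 : dot E1 (u - u') = 0.
  by rewrite /u' !dot_lin e11 e12 e1w; ring.
have h2 : dot E2 (u - u') = 0.
  by rewrite /u' !dot_lin e22 [dot E2 E1]dotC e12 e2w; ring.
have h3 : dot w (u - u') = 0.
  rewrite /u' !dot_lin [dot w E1]dotC [dot w E2]dotC e1w e2w -/ww.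
  by field; exact: frame_ww.
rewrite (parallel_cross e11 e22 e12 h1 h2) /vol cross_E1E2 dotZr dotC h3.
by rewrite mulr0 scale0r.
Qed.

(** Coordinates in the dual basis, which differs from (E1, E2, w) because w is not
    normalized. *)
Definition covec (t : R * R * R) : point :=
  t.1.1 *: E1 + t.1.2 *: E2 + (t.2 / ww) *: w.
Definition vec (t : R * R * R) : point := t.1.1 *: E1 + t.1.2 *: E2 + t.2 *: w.

Lemma dot_covec s t : dot (covec s) (vec t) = dot3 s t.
Proof.
case: fr => -[e11 e22 e12] [e1w e2w w0].
rewrite /covec /vec /dot3 !dot_lin e11 e22 e12 [dot E2 E1]dotC e12.
rewrite e1w e2w [dot w E1]dotC [dot w E2]dotC e1w e2w -/ww.
by field; exact: frame_ww.
Qed.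

Lemma cross_vec s t : cross (vec s) (vec t) = d *: covec (cross3 s t).
Proof.
rewrite /vec !(crossDl, crossDr, crossZl, crossZr) !crossvv.
rewrite [cross E2 E1]crossNC [cross w E2]crossNC [cross E1 w]crossNC.
rewrite cross_E1E2 cross_E2w cross_wE1 /covec /cross3 /=.
apply: col3P; rewrite /coords !mxE /=; congr (_, _, _); field; exact: frame_ww.
Qed.

Lemma det_covec (s t r : R * R * R) :
  dot (covec s) (cross (covec t) (covec r)) = d / ww * dot3 s (cross3 t r).
Proof.
have h t' : covec t' = vec (t'.1.1, t'.1.2, t'.2 / ww) by [].
rewrite [covec t]h [covec r]h cross_vec dotZr h dotC dot_covec.
by rewrite /dot3 /cross3 /=; field; exact: frame_ww.
Qed.

Lemma covec_neq0 s t : dot3 s t != 0 -> covec s != 0.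
Proof.
apply: contraNneq => h; rewrite -dot_covec h dotE /dot3 /= !mxE.
by rewrite !mul0r !addr0.
Qed.
End OneFrame.
End Frames.

(** * Implicit differentiation of the radius of a level *)

Section LevelJet.
Variable R : realType.
Variables (s11 s12 s22 na nb k : {poly R}) (Th : {poly {poly R}}).

(** The derivatives of the function r(z) defined by Th(z, r) = 0. *)
Definition slope z r := - (eval2 (dz Th) z r / eval2 Th^`() z r).
(** Along Th = 0 the derivative in z of A(z, r) is A_z - A_r Th_z / Th_r; the
    denominator is left out to stay polynomial. *)
Definition along (A : {poly {poly R}}) := dz A * Th^`() - A^`() * dz Th.
Definition slope2_num := - (along (dz Th) * Th^`() - dz Th * along Th^`()).
Definition slope2 z r := eval2 slope2_num z r / eval2 Th^`() z r ^+ 3.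
Definition slope3 z r :=
  (eval2 (along slope2_num) z r * eval2 Th^`() z r
   - 3 * eval2 slope2_num z r * eval2 (along Th^`()) z r)
  / eval2 Th^`() z r ^+ 5.

Definition rat_pair n z := (evalr (iter n (@derivr R) (na, k)) z,
                            evalr (iter n (@derivr R) (nb, k)) z).
Definition sym_at n z := ((derivn n s11).[z], (derivn n s12).[z], (derivn n s22).[z]).

Definition jet_at z r : jet R :=
  Jet (sym_at 0 z) (sym_at 1 z) (sym_at 2 z) (sym_at 3 z)
      (rat_pair 0 z) (rat_pair 1 z) (rat_pair 2 z) (rat_pair 3 z)
      (slope z r) (slope2 z r) (slope3 z r).

Lemma iter_derivr_neq0 (n m : {poly R}) i z : m.[z] != 0 ->
  (iter i (@derivr R) (n, m)).2.[z] != 0.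
Proof.
move=> m0; elim: i => //= i ih.
by rewrite horner_exp expf_neq0.
Qed.

Local Notation plane := (R * R)%type.
Variables (p v : plane) (zf rf : plane -> R) (zv rv : R).
Hypothesis hz : reg p v zf zv.
Hypothesis hr : reg p v rf rv.
Hypothesis kz : k.[zf p] != 0.
Hypothesis Thr : eval2 Th^`() (zf p) (rf p) != 0.
Hypothesis Th0 : \near p, eval2 Th (zf p) (rf p) = 0.

Lemma level_rv : rv = slope (zf p) (rf p) * zv.
Proof.
have [h _] := reg_eval2 Th hz hr.
have := is_derive_near0 Th0 h => h0.
rewrite /slope; apply: (mulfI Thr).
rewrite mulNr mulrN mulrA mulrCA divff // mulr1.
by apply/eqP; rewrite -addr_eq0 addrC h0.
Qed.

Lemma reg_level A : reg p v (fun q => eval2 A (zf q) (rf q))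
  (eval2 (along A) (zf p) (rf p) / eval2 Th^`() (zf p) (rf p) * zv).
Proof.
apply: reg_eq (reg_eval2 A hz hr) _.
rewrite level_rv /slope /along eval2D eval2N !eval2M.
by field.
Qed.

Lemma reg_slope : reg p v (fun q => slope (zf q) (rf q)) (slope2 (zf p) (rf p) * zv).
Proof.
apply: reg_eq (reg_opp (reg_mul (reg_level (dz Th)) (reg_inv Thr (reg_level Th^`())))) _.
rewrite /slope2 /slope2_num; move: (along (dz Th)) (along Th^`()) => P1 P2.
rewrite eval2N eval2D eval2N !eval2M.
by field.
Qed.

Lemma reg_slope2 : reg p v (fun q => slope2 (zf q) (rf q)) (slope3 (zf p) (rf p) * zv).
Proof.
have h3 : eval2 Th^`() (zf p) (rf p) ^+ 3 != 0 by rewrite expf_neq0.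
apply: reg_eq (reg_mul (reg_level slope2_num)
  (reg_inv h3 (reg_exp 3 (reg_level Th^`())))) _.
rewrite /slope3 /=.
by field.
Qed.

Lemma reg_derivn (s : {poly R}) n :
  reg p v (fun q => (derivn n s).[zf q]) ((derivn n.+1 s).[zf p] * zv).
Proof. by rewrite derivnS; exact: reg_horner. Qed.

Lemma reg_iter_derivr (m : {poly R}) n :
  reg p v (fun q => evalr (iter n (@derivr R) (m, k)) (zf q))
    (evalr (iter n.+1 (@derivr R) (m, k)) (zf p) * zv).
Proof. by apply: reg_evalr => //; exact: iter_derivr_neq0. Qed.

End LevelJet.

(** * The equation of the affine normal of a level surface *)

Lemma cross3_parallel (K : fieldType) (n a b : K * K * K) :
  dot3 n a = 0 -> dot3 n b = 0 -> (n.1.1 != 0) || (n.1.2 != 0) ->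
  exists kap, cross3 a b = lin3 kap n 0 n.
Proof.
case: n a b => [[n1 n2] n3] [[a1 a2] a3] [[b1 b2] b3]; rewrite /dot3 /cross3 /lin3 /=.
move=> ha hb hn.
have e12 : n1 * (a3 * b1 - a1 * b3) = n2 * (a2 * b3 - a3 * b2).
  by apply/eqP; rewrite -subr_eq0; apply/eqP; transitivity
    (a3 * (n1 * b1 + n2 * b2 + n3 * b3) - b3 * (n1 * a1 + n2 * a2 + n3 * a3));
    [ring|rewrite ha hb; ring].
have e13 : n1 * (a1 * b2 - a2 * b1) = n3 * (a2 * b3 - a3 * b2).
  by apply/eqP; rewrite -subr_eq0; apply/eqP; transitivity
    (b2 * (n1 * a1 + n2 * a2 + n3 * a3) - a2 * (n1 * b1 + n2 * b2 + n3 * b3));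
    [ring|rewrite ha hb; ring].
have e23 : n2 * (a1 * b2 - a2 * b1) = n3 * (a3 * b1 - a1 * b3).
  by apply/eqP; rewrite -subr_eq0; apply/eqP; transitivity
    (a1 * (n1 * b1 + n2 * b2 + n3 * b3) - b1 * (n1 * a1 + n2 * a2 + n3 * a3));
    [ring|rewrite ha hb; ring].
case/orP: hn => h.
  exists ((a2 * b3 - a3 * b2) / n1); rewrite !mul0r !addr0; congr (_, _, _).
  - by rewrite divfK.
  - by apply: (mulfI h); rewrite e12; field.
  - by apply: (mulfI h); rewrite e13; field.
exists ((a3 * b1 - a1 * b3) / n2); rewrite !mul0r !addr0; congr (_, _, _).
- by apply: (mulfI h); rewrite -e12; field.
- by rewrite divfK.
- by apply: (mulfI h); rewrite e23; field.
Qed.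

Definition slide (K : comNzRingType) (m n : K) (t : K * K * K) : K * K * K :=
  (t.1.1 + m * t.2, t.1.2 + n * t.2, t.2).

Lemma cross_slide (R : realType) (m n : R) s t :
  cross3 (slide m n s) (slide m n t) = shear m n (cross3 s t).
Proof. by rewrite /cross3 /slide /shear /=; congr (_, _, _); ring. Qed.

Lemma dot_cross_shear (R : realType) (m n : R) s t r :
  dot3 (shear m n s) (cross3 (shear m n t) (shear m n r)) = dot3 s (cross3 t r).
Proof. by rewrite /dot3 /cross3 /shear /=; ring. Qed.

Lemma dot_shear_slide (R : realType) (m n : R) s t :
  dot3 (shear m n s) (slide m n t) = dot3 s t.
Proof. by rewrite /dot3 /slide /shear /=; ring. Qed.

Local Opaque derive derivable.

Section Explicit.
Variable R : realType.
Local Notation plane := (R * R)%type.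
Local Notation point := 'cV[R]_3.
Variables (Q E1 E2 w : point).
Hypothesis fr : frame E1 E2 w.
Variables (s11 s12 s22 na nb k : {poly R}) (Th : {poly {poly R}}).
Variables (X : plane -> point) (U : set plane) (p0 : plane).
Hypotheses (Uo : open U) (Up0 : U p0) (CX : Ck 2 U X).
Hypothesis X_reg : forall p, U p -> cross (du X p) (dv X p) != 0.

Let ww := dot w w.
Definition frame_x P := dot E1 P - dot E1 Q.
Definition frame_y P := dot E2 P - dot E2 Q.
Definition frame_z P := (dot w P - dot w Q) / dot w w.

Let zf p := frame_z (X p).
Let xi p := frame_x (X p) - evalr (na, k) (zf p).
Let et p := frame_y (X p) - evalr (nb, k) (zf p).
Let rf p := qf (sym_at s11 s12 s22 0 (zf p)) (xi p) (et p).
Let J p := jet_at s11 s12 s22 na nb k Th (zf p) (rf p).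

Hypothesis k_neq0 : forall p, U p -> k.[zf p] != 0.
Hypothesis Thr_neq0 : forall p, U p -> eval2 Th^`() (zf p) (rf p) != 0.
Hypothesis rf_neq0 : forall p, U p -> rf p != 0.
Hypothesis on_level : forall p, U p -> eval2 Th (zf p) (rf p) = 0.

Let near_U p : U p -> \near p, U p.
Proof. by move=> Up; apply: open_nbhs_nbhs; split. Qed.

Section Direction.
Variables (p v : plane).
Hypotheses (Up : U p) (dX : derivable X p v).
Let Xv := 'D_v X p.
Let zv := dot w Xv / ww.
Let tx := dot E1 Xv - evalr (derivr (na, k)) (zf p) * zv.
Let ty := dot E2 Xv - evalr (derivr (nb, k)) (zf p) * zv.

Let cX : {for p, continuous X}. Proof. by case: CX => h _; exact: h. Qed.

Let reg_dot u : reg p v (fun q => dot u (X q)) (dot u Xv).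
Proof.
split; last by apply: continuous_dot => //; exact: cvg_cst.
have := is_derive_dot (is_derive_cst u p v) (derivableP dX).
by rewrite (_ : dot 0 _ = 0) ?add0r // dotE /dot3 /= !mxE !mul0r !addr0.
Qed.

Lemma reg_zf : reg p v zf zv.
Proof.
apply: reg_eq (reg_mul (reg_sub (reg_dot w) (reg_cst p v (dot w Q)))
  (reg_cst p v ww^-1)) _.
by rewrite subr0 mulr0 addr0.
Qed.

Lemma reg_xi : reg p v xi tx.
Proof.
apply: reg_eq (reg_sub (reg_sub (reg_dot E1) (reg_cst p v (dot E1 Q)))
  (@reg_evalr R (na, k) _ _ _ _ (k_neq0 Up) reg_zf)) _.
by rewrite subr0.
Qed.

Lemma reg_et : reg p v et ty.
Proof.
apply: reg_eq (reg_sub (reg_sub (reg_dot E2) (reg_cst p v (dot E2 Q)))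
  (@reg_evalr R (nb, k) _ _ _ _ (k_neq0 Up) reg_zf)) _.
by rewrite subr0.
Qed.

Lemma reg_rf : reg p v rf (slope Th (zf p) (rf p) * zv).
Proof.
have h n s := reg_derivn reg_zf s n.
have r := reg_add (reg_add (reg_mul (h 0 s11) (reg_exp 2 reg_xi))
   (reg_mul (reg_mul (reg_mul (reg_cst p v 2) (h 0 s12)) reg_xi) reg_et))
   (reg_mul (h 0 s22) (reg_exp 2 reg_et)).
rewrite -/rf in r.
apply: (reg_eq r).
apply: (level_rv reg_zf r (Thr_neq0 Up)).
by apply: filterS (near_U Up) => q /on_level.
Qed.

Lemma normal_tangent : dot3 (jn (J p) (xi p) (et p)) (tx, ty, zv) = 0.
Proof.
have h n s := reg_derivn reg_zf s n.
have r := reg_add (reg_add (reg_mul (h 0 s11) (reg_exp 2 reg_xi))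
   (reg_mul (reg_mul (reg_mul (reg_cst p v 2) (h 0 s12)) reg_xi) reg_et))
   (reg_mul (h 0 s22) (reg_exp 2 reg_et)).
rewrite -/rf in r.
have := level_rv reg_zf r (Thr_neq0 Up) _ => /(_ _)/eqP.
rewrite -subr_eq0 => /(_ (filterS on_level (near_U Up)))/eqP <-.
rewrite /jn /dot3 /J /jet_at /qf /sx /sy /=; ring.
Qed.

Let T : R * R * R := (tx, ty, zv).

Lemma Xv_vec : Xv = vec E1 E2 w (slide (A1 (J p)).1 (A1 (J p)).2 T).
Proof.
rewrite [LHS](frame_decomp fr) /vec; congr (_ *: _ + _ *: _ + _).
  by rewrite /slide [RHS]subrK.
by rewrite /slide [RHS]subrK.
Qed.

Definition unshear p (o : R * R * R) : point :=
  covec E1 E2 w (shear (A1 (J p)).1 (A1 (J p)).2 o).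

Lemma dot_unshear o : dot (unshear p o) Xv = dot3 o T.
Proof.
by rewrite Xv_vec /unshear (dot_covec fr) dot_shear_slide.
Qed.

Let Nf q := unshear q (jn (J q) (xi q) (et q)).
Let Wf q := jW (J q) (xi q) (et q).

Lemma reg_vec (f1 f2 f3 : plane -> R) d1 d2 d3 :
  reg p v f1 d1 -> reg p v f2 d2 -> reg p v f3 d3 ->
  is_derive p v (fun q => covec E1 E2 w (f1 q, f2 q, f3 q)) (covec E1 E2 w (d1, d2, d3))
  /\ {for p, continuous (fun q => covec E1 E2 w (f1 q, f2 q, f3 q))}.
Proof.
move=> h1 h2 h3.
have h i : reg p v (fun q => covec E1 E2 w (f1 q, f2 q, f3 q) i 0)
    (covec E1 E2 w (d1, d2, d3) i 0).
  rewrite (_ : (fun q => _) = fun q => f1 q * E1 i 0 + f2 q * E2 i 0 + f3 q * (ww^-1 * w i 0)); last first.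
    by apply: funext => q; rewrite /covec !mxE /= -/ww; ring.
  apply: reg_eq (reg_add (reg_add (reg_mul h1 (reg_cst p v _)) (reg_mul h2 (reg_cst p v _)))
     (reg_mul h3 (reg_cst p v _))) _.
  by rewrite /covec !mxE /= -/ww; ring.
split; first by apply: is_derive_vec => i; case: (h i).
by apply: continuous_vec => i; case: (h i).
Qed.

Let Th0 : \near p, eval2 Th (zf p) (rf p) = 0.
Proof. by apply: filterS (near_U Up) => q /on_level. Qed.

Let D s n := fun q => (derivn n s).[zf q].
Let E m n := fun q => evalr (iter n (@derivr R) (m, k)) (zf q).

Lemma reg_Nf : is_derive p v Nf (unshear p (app3 (jH (J p) (xi p) (et p)) T)) /\
  {for p, continuous Nf}.
Proof.
have h n s := reg_derivn reg_zf s n.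
have hr n m := reg_iter_derivr reg_zf (k_neq0 Up) m n.
have hs := reg_slope reg_zf reg_rf (Thr_neq0 Up) Th0.
have [h1 h2 h3] := @reg_norm R p v zv tx ty (D s11 0) (D s12 0) (D s22 0) (D s11 1) (D s12 1) (D s22 1)
   (D s11 2) (D s12 2) (D s22 2) (D s11 3) (D s12 3) (D s22 3)
   (E na 0) (E nb 0) (E na 1) (E nb 1) (E na 2) (E nb 2) (E na 3) (E nb 3)
   (fun q => slope Th (zf q) (rf q)) (fun q => slope2 Th (zf q) (rf q))
   (fun q => slope3 Th (zf q) (rf q)) xi et
   (h 0 s11) (h 0 s12) (h 0 s22) (h 1 s11) (h 1 s12) (h 1 s22)
   (hr 1 na) (hr 1 nb) hs reg_xi reg_et.
exact: reg_vec h1 h2 h3.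
Qed.

Lemma reg_Wf : reg p v Wf (dot3 (jo (J p) (xi p) (et p)) T).
Proof.
have h n s := reg_derivn reg_zf s n.
have hr n m := reg_iter_derivr reg_zf (k_neq0 Up) m n.
have hs := reg_slope reg_zf reg_rf (Thr_neq0 Up) Th0.
have hs2 := reg_slope2 reg_zf reg_rf (Thr_neq0 Up) Th0.
apply: (@reg_jW R p v zv tx ty (D s11 0) (D s12 0) (D s22 0) (D s11 1) (D s12 1) (D s22 1)
   (D s11 2) (D s12 2) (D s22 2) (D s11 3) (D s12 3) (D s22 3)
   (E na 0) (E nb 0) (E na 1) (E nb 1) (E na 2) (E nb 2) (E na 3) (E nb 3)
   (fun q => slope Th (zf q) (rf q)) (fun q => slope2 Th (zf q) (rf q))
   (fun q => slope3 Th (zf q) (rf q)) xi et rf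
   (h 0 s11) (h 0 s12) (h 0 s22) (h 1 s11) (h 1 s12) (h 1 s22)
   (h 2 s11) (h 2 s12) (h 2 s22)
   (hr 2 na) (hr 2 nb) hs hs2 reg_xi reg_et reg_rf (erefl _)).
Qed.
End Direction.

Let T e p : R * R * R :=
  (dot E1 ('D_e X p) - evalr (derivr (na, k)) (zf p) * (dot w ('D_e X p) / ww),
   dot E2 ('D_e X p) - evalr (derivr (nb, k)) (zf p) * (dot w ('D_e X p) / ww),
   dot w ('D_e X p) / ww).
Let n p := jn (J p) (xi p) (et p).
Let eu : plane := (1, 0).
Let ev : plane := (0, 1).

Let CXu p : U p -> derivable X p eu.
Proof. by case: CX => _ [h _ _ _]; exact: h. Qed.
Let CXv p : U p -> derivable X p ev.
Proof. by case: CX => _ [_ h _ _]; exact: h. Qed.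

Lemma horizontal_normal p : U p -> ((n p).1.1 != 0) || ((n p).1.2 != 0).
Proof.
move=> Up; apply: contraNT (rf_neq0 Up); rewrite negb_or !negbK => /andP[/eqP h1 /eqP h2].
apply/eqP; rewrite /rf.
have -> : qf (sym_at s11 s12 s22 0 (zf p)) (xi p) (et p) = ((n p).1.1 * xi p + (n p).1.2 * et p) / 2.
  by rewrite /n /jn /= /qf /sx /sy /=; field.
by rewrite h1 h2 !mul0r addr0 mul0r.
Qed.

Lemma tangent_cross p : U p -> exists kap,
  cross3 (T eu p) (T ev p) = lin3 kap (n p) 0 (n p) /\
  cross (du X p) (dv X p) = (vol E1 E2 w * kap) *: unshear p (n p).
Proof.
move=> Up; have hu := normal_tangent Up (CXu Up); have hv := normal_tangent Up (CXv Up).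
rewrite -/(T eu p) -/(n p) in hu; rewrite -/(T ev p) -/(n p) in hv.
have [kap hk] : exists kap, cross3 (T eu p) (T ev p) = lin3 kap (n p) 0 (n p).
  exact: cross3_parallel hu hv (horizontal_normal Up).
exists kap; split => //.
rewrite /du /dv (Xv_vec p eu) (Xv_vec p ev) (cross_vec fr) -scalerA; congr (_ *: _).
have -> : kap *: unshear p (n p) = unshear p (lin3 kap (n p) 0 (n p)).
  apply: col3P; rewrite /coords /unshear /covec /shear /lin3 !mxE /=; congr (_, _, _); ring.
by rewrite -hk /unshear -cross_slide.
Qed.

Let Nu e p := unshear p (app3 (jH (J p) (xi p) (et p)) (T e p)).
Let Nf p := unshear p (n p).
Let Wf p := jW (J p) (xi p) (et p).

Lemma app3_adj (H : sym3 R) (a b : R * R * R) :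
  dot3 (app3 H a) a * dot3 (app3 H b) b - dot3 (app3 H b) a ^+ 2 =
  dot3 (cross3 a b) (app3 (adj3 H) (cross3 a b)).
Proof.
case: H a b => h11 h12 h13 h22 h23 h33 [[a1 a2] a3] [[b1 b2] b3].
rewrite /dot3 /app3 /adj3 /cross3 /=; ring.
Qed.

Let second_form_eq (x y z x' y' z' NN L : R) : x = x' -> y = y' -> z = z' ->
  L = (x' * y' - z' ^+ 2) * NN -> L = (x * y - z ^+ 2) * NN.
Proof. by move=> -> -> ->. Qed.

Lemma W_relation p : U p ->
  4 / ww * Wf p * dot (cross (du X p) (dv X p)) (cross (du X p) (dv X p)) =
  (dot (du X p) (Nu eu p) * dot (dv X p) (Nu ev p) - dot (du X p) (Nu ev p) ^+ 2)
  * dot (Nf p) (Nf p).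
Proof.
move=> Up; have [kap [hk hc]] := tangent_cross Up.
pose H := jH (J p) (xi p) (et p); pose a := T eu p; pose b := T ev p.
have a1 : dot (du X p) (Nu eu p) = dot3 (app3 H a) a :=
  eq_trans (dotC (du X p) (Nu eu p)) (dot_unshear p eu _).
have a2 : dot (dv X p) (Nu ev p) = dot3 (app3 H b) b :=
  eq_trans (dotC (dv X p) (Nu ev p)) (dot_unshear p ev _).
have a3 : dot (du X p) (Nu ev p) = dot3 (app3 H b) a :=
  eq_trans (dotC (du X p) (Nu ev p)) (dot_unshear p eu _).
apply: (second_form_eq a1 a2 a3); rewrite {a1 a2 a3} hc !dotZl !dotZr -/(Nf p).
have {hk} hk : cross3 a b = lin3 kap (n p) 0 (n p) := hk; clearbody a b; rewrite /H {H}.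
rewrite app3_adj hk.
have -> : dot3 (lin3 kap (n p) 0 (n p)) (app3 (adj3 (jH (J p) (xi p) (et p))) (lin3 kap (n p) 0 (n p)))
   = kap ^+ 2 * (4 * Wf p).
  rewrite /Wf jWE -/(n p); case: (n p) (adj3 _) => [[n1 n2] n3] [m11 m12 m13 m22 m23 m33].
  rewrite /dot3 /app3 /lin3 /=; ring.
have := frame_vol2 fr; rewrite -/ww => h; have w0 : ww != 0 by exact: frame_ww fr.
rewrite (_ : 4 / ww * Wf p * (vol E1 E2 w * kap * (vol E1 E2 w * kap * dot (Nf p) (Nf p))) =
  4 / ww * Wf p * (vol E1 E2 w ^+ 2 * kap ^+ 2 * dot (Nf p) (Nf p))); last by ring.
by rewrite h; field.
Qed.

Lemma unshear_lin p x s y t :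
  unshear p (lin3 x s y t) = x *: unshear p s + y *: unshear p t.
Proof.
apply: col3P; rewrite /coords /unshear /covec /shear /lin3 !mxE /=.
by congr (_, _, _); ring.
Qed.

(** The determinant of [affine_normal_dot] is given by [det_defect] for the gradient
    of the level; the other factors, W, the factor of [tangent_cross] and the
    volume of the frame, are nonzero. *)
Lemma affine_normal_defect (v : R * R * R) : gaussian_curvature X p0 != 0 ->
  dot (affine_normal X p0) (unshear p0 v) = 0 <-> jdefect (J p0) v (xi p0) (et p0) = 0.
Proof.
move=> K0.
have [kap [hk hc]] := tangent_cross Up0.
have kap0 : kap != 0.
  have := X_reg Up0; rewrite hc; apply: contraNneq => ->.
  by rewrite mulr0 scale0r.
have [_ [_ _ Cu Cv]] := CX.
have w0 : ww != 0 by exact: frame_ww fr.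
have c0 : 4 / ww != 0 by rewrite mulf_neq0 ?invr_eq0.
have W_u := (reg_Wf Up0 (CXu Up0)).1.
have W_v := (reg_Wf Up0 (CXv Up0)).1.
have cW := (reg_Wf Up0 (CXu Up0)).2.
have cN := (reg_Nf Up0 (CXu Up0)).2.
have hXuu p : U p -> derivable (du X) p eu by case: Cu => _ [h _ _ _]; exact: h.
have hXuv p : U p -> derivable (du X) p ev by case: Cu => _ [_ h _ _]; exact: h.
have hXvv p : U p -> derivable (dv X) p ev by case: Cv => _ [_ h _ _]; exact: h.
have cXu : {for p0, continuous (du X)} by case: Cu => h _; exact: h.
have cXv : {for p0, continuous (dv X)} by case: Cv => h _; exact: h.
have hNu p : U p -> is_derive p eu Nf (Nu eu p) by move=> Up; case: (reg_Nf Up (CXu Up)).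
have hNv p : U p -> is_derive p ev Nf (Nu ev p) by move=> Up; case: (reg_Nf Up (CXv Up)).
have oXu p : U p -> dot (Nf p) (du X p) = 0.
  by move=> Up; exact: eq_trans (dot_unshear p eu _) (normal_tangent Up (CXu Up)).
have oXv p : U p -> dot (Nf p) (dv X p) = 0.
  by move=> Up; exact: eq_trans (dot_unshear p ev _) (normal_tangent Up (CXv Up)).
have N0 p : U p -> Nf p != 0.
  move=> Up; apply: (covec_neq0 fr (t := (xi p, et p, 0))).
  apply: contraNneq (rf_neq0 Up) => h; rewrite /rf.
  have -> : qf (sym_at s11 s12 s22 0 (zf p)) (xi p) (et p) =
     dot3 (shear (A1 (J p)).1 (A1 (J p)).2 (n p)) (xi p, et p, 0) / 2.
    by rewrite /n /jn /dot3 /= /qf /sx /sy /=; field.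
  by rewrite h mul0r.
have symN p : U p -> dot (du X p) (Nu ev p) = dot (dv X p) (Nu eu p).
  move=> Up.
  pose H := jH (J p) (xi p) (et p); pose a := T eu p; pose b := T ev p.
  have a1 : dot (dv X p) (Nu eu p) = dot3 (app3 H a) b :=
    eq_trans (dotC (dv X p) (Nu eu p)) (dot_unshear p ev _).
  have a2 : dot (du X p) (Nu ev p) = dot3 (app3 H b) a :=
    eq_trans (dotC (du X p) (Nu ev p)) (dot_unshear p eu _).
  apply: (eq_trans a2 (eq_trans _ (esym a1))); clearbody a b H; case: a b H {a1 a2} => [[a1 a2] a3] [[b1 b2] b3] [h11 h12 h13 h22 h23 h33].
  by rewrite /dot3 /app3 /=; ring.
have WE := W_relation.
have W0 := @W_neq0 R X Nf (Nu eu) (Nu ev) Wf U p0 _ Uo Up0 hXuu hXuv hXvv hNu hNv oXu oXv N0 X_reg WE K0.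
pose H := jH (J p0) (xi p0) (et p0); pose o := jo (J p0) (xi p0) (et p0).
pose a := T eu p0; pose b := T ev p0.
pose lu := lin3 (4 * Wf p0) (app3 H a) (- dot3 o a) (n p0).
pose lv := lin3 (4 * Wf p0) (app3 H b) (- dot3 o b) (n p0).
have AN : dot (affine_normal X p0) (unshear p0 v) = 0 <->
    dot (unshear p0 v) (cross ((4 * Wf p0) *: Nu eu p0 - dot3 o a *: Nf p0)
                             ((4 * Wf p0) *: Nu ev p0 - dot3 o b *: Nf p0)) = 0 :=
  @affine_normal_dot R X Nf (Nu eu) (Nu ev) Wf U p0 _ _ _ Uo Up0
  hXuu hXuv hXvv cXu cXv cN cW hNu hNv oXu oXv N0 X_reg symN c0 WE W_u W_v K0
  (unshear p0 v).
apply: (iff_trans AN) => {AN}.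
have lE c : (4 * Wf p0) *: unshear p0 (app3 H c) - dot3 o c *: unshear p0 (n p0) =
    unshear p0 (lin3 (4 * Wf p0) (app3 H c) (- dot3 o c) (n p0)).
  by rewrite unshear_lin scaleNr.
have lEu : (4 * Wf p0) *: Nu eu p0 - dot3 o a *: Nf p0 = unshear p0 lu := lE a.
have lEv : (4 * Wf p0) *: Nu ev p0 - dot3 o b *: Nf p0 = unshear p0 lv := lE b.
have {hk} hk : cross3 a b = lin3 kap (n p0) 0 (n p0) := hk.
have detE : dot (unshear p0 v) (cross (unshear p0 lu) (unshear p0 lv)) =
    vol E1 E2 w / ww * (4 * Wf p0 * kap * defect (Wf p0) (n p0) H o v).
  rewrite /unshear (det_covec fr) dot_cross_shear.
  by rewrite /lu /lv (det_defect _ _ _ _ hk).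
have detE' := eq_trans (congr2 (fun x y => dot (unshear p0 v) (cross x y)) lEu lEv) detE.
have d0 := frame_vol_neq0 fr; rewrite /jdefect.
split=> h.
  have := eq_trans (esym detE') h => /eqP.
  by rewrite !(mulf_eq0, invr_eq0) (negPf d0) (negPf w0) (negPf W0) (negPf kap0)
    pnatr_eq0 /= => /eqP.
apply: (eq_trans detE'); rewrite (_ : defect _ _ _ _ _ = 0) ?mulr0 //.
Qed.
End Explicit.

(** * Polynomial identities that hold at many heights *)

Section Fractions.
Variable D : idomainType.

Lemma fraction_split (x : {fraction D}) :
  exists n d : D, d != 0 /\ x = tofrac n / tofrac d.
Proof.
have [y ->] : exists y : {ratio D}, x = (\pi_(FracField.type D) y)%qT.
  by exists (repr x); rewrite reprK.
exists (frac y).1, (frac y).2; split; first exact: denom_ratioP.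
have d0 : tofrac (frac y).2 != 0 :> {fraction D} by rewrite tofrac_eq0 denom_ratioP.
apply: (mulIf d0); rewrite divfK //; unlock tofrac.
rewrite -[LHS]FracField.pi_mul; apply/eqmodP.
rewrite /= FracField.equivfE /FracField.mulf /= !numden_Ratio ?(oner_neq0, mulr1, mulf_neq0, denom_ratioP) //.
by rewrite mulrC.
Qed.

Lemma fraction_clear (v n d p : D) : d != 0 ->
  tofrac (v * (n * p)) = tofrac v * (tofrac n / tofrac d) * tofrac (d * p).
Proof. by move=> d0; rewrite !tofracM -!mulrA mulKf ?tofrac_eq0. Qed.
End Fractions.

Section Dense.
Variable R : idomainType.

(** Density in the Zariski topology of the line. *)
Definition dense_set (H : R -> Prop) :=
  forall q : {poly R}, q != 0 -> exists h, H h /\ q.[h] != 0.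

Lemma dense_sub (H H' : R -> Prop) : dense_set H -> (forall h, H h -> H' h) -> dense_set H'.
Proof. by move=> dH sub q /dH [h [/sub Hh qh]]; exists h. Qed.

Lemma dense_poly (H : R -> Prop) q : dense_set H -> q != 0 ->
  dense_set (fun h => H h /\ q.[h] != 0).
Proof.
move=> dH q0 r r0; have [h [Hh]] := dH _ (mulf_neq0 q0 r0).
by rewrite hornerM mulf_eq0 negb_or => /andP[qh rh]; exists h.
Qed.

Lemma dense_eq0 (H : R -> Prop) q : dense_set H -> (forall h, H h -> q.[h] = 0) -> q = 0.
Proof.
move=> dH h0; apply/eqP; apply: contrapT => /negP q0.
by have [h [/h0 -> /eqP]] := dH _ q0.
Qed.
End Dense.

(** If N of the vectors v i were independent over the field of fractions, their
    determinant would be nonzero at some h in H, against the existence of a kernel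
    vector there.  So the rank is less than N, and a kernel vector over the field
    of fractions is cleared of its denominators. *)
Lemma poly_kernel (R : fieldType) N (I : Type) (v : I -> 'I_N -> {poly R}) (H : R -> Prop) :
  dense_set H ->
  (forall h, H h -> exists c : 'I_N -> R, (exists j, c j != 0) /\
    forall i, \sum_j (v i j).[h] * c j = 0) ->
  exists c : 'I_N -> {poly R}, (exists j, c j != 0) /\
    forall i, \sum_j v i j * c j = 0.
Proof.
move=> dH kerH; pose K := {fraction {poly R}}.
pose M0 r (x : 'I_r -> I) : 'M[{poly R}]_(r, N) := \matrix_(a, j) v (x a) j.
pose M r x : 'M[K]_(r, N) := map_mx (@tofrac _) (@M0 r x).
pose P r := `[< exists x, row_free (@M r x) >].
have P0 : P 0.
  apply/asboolP; exists (fun i : 'I_0 => False_rect I (notF (ltn_ord i))).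
  by rewrite /row_free -leqn0 rank_leq_row.
have PN r : P r -> (r <= N)%N.
  by move=> /asboolP [x /eqP <-]; exact: rank_leq_col.
have exP : exists r, P r by exists 0%N.
(* r is the rank of the family over the field of fractions. *)
case: (ex_maxnP exP PN) => r /asboolP [x xfree] maxr.
have rN : (r < N)%N.
  rewrite ltn_neqAle PN ?andbT; last by apply/asboolP; exists x.
  apply/eqP => rN; subst r.
  have detM0 : \det (M0 N x) != 0.
    rewrite -tofrac_eq0 -det_map_mx -unitfE -unitmxE.
    by rewrite -row_free_unit.
  have [h [Hh deth]] := dH _ detM0.
  have [c [[j cj] cE]] := kerH h Hh.
  have Mc : map_mx (horner^~ h) (M0 N x) *m (\col_j c j) = 0.
    apply/colP => a; rewrite !mxE -[RHS](cE (x a)).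
    by apply: eq_bigr => b _; rewrite !mxE.
  have : map_mx (horner^~ h) (M0 N x) \in unitmx.
    by rewrite unitmxE (det_map_mx (horner_eval h)) unitfE.
  move=> uM; have := mulKmx uM (\col_j c j); rewrite Mc mulmx0 => /colP/(_ j).
  by rewrite !mxE => /esym/eqP; rewrite (negPf cj).
have [j0 c0] : exists i, row i (kermx (M r x)^T) != 0.
  apply/existsP; rewrite -negb_forall; apply: contraL rN => /forallP h0.
  have k0 : kermx (M r x)^T = 0.
    by apply/row_matrixP => i; rewrite row0; apply/eqP/h0.
  have := mxrank_ker (M r x)^T; rewrite k0 mxrank0 mxrank_tr => /esym/eqP.
  by rewrite subn_eq0 -leqNgt => /leq_trans; apply; exact: rank_leq_row.
pose c : 'cV[K]_N := (row j0 (kermx (M r x)^T))^T.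
have Mc : M r x *m c = 0.
  by rewrite -[M r x]trmxK -trmx_mul -row_mul mulmx_ker row0 trmx0.
have vc i : (\row_j tofrac (v i j) : 'rV[K]_N) *m c = 0.
  set u := \row_j _.
  have /submxP [D ->] : (u <= M r x)%MS; last by rewrite -mulmxA Mc mulmx0.
  have : ~~ P r.+1 by apply/negP => /maxr; rewrite ltnn.
  move/asboolPn => nP; apply: contrapT => nu; apply: nP.
  exists (fun a : 'I_(r.+1) => if unlift ord_max a is Some b then x b else i).
  apply: inj_row_free => y; set A := M _ _ => yA.
  pose y' : 'rV[K]_r := \row_b y 0 (lift ord_max b).
  have yE : y *m A = y' *m M r x + y 0 ord_max *: u.
    apply/rowP => j; rewrite !mxE (bigD1_ord ord_max) //= addrC; congr (_ + _).
      by apply: eq_bigr => b _; rewrite !mxE liftK.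
    by rewrite !mxE unlift_none.
  have ymax : y 0 ord_max = 0.
    apply: contrapT => /eqP ym; apply: nu.
    have -> : u = (- (y 0 ord_max)^-1 *: y') *m M r x.
      rewrite -scalemxAl; apply: (scalerI ym); rewrite scalerA mulrN divff // scaleN1r.
      by apply/eqP; rewrite -addr_eq0 addrC -yE yA.
    exact: submxMl.
  have y'0 : y' = 0.
    apply: (row_free_inj xfree); rewrite mul0mx.
    by rewrite yE ymax scale0r addr0 in yA.
  apply/rowP => b; rewrite mxE; case: (unliftP ord_max b) => [b' ->|-> //].
  by move/rowP: y'0 => /(_ b'); rewrite !mxE.
pose nd j := fraction_split (c j 0).
have [n /choice [d nE]] := choice nd.
have d0 j : d j != 0 by case: (nE j).
exists (fun j => n j * \prod_(i | i != j) d i); split.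
  have [j cj] : exists j, c j 0 != 0.
    apply/existsP; rewrite -negb_forall; apply: contraNN c0 => /forallP h0.
    apply/eqP/trmx_inj; rewrite -/c; apply/colP => j; rewrite trmx0 [RHS]mxE.
    by apply/eqP/h0.
  exists j; rewrite mulf_neq0 //; last by apply/prodf_neq0 => i _.
  apply: contraNneq cj => n0; case: (nE j) => _ ->.
  by rewrite n0 tofrac0 mul0r.
move=> i; apply/eqP; rewrite -tofrac_eq0 rmorph_sum /=.
have := congr1 (fun m : 'M[K]_1 => m 0 0 * tofrac (\prod_j d j)) (vc i).
rewrite !mxE mul0r => h; apply/eqP; rewrite -[RHS]h big_distrl /=.
apply: eq_bigr => j _; rewrite mxE; case: (nE j) => _ ->.
have -> : \prod_j d j = d j * \prod_(i0 | i0 != j) d i0 by rewrite (bigD1 j).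
by rewrite -fraction_clear.
Qed.

(** * Substitutions in multivariate polynomials *)

Section Substitution.
Variables (n : nat) (A : comNzRingType).
Implicit Types G : {mpoly A[n]}.

Lemma rmorph_mmap (S T : comNzRingType) (phi : {rmorphism S -> T}) (f : A -> S)
    (x : 'I_n -> S) G :
  phi (mmap f x G) = mmap (phi \o f) (phi \o x) G.
Proof.
rewrite /mmap rmorph_sum; apply: eq_bigr => m _ /=.
rewrite rmorphM /mmap1 rmorph_prod; congr (_ * _).
by apply: eq_bigr => i _ /=; rewrite rmorphXn.
Qed.

Lemma eq_mmap (S : comNzRingType) (f g : A -> S) (x y : 'I_n -> S) G :
  f =1 g -> x =1 y -> mmap f x G = mmap g y G.
Proof.
move=> fg xy; apply: eq_bigr => m _; rewrite fg; congr (_ * _).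
by apply: eq_bigr => i _; rewrite xy.
Qed.

Definition psubst G (x : 'I_n -> {poly A}) : {poly A} := mmap (@polyC A) x G.

Lemma horner_psubst G x z : (psubst G x).[z] = meval (fun i => (x i).[z]) G.
Proof.
rewrite -[LHS]/(horner_eval z (psubst G x)) rmorph_mmap /meval.
by apply: eq_mmap => c //=; rewrite /horner_eval ?hornerC.
Qed.

(** The numerator of the value of G at the rational point x / d. *)
Definition numer_subst G (x : 'I_n -> {poly A}) (d : {poly A}) : {poly A} :=
  \sum_(m <- msupp G) (mcoeff m G)%:P * d ^+ (msize G - mdeg m) * mmap1 x m.

End Substitution.

Section Field.
Variables (n : nat) (K : fieldType).
Implicit Types G : {mpoly K[n]}.

Lemma horner_numer_subst G x d z : d.[z] != 0 ->
  (numer_subst G x d).[z] =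
  d.[z] ^+ msize G * meval (fun i => (x i).[z] / d.[z]) G.
Proof.
move=> dz; rewrite /numer_subst mevalE horner_sum big_distrr /=.
rewrite [LHS]big_seq [RHS]big_seq; apply: eq_bigr => m mG.
rewrite !hornerM hornerC horner_exp /mmap1 horner_prod mulrCA -mulrA; congr (_ * _).
rewrite [X in _ = _ * X](eq_bigr (fun i => (x i).[z] ^+ m i * d.[z] ^- m i)); last first.
  by move=> i _ /=; rewrite expr_div_n.
rewrite big_split /= mulrCA [RHS]mulrC; congr (_ * _); last first.
  by apply: eq_bigr => i _; rewrite horner_exp.
rewrite prodfV -expr_sum -mdegE -exprB ?unitfE //.
by apply/ltnW/msize_mdeg_lt.
Qed.
End Field.

Section Infinite.
Variable R : numFieldType.

Lemma dense_setT : dense_set (fun _ : R => True).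
Proof.
move=> q q0; apply: contrapT => h.
have hq i : q.[i%:R] = 0.
  by apply: contrapT => /eqP qi; apply: h; exists i%:R.
have := max_poly_roots (rs := [seq i%:R | i <- iota 0 (size q)]) q0.
rewrite size_map size_iota ltnn => /(_ _ _)/negP; apply=> //.
  by apply/allP => x /mapP [i _ ->]; rewrite rootE hq.
by rewrite map_inj_uniq ?iota_uniq //; exact: (can_inj (@natrK R)) || exact: mulrIn (oner_neq0 R).
Qed.

Lemma polyfun_inj (p q : {poly R}) : (forall z, p.[z] = q.[z]) -> p = q.
Proof.
move=> pq; apply/eqP; rewrite -subr_eq0; apply/eqP.
by apply: (dense_eq0 dense_setT) => z _; rewrite hornerD hornerN pq subrr.
Qed.

Lemma prod3E (S : comNzRingType) (f : 'I_3 -> S) : \prod_i f i = f i0 * f i1 * f i2.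
Proof.
rewrite !big_ord_recl big_ord0 mulr1 mulrA.
by congr (f _ * f _ * f _); apply: val_inj.
Qed.

(** Kronecker substitution makes the exponents of distinct monomials distinct. *)
Lemma meval_neq0 (G : {mpoly R[3]}) : G != 0 -> exists x, meval x G != 0.
Proof.
move=> G0; pose N := msize G.
pose e (m : multinom 3) := (m i0 + N * (m i1 + N * m i2))%N.
pose x i : {poly R} := 'X^(N ^ i).
have xE m : mmap1 x m = 'X^(e m).
  rewrite /mmap1 prod3E /x /= expn0 expn1 -!exprM -!exprD; congr ('X^ _).
  by rewrite /e; lia.
have lt_m m i : m \in msupp G -> (m i < N)%N.
  move=> /msize_mdeg_lt; apply: leq_trans; rewrite ltnS mdegE (bigD1 i) //=.
  exact: leq_addr.
have e_inj : {in msupp G &, injective e}.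
  move=> m m' mG m'G; rewrite /e => E.
  have N0 : (0 < N)%N by exact: leq_ltn_trans (lt_m _ i0 mG).
  have h0 : m i0 = m' i0 :> nat.
    have := congr1 (fun t => t %% N)%N E.
    by rewrite !(mulnC N) ![(_ + _ * N)%N]addnC !modnMDl !modn_small ?lt_m.
  have E' : (m i1 + N * m i2 = m' i1 + N * m' i2)%N.
    by apply/eqP; rewrite -(eqn_pmul2l N0) -(eqn_add2l (m i0)) {2}h0 E.
  have h1 : m i1 = m' i1 :> nat.
    have := congr1 (fun t => t %% N)%N E'.
    by rewrite !(mulnC N) ![(_ + _ * N)%N]addnC !modnMDl !modn_small ?lt_m.
  have h2 : m i2 = m' i2 :> nat.
    by apply/eqP; rewrite -(eqn_pmul2l N0) -(eqn_add2l (m i1)) {2}h1 E'.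
  by apply/mnmP => -[[|[|[|//]]] Hi]; [move: h0|move: h1|move: h2];
    congr (_ = _); congr (_ _); apply: val_inj.
have [m mG] : exists m, m \in msupp G.
  move: G0; rewrite -msupp_eq0; case: (msupp G) => // m s _.
  by exists m; rewrite inE eqxx.
have p0 : psubst G x != 0.
  apply/eqP => /polyP/(_ (e m)); rewrite coef0 /psubst /mmap coef_sum.
  rewrite (bigD1_seq m) ?msupp_uniq //= big1_seq ?addr0; last first.
    move=> m' /andP [m'm m'G]; rewrite xE coefCM coefXn.
    rewrite (_ : (e m == e m') = false) ?mulr0 //.
    by apply: contraNF m'm => /eqP/e_inj-> .
  by rewrite xE coefCM coefXn eqxx mulr1; apply/eqP; rewrite -mcoeff_msupp.
have [z [_]] := dense_setT p0; rewrite horner_psubst => hz.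
by exists (fun i => (x i).[z]).
Qed.
End Infinite.

(** * Families of conics with polynomial coefficients *)

Section Conics.
Variable R : realType.
Implicit Types (S o : R * R * R) (p : {poly R}).

(** The bound n makes the degree of p uniform in the height, so that p can be found
    by linear algebra. *)
Definition conic_data (f : R -> R -> R) n S (o1 o2 : R) p :=
  [/\ dets S != 0, (1 < size p <= n)%N &
      forall x y, f x y = p.[qf S (x - o1) (y - o2)]].

(** Where p' is nonzero, the gradient of the quadratic polynomial with coefficients
    c0, 2 c1, c2, 2 c3, 2 c4 is parallel to the one of S[x - o1, y - o2].  Comparing
    on the lines through the centre, the two polynomials are proportional, up to
    their constant terms. *)
Lemma conic_direction S (c0 c1 c2 c3 c4 o1 o2 : R) p :
  dets S != 0 -> (1 < size p)%N ->
  (exists2 x, x \in [:: c0; c1; c2; c3; c4] & x != 0) ->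
  (forall x y, p^`().[qf S (x - o1) (y - o2)] *
     ((c1 * x + c2 * y + c4) * sx S (x - o1) (y - o2)
      - (c0 * x + c1 * y + c3) * sy S (x - o1) (y - o2)) = 0) ->
  exists2 k, k != 0 & [/\ c0 = k * S.1.1, c1 = k * S.1.2, c2 = k * S.2,
     c3 = - (c0 * o1 + c1 * o2) & c4 = - (c1 * o1 + c2 * o2)].
Proof.
case: S => [[a b] c]; rewrite /dets /sx /sy /= => dS sp cn0 pde.
have p'0 : p^`() != 0.
  apply: contraTneq sp => /polyP/(_ (size p).-2); rewrite coef_deriv coef0 => h.
  rewrite -leqNgt; case E : (size p) h => [|[|m]] //= /eqP.
  rewrite mulrn_eq0 /= => /eqP h; have := lead_coef_eq0 p; rewrite lead_coefE E /= h eqxx.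
  by move=> /esym/eqP p0; move: E; rewrite p0 size_poly0.
pose v1 := c0 * o1 + c1 * o2 + c3; pose v2 := c1 * o1 + c2 * o2 + c4.
(* On the line of the points t (X, Y), relative to the centre, the equation is a
   product of polynomials in t, and the factor coming from p is nonzero. *)
have zero X Y : qf (a, b, c) X Y != 0 ->
    (c1 * X + c2 * Y) * (a * X + b * Y) - (c0 * X + c1 * Y) * (b * X + c * Y) = 0 /\
    v2 * (a * X + b * Y) - v1 * (b * X + c * Y) = 0.
  move=> q0.
  set B2 := (X in X = 0 /\ _); set B1 := (X in _ /\ X = 0).
  have pz : (p^`() \Po (qf (a, b, c) X Y *: 'X^2)) * (B2 *: 'X^2 + B1 *: 'X) = 0.
    apply: polyfun_inj => t; rewrite hornerM horner_comp !(hornerD, hornerZ, hornerXn, hornerX, horner0).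
    rewrite -[RHS](pde (t * X + o1) (t * Y + o2)) !addrK; congr (_ * _).
      by congr (_.[_]); rewrite /qf /=; ring.
    by rewrite /B1 /B2 /v1 /v2; ring.
  have q1 : p^`() \Po (qf (a, b, c) X Y *: 'X^2) != 0.
    rewrite comp_poly_eq0 //; first by rewrite size_scale // size_polyXn.
  move/eqP: pz; rewrite mulf_eq0 (negPf q1) /= => /eqP/polyP pz.
  by split; [have := pz 2%N|have := pz 1%N]; rewrite !coefE /= ?mulr1 ?mulr0 ?addr0 ?add0r.
have ext (P : {poly R}) : (forall Y, qf (a, b, c) 1 Y != 0 -> P.[Y] = 0) -> P = 0.
  move=> hP; pose q1 := c *: 'X^2 + (2 * b) *: 'X + a%:P.
  have q1E Y : q1.[Y] = qf (a, b, c) 1 Y.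
    by rewrite /q1 !(hornerD, hornerZ, hornerXn, hornerX, hornerC) /qf /=; ring.
  have q10 : q1 != 0.
    apply: contraNneq dS => /polyP q0.
    have := q0 0%N; have := q0 1%N; have := q0 2%N; rewrite !coefE /=.
    rewrite !(mulr0, mulr1, addr0, add0r) => -> /eqP; rewrite mulf_eq0 pnatr_eq0 /=.
    by move=> /eqP-> ->; apply/eqP; ring.
  apply/eqP; have : P * q1 = 0.
    apply: polyfun_inj => Y; rewrite hornerM horner0 q1E.
    by have [->|/hP->] := eqVneq (qf (a, b, c) 1 Y) 0; rewrite ?mulr0 ?mul0r.
  by move/eqP; rewrite mulf_eq0 (negPf q10) orbF.
have /polyP e2 : (c2 * b - c1 * c) *: 'X^2 + (c2 * a - c0 * c) *: 'X + (c1 * a - c0 * b)%:P = 0.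
  apply: ext => Y /zero [<- _].
  by rewrite !(hornerD, hornerZ, hornerXn, hornerX, hornerC); ring.
have /polyP e1 : (v2 * b - v1 * c) *: 'X + (v2 * a - v1 * b)%:P = 0.
  apply: ext => Y /zero [_ <-].
  by rewrite !(hornerD, hornerZ, hornerXn, hornerX, hornerC); ring.
have := e2 0%N; have := e2 1%N; have := e2 2%N; rewrite !coefE /=.
rewrite !(mulr0, mulr1, addr0, add0r) => h2 h1 h0.
have := e1 0%N; have := e1 1%N; rewrite !coefE /=.
rewrite !(mulr0, mulr1, addr0, add0r) => g1 g0.
have v20 : v2 = 0.
  apply: (mulIf dS); rewrite mul0r.
  transitivity (c * (v2 * a - v1 * b) - b * (v2 * b - v1 * c)); first by ring.
  by rewrite g1 g0; ring.
have v10 : v1 = 0.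
  apply: (mulIf dS); rewrite mul0r.
  transitivity (b * (v2 * a - v1 * b) - a * (v2 * b - v1 * c)); first by ring.
  by rewrite g1 g0; ring.
have E3 : c3 = - (c0 * o1 + c1 * o2).
  by apply/eqP; rewrite -addr_eq0 addrC; apply/eqP.
have E4 : c4 = - (c1 * o1 + c2 * o2).
  by apply/eqP; rewrite -addr_eq0 addrC; apply/eqP.
move/eqP: h0; rewrite subr_eq0 => /eqP h0.
move/eqP: h1; rewrite subr_eq0 => /eqP h1.
move/eqP: h2; rewrite subr_eq0 => /eqP h2.
have [k [k0 k1 k2]] : exists k, [/\ c0 = k * a, c1 = k * b & c2 = k * c].
  have [a0|a0] := eqVneq a 0; last first.
    by exists (c0 / a); split; [rewrite divfK|apply: (mulIf a0); rewrite h0; field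
      |apply: (mulIf a0); rewrite h1; field].
  have b0 : b != 0 by apply: contraNneq dS => ->; rewrite a0; apply/eqP; ring.
  exists (c1 / b); split; [|by rewrite divfK|by apply: (mulIf b0); rewrite h2; field].
  by apply: (mulIf b0); rewrite -h0 a0 !mulr0 mul0r.
exists k; last by split.
apply/eqP => kz; case: cn0 => x.
have {E3}E3 : c3 = 0 by rewrite E3 k0 k1 kz; ring.
have {E4}E4 : c4 = 0 by rewrite E4 k1 k2 kz; ring.
rewrite !inE k0 k1 k2 kz E3 E4 !mul0r => h /negP; apply.
by move: h; rewrite !orbb.
Qed.
End Conics.

Definition j5_0 : 'I_5 := @Ordinal 5 0 isT.
Definition j5_1 : 'I_5 := @Ordinal 5 1 isT.
Definition j5_2 : 'I_5 := @Ordinal 5 2 isT.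
Definition j5_3 : 'I_5 := @Ordinal 5 3 isT.
Definition j5_4 : 'I_5 := @Ordinal 5 4 isT.

Lemma sum5E (K : nmodType) (f : 'I_5 -> K) :
  \sum_j f j = f j5_0 + f j5_1 + f j5_2 + f j5_3 + f j5_4.
Proof.
rewrite !big_ord_recl big_ord0 addr0 !addrA.
by congr (f _ + f _ + f _ + f _ + f _); apply: val_inj.
Qed.

Lemma ord5P (P : 'I_5 -> Prop) :
  P j5_0 -> P j5_1 -> P j5_2 -> P j5_3 -> P j5_4 -> forall j, P j.
Proof.
move=> P0 P1 P2 P3 P4 [[|[|[|[|[|//]]]]] Hi].
- by rewrite (_ : Ordinal Hi = j5_0); last exact: val_inj.
- by rewrite (_ : Ordinal Hi = j5_1); last exact: val_inj.
- by rewrite (_ : Ordinal Hi = j5_2); last exact: val_inj.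
- by rewrite (_ : Ordinal Hi = j5_3); last exact: val_inj.
- by rewrite (_ : Ordinal Hi = j5_4); last exact: val_inj.
Qed.

Section ConicField.
Variable R : realType.
Variables (f fx fy : R -> R -> {poly R}) (n : nat) (H : R -> Prop).
Hypothesis dX : forall x y h, exists L : {poly R},
  (forall e, L.[e] = (f (x + e) y).[h]) /\ L`_1 = (fx x y).[h].
Hypothesis dY : forall x y h, exists L : {poly R},
  (forall e, L.[e] = (f x (y + e)).[h]) /\ L`_1 = (fy x y).[h].
Hypothesis dH : dense_set H.

Let data h := conic_data (fun x y => (f x y).[h]) n.

Hypothesis Hdata : forall h, H h -> exists S o1 o2 p, data h S o1 o2 p.

Let coef1_comp (p : {poly R}) c0 c1 c2 :
  (p \Po (c2 *: 'X^2 + c1 *: 'X + c0%:P))`_1 = p^`().[c0] * c1.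
Proof.
have -> (q : {poly R}) : q`_1 = q^`().[0].
  by rewrite horner_coef0 coef_deriv.
rewrite deriv_comp hornerM horner_comp derivD derivD derivC !derivZ derivX derivXn.
rewrite !(hornerD, hornerZ, hornerXn, hornerX, hornerC, hornerMn) /=.
by congr (_.[_] * _); ring.
Qed.

Lemma conic_gradient h S o1 o2 p x y : data h S o1 o2 p ->
  (fx x y).[h] = p^`().[qf S (x - o1) (y - o2)] * (2 * sx S (x - o1) (y - o2)) /\
  (fy x y).[h] = p^`().[qf S (x - o1) (y - o2)] * (2 * sy S (x - o1) (y - o2)).
Proof.
move=> [_ _ fE]; split.
  have [L [LE <-]] := dX x y h.
  rewrite -(coef1_comp p (qf S (x - o1) (y - o2)) (2 * sx S (x - o1) (y - o2)) S.1.1).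
  set M := p \Po _; suff -> : L = M by []; apply: polyfun_inj => e; rewrite /M.
  rewrite LE fE horner_comp !(hornerD, hornerZ, hornerXn, hornerX, hornerC).
  by congr (_.[_]); rewrite /qf /sx; ring.
have [L [LE <-]] := dY x y h.
rewrite -(coef1_comp p (qf S (x - o1) (y - o2)) (2 * sy S (x - o1) (y - o2)) S.2).
set M := p \Po _; suff -> : L = M by []; apply: polyfun_inj => e; rewrite /M.
rewrite LE fE horner_comp !(hornerD, hornerZ, hornerXn, hornerX, hornerC).
by congr (_.[_]); rewrite /qf /sy; ring.
Qed.

(** By [conic_direction] the coefficients of the conics at a height are determined
    up to a factor by linear equations whose coefficients are polynomial in the
    height, so [poly_kernel] applies. *)
Lemma conic_polys : exists s11 s12 s22 m1 m2 : {poly R},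
  dense_set (fun h => H h /\ forall S o1 o2 p, data h S o1 o2 p ->
    exists2 k, k != 0 & [/\ s11.[h] = k * S.1.1, s12.[h] = k * S.1.2,
      s22.[h] = k * S.2, m1.[h] = - (s11.[h] * o1 + s12.[h] * o2) &
      m2.[h] = - (s12.[h] * o1 + s22.[h] * o2)]).
Proof.
pose v (xy : R * R) (j : 'I_5) : {poly R} := nth 0
  [:: - xy.1 *: fy xy.1 xy.2; xy.1 *: fx xy.1 xy.2 - xy.2 *: fy xy.1 xy.2;
      xy.2 *: fx xy.1 xy.2; - fy xy.1 xy.2; fx xy.1 xy.2] j.
have vE (c : 'I_5 -> R) h x y : \sum_j (v (x, y) j).[h] * c j =
    (c j5_1 * x + c j5_2 * y + c j5_4) * (fx x y).[h]
  - (c j5_0 * x + c j5_1 * y + c j5_3) * (fy x y).[h].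
  rewrite sum5E /v /=.
  rewrite !(hornerD, hornerN, hornerZ).
  ring.
have [c [[j cj] cE]] : exists c : 'I_5 -> {poly R}, (exists j, c j != 0) /\
    forall i, \sum_j v i j * c j = 0.
  apply: (poly_kernel dH) => h /Hdata [] S [] o1 [] o2 [] p D.
  pose l := [:: S.1.1; S.1.2; S.2; - (S.1.1 * o1 + S.1.2 * o2); - (S.1.2 * o1 + S.2 * o2)].
  exists (fun j : 'I_5 => nth 0 l j); split.
    case: (D) => dS _ _.
    have [a0|a0] := eqVneq S.1.1 0; last by exists j5_0.
    exists j5_1 => /=; apply: contraNneq dS.
    by rewrite /dets a0 => ->; apply/eqP; ring.
  move=> [x y]; rewrite vE /=.
  have [-> ->] := conic_gradient x y D.
  by rewrite /sx /sy; ring.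
exists (c j5_0), (c j5_1), (c j5_2), (c j5_3), (c j5_4).
apply: dense_sub (dense_poly dH cj) _ => h [Hh cjh]; split=> // S o1 o2 p D.
have [dS sp _] := D; have [sp1 _] := andP sp.
have [||k k0 [e0 e1 e2 e3 e4]] := @conic_direction R S (c j5_0).[h] (c j5_1).[h] (c j5_2).[h]
  (c j5_3).[h] (c j5_4).[h] o1 o2 p dS sp1.
- exists (c j).[h] => //; rewrite !inE.
  by move: j {cj cjh}; apply: ord5P; rewrite eqxx ?orbT.

- move=> x y; have [gx gy] := conic_gradient x y D.
  have := congr1 (fun q : {poly R} => q.[h]) (cE (x, y)).
  rewrite horner_sum horner0 (eq_bigr (fun j => (v (x, y) j).[h] * (c j).[h])); last first.
    by move=> i _; rewrite hornerM.
  rewrite (vE (fun j => (c j).[h])) gx gy => h0.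
  apply: (mulfI (_ : 2 != 0)); first by rewrite pnatr_eq0.
  rewrite mulr0 -[RHS]h0; ring.
by exists k => //; split; rewrite ?e0 ?e1 ?e2 ?e3 ?e4 //.
Qed.
End ConicField.

(** * Coordinates adapted to the axis *)

Section LevelPolys.
Variable R : realType.

Definition qfp (t11 t12 t22 : {poly R}) (X Y : R) : {poly R} :=
  X ^+ 2 *: t11 + (2 * X * Y) *: t12 + Y ^+ 2 *: t22.

Lemma horner_qfp t11 t12 t22 X Y z :
  (qfp t11 t12 t22 X Y).[z] = qf (t11.[z], t12.[z], t22.[z]) X Y.
Proof. by rewrite /qfp !(hornerD, hornerZ) /qf /=; ring. Qed.

(** At a height h, the coefficients of p together with 1 are a kernel vector of the
    family of the powers of the form and of - f, indexed by the points (X, Y).  In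
    the polynomial kernel vector the coefficient of f is nonzero, because the
    powers of the form are independent. *)
Lemma level_polys (f : R -> R -> {poly R}) t11 t12 t22 n (H : R -> Prop) X0 Y0 :
  dense_set H -> qfp t11 t12 t22 X0 Y0 != 0 ->
  (forall h, H h -> exists2 p : {poly R}, (size p <= n)%N &
    forall X Y, (f X Y).[h] = p.[(qfp t11 t12 t22 X Y).[h]]) ->
  exists2 D : {poly R}, D != 0 & exists Phi : {poly {poly R}}, forall X Y z,
    D.[z] * (f X Y).[z] = eval2 Phi z (qfp t11 t12 t22 X Y).[z].
Proof.
move=> dH q0 Hp; pose q := qfp t11 t12 t22.
pose v (XY : R * R) (j : 'I_n.+1) : {poly R} :=
  if unlift ord_max j is Some i then q XY.1 XY.2 ^+ i else - f XY.1 XY.2.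
have vE (S : comNzRingType) (phi : {poly R} -> S) (c : 'I_n.+1 -> S) XY :
    \sum_j phi (v XY j) * c j =
    phi (- f XY.1 XY.2) * c ord_max + \sum_(i < n) phi (q XY.1 XY.2 ^+ i) * c (lift ord_max i).
  rewrite (bigD1_ord ord_max) //= /v unlift_none; congr (_ + _).
  by apply: eq_bigr => i _; rewrite liftK.
have [c [[j cj] cE]] : exists c : 'I_n.+1 -> {poly R}, (exists j, c j != 0) /\
    forall i, \sum_j v i j * c j = 0.
  apply: (poly_kernel dH) => h /Hp [p sp pE].
  exists (fun j => if unlift ord_max j is Some i then p`_i else 1); split.
    by exists ord_max; rewrite unlift_none oner_eq0.
  move=> [X Y]; rewrite (vE _ (fun P => P.[h])) unlift_none mulr1 /= hornerN pE.
  rewrite (horner_coef_wide _ sp) addrC; apply/eqP; rewrite subr_eq0; apply/eqP.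
  by apply: eq_bigr => i _; rewrite liftK horner_exp mulrC.
pose Phi : {poly {poly R}} := \poly_(i < n) (if insub i is Some i' then c (lift ord_max i') else 0).
have PhiE X Y z : eval2 Phi z (q X Y).[z] = \sum_(i < n) (q X Y ^+ i).[z] * (c (lift ord_max i)).[z].
  rewrite /eval2 horner_poly horner_sum; apply: eq_bigr => i _.
  rewrite valK hornerM -rmorphXn hornerC horner_exp mulrC; congr (_ * _).
have cEz X Y z : (c ord_max).[z] * (f X Y).[z] = eval2 Phi z (q X Y).[z].
  have := congr1 (fun P : {poly R} => P.[z]) (cE (X, Y)).
  rewrite (vE _ id) horner0 hornerD hornerM hornerN mulNr horner_sum.
  move/eqP; rewrite addrC subr_eq0 => /eqP h; rewrite mulrC -h PhiE.
  by apply: eq_bigr => i _; rewrite hornerM.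
exists (c ord_max); last by exists Phi.
apply/eqP => c0.
(* If the coefficient of f were zero, a nonzero polynomial would vanish at all the
   values of the form at some height. *)
have {}cj : exists i, c (lift ord_max i) != 0.
  by case: (unliftP ord_max j) cj => [i ->|->]; [exists i|rewrite c0 eqxx].
case: cj => i ci.
have [z [_]] := dense_setT (mulf_neq0 ci q0).
rewrite hornerM mulf_eq0 negb_or => /andP[cz qz].
pose P : {poly R} := \poly_(i < n) (if insub i is Some i' then (c (lift ord_max i')).[z] else 0).
have P0 : P != 0.
  apply/eqP => /polyP/(_ i); rewrite coef_poly ltn_ord valK coef0.
  by apply/eqP.
have : P \Po ((q X0 Y0).[z] *: 'X^2) != 0.
  by rewrite comp_poly_eq0 // size_scale // size_polyXn.
case/eqP; apply: polyfun_inj => u; rewrite horner0 horner_comp hornerZ hornerXn.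
have <- : (q (u * X0) (u * Y0)).[z] = (q X0 Y0).[z] * u ^+ 2.
  by rewrite /q !horner_qfp /qf /=; ring.
transitivity (eval2 Phi z (q (u * X0) (u * Y0)).[z]); last by rewrite -cEz c0 horner0 mul0r.
rewrite PhiE horner_poly; apply: eq_bigr => k _.
by rewrite valK mulrC horner_exp.
Qed.
End LevelPolys.

Section Coordinates.
Variables (R : realType) (F : {mpoly R[3]}).
Local Notation point := 'cV[R]_3.
Variables (Q E1 E2 w : point).

Definition pt x y z : point := Q + x *: E1 + y *: E2 + z *: w.

Definition restr x y : {poly R} :=
  psubst F (fun i => (Q i 0 + x * E1 i 0 + y * E2 i 0)%:P + (w i 0)%:P * 'X).

Lemma horner_restr x y z : (restr x y).[z] = evalP F (pt x y z).
Proof.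
rewrite horner_psubst; apply: meval_eq => i.
by rewrite hornerD hornerM !hornerC hornerX /pt !mxE; ring.
Qed.

(** The coefficient of the first power of e in F(pt x y z + e v), as a polynomial in
    the height z. *)
Definition restr_deriv (v : point) x y : {poly R} :=
  (mmap (polyC \o polyC) (fun i => ((Q i 0 + x * E1 i 0 + y * E2 i 0)%:P
     + (w i 0)%:P * 'X)%:P + (v i 0)%:P%:P * 'X) F : {poly {poly R}})`_1.

Lemma restr_line v x y h : exists L : {poly R},
  (forall e, L.[e] = evalP F (pt x y h + e *: v)) /\ L`_1 = (restr_deriv v x y).[h].
Proof.
exists (psubst F (fun i => (pt x y h i 0)%:P + (v i 0)%:P * 'X)); split.
  move=> e; rewrite horner_psubst; apply: meval_eq => i.
  by rewrite hornerD hornerM !hornerC hornerX /pt !mxE; ring.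
rewrite /restr_deriv -[RHS]/(horner_eval h _) -coef_map rmorph_mmap /psubst.
set A := mmap _ _ _; set B := mmap _ _ _; suff -> : A = B by [].
apply: eq_mmap => c /=.
  by rewrite map_polyC /= /horner_eval hornerC.
rewrite rmorphD rmorphM /= !map_polyC map_polyX /= /horner_eval.
by rewrite hornerD hornerM !hornerC hornerX /pt !mxE; congr (_%:P + _); ring.
Qed.

Lemma restr_dX x y h : exists L : {poly R},
  (forall e, L.[e] = (restr (x + e) y).[h]) /\ L`_1 = (restr_deriv E1 x y).[h].
Proof.
have [L [h1 h2]] := restr_line E1 x y h; exists L; split=> // e.
by rewrite h1 horner_restr /pt; congr evalP; apply/colP => i; rewrite !mxE; ring.
Qed.

Lemma restr_dY x y h : exists L : {poly R},
  (forall e, L.[e] = (restr x (y + e)).[h]) /\ L`_1 = (restr_deriv E2 x y).[h].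
Proof.
have [L [h1 h2]] := restr_line E2 x y h; exists L; split=> // e.
by rewrite h1 horner_restr /pt; congr evalP; apply/colP => i; rewrite !mxE; ring.
Qed.

(** F in coordinates with the origin at the centre (na / k, nb / k), multiplied by a
    power of k to be a polynomial. *)
Definition moving (na nb k : {poly R}) X Y : {poly R} :=
  numer_subst F (fun i => k * (Q i 0 + X * E1 i 0 + Y * E2 i 0 )%:P
    + (na * (E1 i 0)%:P + nb * (E2 i 0)%:P) + k * 'X * (w i 0)%:P) k.

Lemma horner_moving na nb k X Y z : k.[z] != 0 ->
  (moving na nb k X Y).[z] = k.[z] ^+ msize F
    * evalP F (pt (X + na.[z] / k.[z]) (Y + nb.[z] / k.[z]) z).
Proof.
move=> kz; rewrite horner_numer_subst //; congr (_ * _); apply: meval_eq => i.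
by rewrite !(hornerD, hornerM, hornerC, hornerX) /pt !mxE; field.
Qed.
End Coordinates.

(** * Solutions of the linear system *)

Section Fractions3.
Variable D : idomainType.
Implicit Types (a n d : 'I_3 -> D).

Lemma fraction_sum0 a n d : (forall i, d i != 0) ->
  (tofrac (a i0) * (tofrac (n i0) / tofrac (d i0)) +
   tofrac (a i1) * (tofrac (n i1) / tofrac (d i1)) +
   tofrac (a i2) * (tofrac (n i2) / tofrac (d i2)) == 0 :> {fraction D}) =
  (a i0 * n i0 * (d i1 * d i2) + a i1 * n i1 * (d i0 * d i2)
   + a i2 * n i2 * (d i0 * d i1) == 0).
Proof.
move=> d0; have e i : tofrac (d i) != 0 :> {fraction D} by rewrite tofrac_eq0.
rewrite -[RHS]tofrac_eq0 !(tofracD, tofracM).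
set x0 := tofrac (d i0) in e *; set x1 := tofrac (d i1); set x2 := tofrac (d i2).
have h : x0 * x1 * x2 != 0 by rewrite !mulf_neq0 ?e.
rewrite -[LHS](inj_eq (mulIf h)) mul0r; congr (_ == _).
rewrite !mulrDl; congr (_ + _ + _).
- rewrite -!mulrA; congr (_ * (_ * _)); rewrite mulKf ?e //.
- rewrite -!mulrA; congr (_ * (_ * _)); rewrite mulrCA; congr (_ * _).
  by rewrite mulKf ?e.
- rewrite -!mulrA; congr (_ * (_ * _)); rewrite mulrCA; congr (_ * _).
  by rewrite mulrCA mulVf ?e // mulr1.
Qed.

Lemma fraction_eq (n d m e : D) : d != 0 -> e != 0 ->
  tofrac n / tofrac d = tofrac m / tofrac e :> {fraction D} -> n * e = m * d.
Proof.
move=> d0 e0 /eqP; rewrite eqr_div ?tofrac_eq0 //.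
by rewrite -!tofracM tofrac_eq => /eqP.
Qed.
End Fractions3.

Section NormalField.
Variable R : realType.
Local Notation point := 'cV[R]_3.
Variables (F : {mpoly R[3]}) (gamma : 'cV[{fraction {mpoly R[3]}}]_3).
Hypothesis gamma_normal : affine_normal_field F gamma.

(** A triple product turns the equations of the system into the orthogonality of
    gamma to the field alpha x P + beta. *)
Definition field_poly (ba : point * point) : 'cV[{mpoly R[3]}]_3 :=
  cross (map_mx (@mpolyC 3 R) ba.2) (\col_i mpolyX R (mnm1 i)) + map_mx (@mpolyC 3 R) ba.1.
Definition field_at (ba : point * point) (P : point) : point := cross ba.2 P + ba.1.

Lemma evalPM G H P : evalP (G * H) P = evalP G P * evalP H P :> R.
Proof. exact: mevalM. Qed.
Lemma evalPD G H P : evalP (G + H) P = evalP G P + evalP H P :> R.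
Proof. exact: mevalD. Qed.

Lemma field_polyE ba P i : evalP (field_poly ba i 0) P = field_at ba P i 0.
Proof.
move: i; apply: ord3P; rewrite /field_poly /field_at /cross !mxE /= ?mxE /evalP;
 by rewrite !(mevalD, mevalN, mevalM, mevalC, mevalXU).
Qed.

Lemma solves_LE ba : solves_L gamma ba <->
  tofrac (field_poly ba i0 0) * gamma i0 0 + tofrac (field_poly ba i1 0) * gamma i1 0
  + tofrac (field_poly ba i2 0) * gamma i2 0 = 0.
Proof.
rewrite /solves_L; set L := (X in X = 0 <-> _); set L' := (X in _ <-> X = 0).
suff -> : L = L' by [].
rewrite /L /L' !dotE crossE /dot3 /cross3 /coords /field_poly /cross !mxE /= ?mxE.
rewrite /frac_const !(tofracD, tofracB, tofracN, tofracM).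
move: (tofrac _) (tofrac _) (tofrac _) (tofrac _) (tofrac _) (tofrac _) (tofrac _) (tofrac _) (tofrac _).
move: (gamma i0 0) (gamma i1 0) (gamma i2 0) => g0 g1 g2 a b c d e f g h k.
ring.
Qed.

Lemma normal_annihilates ba : solves_L gamma ba ->
  exists2 G : {mpoly R[3]}, G != 0 & forall P, evalP G P != 0 ->
    exists X p0, [/\ local_parametrization F P X p0, gaussian_curvature X p0 != 0 &
      dot (affine_normal X p0) (field_at ba P) = 0].
Proof.
move=> /solves_LE sol; have [G G0 GP] := gamma_normal; exists G => // P /GP.
move=> [g [gv [X [p0 [hX hK [a a0 xi]]]]]]; exists X, p0; split=> //.
rewrite xi dotZl; apply/eqP; rewrite mulf_eq0 (negPf a0) /=.
have [n /choice [d hnd]] := choice gv.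
have d0 i : d i != 0.
  by case: (hnd i) => h _ _; apply: contraNneq h => ->; rewrite /evalP meval0.
move: sol; case: (hnd i0) => h0 -> g0; case: (hnd i1) => h1 -> g1; case: (hnd i2) => h2 -> g2.
move/eqP; rewrite (fraction_sum0 (fun i => field_poly ba i 0)) //.
move=> /eqP/(congr1 (fun S => evalP S P)); rewrite !(evalPD, evalPM) !field_polyE.
rewrite /evalP meval0 -!/(evalP _ P) => h.
rewrite dotE /dot3 /= g0 g1 g2; apply/eqP.
have hd : evalP (d i0) P * evalP (d i1) P * evalP (d i2) P != 0 by rewrite !mulf_neq0.
apply: (mulIf hd); rewrite mul0r -[RHS]h.
by field; rewrite h0 h1 h2.
Qed.

(** Otherwise the numerator of the left-hand side of the system is nonzero, and so is
    its product N with the denominators and with the polynomial outside of whose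
    zeros gamma is parallel to the affine normal; a zero of the field at a point
    where N is nonzero is a contradiction. *)
Lemma annihilated_solves ba :
  (forall N : {mpoly R[3]}, N != 0 -> exists2 P, evalP N P != 0 &
    forall X p0, local_parametrization F P X p0 -> gaussian_curvature X p0 != 0 ->
    dot (affine_normal X p0) (field_at ba P) = 0) ->
  solves_L gamma ba.
Proof.
move=> h; apply/solves_LE.
have [n /choice [d hnd]] := choice (fun i => fraction_split (gamma i 0)).
have d0 i : d i != 0 by case: (hnd i).
case: (hnd i0) => _ ->; case: (hnd i1) => _ ->; case: (hnd i2) => _ ->.
apply/eqP; rewrite (fraction_sum0 (fun i => field_poly ba i 0)) //.
set S := (X in X == 0); apply: contraT => S0.
have [G G0 GP] := gamma_normal.
have [P] := h _ (mulf_neq0 (mulf_neq0 S0 G0)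
  (mulf_neq0 (d0 i0) (mulf_neq0 (d0 i1) (d0 i2)))).
rewrite !evalPM !mulf_eq0 !negb_or.
move=> /andP[/andP[SP /GP]].
move=> [g [gv [X [p0 [hX hK [a a0 xi]]]]]] /andP[dP0 /andP[dP1 dP2]] hP.
have := hP X p0 hX hK; rewrite xi dotZl => /eqP; rewrite mulf_eq0 (negPf a0) /=.
have gE i : evalP (d i) P != 0 -> g i 0 = evalP (n i) P / evalP (d i) P.
  move=> dP; case: (gv i) => m [e [eP]]; case: (hnd i) => _ ->.
  have e0 : e != 0 by apply: contraNneq eP => ->; rewrite /evalP meval0.
  move=> /(fraction_eq (d0 i) e0) nm ->.
  by apply/eqP; rewrite eqr_div // -!evalPM nm.
rewrite dotE /dot3 /= !gE // => hz; case/eqP: SP.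
rewrite /S !(evalPD, evalPM) !field_polyE.
have hd : evalP (d i0) P * evalP (d i1) P * evalP (d i2) P != 0 by rewrite !mulf_neq0.
move/eqP: hz => /(congr1 (fun t => t * (evalP (d i0) P * evalP (d i1) P * evalP (d i2) P))).
rewrite mul0r => <-.
by field; rewrite dP0 dP1 dP2.
Qed.
End NormalField.

(** * The affine normal at the points of the surface *)

Section Local.
Variable R : realType.
Local Notation plane := (R * R)%type.
Local Notation point := 'cV[R]_3.
Variables (F : {mpoly R[3]}) (Q E1 E2 w : point).
Hypothesis fr : frame E1 E2 w.

Lemma Ck_sub n (U V : set plane) (X : plane -> point) : V `<=` U -> Ck n U X -> Ck n V X.
Proof.
move=> VU; elim: n X => [|n ih] X [hc hn].
  exact: (conj (fun p Vp => hc p (VU p Vp)) I).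
have [h1 h2 h3 h4] := hn.
exact: (conj (fun p Vp => hc p (VU p Vp)) (And4 (fun p Vp => h1 p (VU p Vp))
  (fun p Vp => h2 p (VU p Vp)) (ih _ h3) (ih _ h4))).
Qed.

Lemma near_neq0 (f : plane -> R) p : {for p, continuous f} -> f p != 0 ->
  \near p, f p != 0.
Proof.
move=> cf fp; apply: filterS (continuous_sg cf fp) => q h.
by rewrite -sgr_eq0 h sgr_eq0.
Qed.

Lemma pt_frame P : P = pt Q E1 E2 w (frame_x Q E1 P) (frame_y Q E2 P) (frame_z Q w P).
Proof.
rewrite /pt /frame_x /frame_y /frame_z; have := frame_decomp fr (P - Q).
rewrite !dotDr !dotNr => h.
by rewrite -!addrA [X in Q + X]addrA -h addrC subrK.
Qed.

Variables (s11 s12 s22 na nb k D : {poly R}) (Phi : {poly {poly R}}).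
Hypothesis level_eq : forall x y z, k.[z] != 0 ->
  D.[z] * evalP F (pt Q E1 E2 w (x + evalr (na, k) z) (y + evalr (nb, k) z) z) =
  eval2 Phi z (qf (sym_at s11 s12 s22 0 z) x y).

Definition level_poly (c : R) := Phi - (c *: D)%:P.

(** The conditions required by [affine_normal_defect] on an open set hold near p0 by
    continuity. *)
Lemma defect_at P X p0 v :
  let z0 := frame_z Q w P in
  let x0 := frame_x Q E1 P - evalr (na, k) z0 in
  let y0 := frame_y Q E2 P - evalr (nb, k) z0 in
  let r0 := qf (sym_at s11 s12 s22 0 z0) x0 y0 in
  local_parametrization F P X p0 -> gaussian_curvature X p0 != 0 ->
  k.[z0] != 0 -> eval2 Phi^`() z0 r0 != 0 -> r0 != 0 ->
  dot (affine_normal X p0) (covec E1 E2 w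
    (shear (evalr (derivr (na, k)) z0) (evalr (derivr (nb, k)) z0) v)) = 0 <->
  jdefect (jet_at s11 s12 s22 na nb k (level_poly (evalP F P)) z0 r0) v x0 y0 = 0.
Proof.
move=> z0 x0 y0 r0 [U [[Uo Up0 XP _] [CX Xreg Xlev]]] K0 k0 Phir r0n.
have C2 := CX 2%N; have C1 : Ck 2 [set p0] X by apply: Ck_sub C2 => p ->.
have dXu : derivable X p0 ((1, 0) : plane) by case: C2 => _ [h _ _ _]; exact: h.
have kp (p : plane) : [set p0] p -> k.[frame_z Q w (X p)] != 0.
  by move=> ->; rewrite XP.
have hz := reg_zf Q w C1 (erefl p0) dXu.
have hx := reg_xi E1 na C1 kp (erefl p0) dXu.
have hy := reg_et E2 nb C1 kp (erefl p0) dXu.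
have hs s := reg_horner s hz.
have hr := reg_add (reg_add (reg_mul (hs s11) (reg_exp 2 hx))
   (reg_mul (reg_mul (reg_mul (reg_cst p0 _ 2) (hs s12)) hx) hy))
   (reg_mul (hs s22) (reg_exp 2 hy)).
have hT := reg_eval2 Phi^`() hz hr.
have n1 := near_neq0 (reg_continuous (hs k)) _.
have n2 := near_neq0 (reg_continuous hr) _.
have n3 := near_neq0 (reg_continuous hT) _.
rewrite /= XP in n1 n2 n3.
have nU : nbhs p0 U by apply: open_nbhs_nbhs; split.
pose A : set plane := fun p => (U p /\ k.[frame_z Q w (X p)] != 0) /\
  (qf (sym_at s11 s12 s22 0 (frame_z Q w (X p)))
     (frame_x Q E1 (X p) - evalr (na, k) (frame_z Q w (X p)))
     (frame_y Q E2 (X p) - evalr (nb, k) (frame_z Q w (X p))) != 0 /\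
   eval2 Phi^`() (frame_z Q w (X p))
    (qf (sym_at s11 s12 s22 0 (frame_z Q w (X p)))
     (frame_x Q E1 (X p) - evalr (na, k) (frame_z Q w (X p)))
     (frame_y Q E2 (X p) - evalr (nb, k) (frame_z Q w (X p)))) != 0).
have nA : nbhs p0 A.
  by apply: filterI; apply: filterI; [exact: nU|exact: n1|exact: n2|exact: n3].
pose V : set plane := interior A.
have VS p : V p -> A p := @interior_subset _ A p.
pose Th := level_poly (evalP F P).
have Th' : Th^`() = Phi^`() by rewrite /Th /level_poly derivB derivC subr0.
have Vo : open V by exact: open_interior.
have Vp0 : V p0 := nA.
have VU : V `<=` U by move=> p /VS [[]].
have r1 p (Vp : V p) : cross (du X p) (dv X p) != 0 := Xreg p (VU p Vp).
have r2 p (Vp : V p) : k.[frame_z Q w (X p)] != 0 := (VS p Vp).1.2.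
have r3 p (Vp : V p) := (VS p Vp).2.1.
have r4 p (Vp : V p) := (VS p Vp).2.2.
rewrite -Th' in r4.
have r5 p (Vp : V p) : eval2 Th (frame_z Q w (X p)) (qf (sym_at s11 s12 s22 0 (frame_z Q w (X p)))
     (frame_x Q E1 (X p) - evalr (na, k) (frame_z Q w (X p)))
     (frame_y Q E2 (X p) - evalr (nb, k) (frame_z Q w (X p)))) = 0.
  rewrite /Th /level_poly eval2D eval2N eval2C hornerZ.
  rewrite -level_eq ?r2 // !subrK -pt_frame (Xlev p (VU p Vp)).
  by rewrite mulrC subrr.
have h := @affine_normal_defect R Q E1 E2 w fr s11 s12 s22 na nb k Th X V p0
  Vo Vp0 (Ck_sub VU C2) r1 r2 r4 r3 r5 v K0.
by rewrite /unshear XP in h.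
Qed.
End Local.

(** * The level form of the polynomial *)

Section Ratio.
Variable R : numFieldType.
Implicit Types p q n k : {poly R}.

(** The hypothesis says that p / q has derivative 0.  Subtract the multiple of q that
    agrees with p at a point where q is nonzero: the difference r satisfies
    r' q = r q', and at a zero of r the left-hand side has smaller
    multiplicity. *)
Lemma proportional_deriv p q : q != 0 -> p^`() * q = p * q^`() ->
  exists b, p = b *: q.
Proof.
move=> q0 pq; have [z [_ qz]] := dense_setT q0.
exists (p.[z] / q.[z]); apply/eqP; rewrite -subr_eq0; set r := p - _.
have rz : root r z by rewrite /r rootE hornerD hornerN hornerZ divfK // subrr.
have {pq} rq : r^`() * q = r * q^`() by rewrite /r derivB derivZ !mulrBl pq -!scalerAl [q^`() * q]mulrC.
apply: contraT => r0; case: (multiplicity_XsubC r z) => -[|m] [s].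
  by rewrite r0 /= => sz; rewrite expr0 mulr1 => rs; rewrite rs (negPf sz) in rz.
rewrite r0 /= => sz rs; move: rq.
set L := 'X - z%:P in rs *.
rewrite rs derivM deriv_exp derivXsubC mul1r /= => E.
have L0 : L ^+ m != 0 by rewrite expf_neq0 ?polyXsubC_eq0.
have {}E : (s^`() * L + s *+ m.+1) * q = s * L * q^`().
  apply: (mulfI L0); move: E; rewrite exprS -(mulr_natr s) -(mulr_natr (L ^+ m)).
  move: (L ^+ m) (m.+1%:R) => M N E; transitivity (s * (L * M) * q^`()); last by ring.
  by rewrite -E; ring.
have Lz : L.[z] = 0 by rewrite /L hornerXsubC subrr.
clearbody L; have := congr1 (horner^~ z) E; rewrite !(hornerM, hornerD, hornerMn) Lz.
rewrite !(mulr0, mul0r) add0r => /eqP.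
by rewrite mulf_eq0 (negPf qz) orbF mulrn_eq0 /= => /eqP h; rewrite /root h eqxx in sz.
Qed.

(** The hypothesis says that (n / k)'' = 0. *)
Lemma rational_linear n k : k != 0 ->
  (n^`() * k - n * k^`())^`() * k ^+ 2 = (n^`() * k - n * k^`()) * (k ^+ 2)^`() ->
  exists b0 b1, n = k * (b0%:P + b1 *: 'X).
Proof.
move=> k0 /(proportional_deriv (expf_neq0 2 k0)) [b1 h1].
have [|b0 h0] := @proportional_deriv (n - b1 *: (k * 'X)) k k0.
  rewrite derivB derivZ derivM derivX mulr1 -!mul_polyC !mulrBl.
  apply/eqP; rewrite -subr_eq0; apply/eqP.
  rewrite -mul_polyC in h1.
  transitivity ((n^`() * k - n * k^`()) - b1%:P * k ^+ 2); first by ring.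
  by rewrite h1 subrr.
exists b0, b1; move/eqP: h0; rewrite subr_eq => /eqP ->.
by rewrite -!mul_polyC; ring.
Qed.
End Ratio.

Section Central.
Variables (R : realType) (F : {mpoly R[3]}).
Local Notation point := 'cV[R]_3.
Variables (Q E1 E2 w : point).

(** At the height z, in coordinates with the origin at the centre (na / k, nb / k),
    F is Phi(z, S(z)[x, y]) / D(z). *)
Definition level_form (s11 s12 s22 na nb k D : {poly R}) (Phi : {poly {poly R}}) :=
  [/\ k != 0, D != 0, Phi^`() != 0, s11 * s22 - s12 ^+ 2 != 0 &
   forall x y z, k.[z] != 0 ->
    D.[z] * evalP F (pt Q E1 E2 w (x + evalr (na, k) z) (y + evalr (nb, k) z) z) =
    eval2 Phi z (qf (s11.[z], s12.[z], s22.[z]) x y)].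

Lemma qf_neq0 (t11 t12 t22 : R) : t11 * t22 - t12 ^+ 2 != 0 ->
  exists X Y, qf (t11, t12, t22) X Y != 0.
Proof.
move=> d; have [a0|a0] := eqVneq t11 0; last first.
  by exists 1, 0; rewrite /qf /= (_ : _ + _ = t11) //; ring.
have [c0|c0] := eqVneq t22 0; last first.
  by exists 0, 1; rewrite /qf /= (_ : _ + _ = t22) //; ring.
exists 1, 1; rewrite /qf /= a0 c0 (_ : _ + _ = 2 * t12); last by ring.
rewrite mulf_eq0 pnatr_eq0 /=; apply: contraNneq d => ->.
by rewrite a0; apply/eqP; ring.
Qed.

Variables (n : nat) (H : R -> Prop).
Hypothesis dH : dense_set H.
Let data h := conic_data (fun x y => evalP F (pt Q E1 E2 w x y h)) n.
Hypothesis Hdata : forall h, H h -> exists S o1 o2 p, data h S o1 o2 p.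

(** [conic_polys] gives the form and the centre, and [level_polys], in coordinates
    that move with the centre, gives the function of the form.  The derivative of
    Phi is nonzero because the sections are not constant. *)
Lemma central_level : exists s11 s12 s22 na nb k D Phi,
  level_form s11 s12 s22 na nb k D Phi /\
  dense_set (fun h => H h /\ forall S o1 o2 p, data h S o1 o2 p ->
    exists2 kap, kap != 0 & [/\ s11.[h] = kap * S.1.1, s12.[h] = kap * S.1.2 &
      s22.[h] = kap * S.2]).
Proof.
pose f := restr F Q E1 E2 w.
have fE x y h : (f x y).[h] = evalP F (pt Q E1 E2 w x y h) := horner_restr _ _ _ _ _ _ _ _.
have data' h S o1 o2 p : conic_data (fun x y => (f x y).[h]) n S o1 o2 p <-> data h S o1 o2 p.
  by split=> -[h1 h2 h3]; split=> // x y; [rewrite -fE|rewrite fE].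
have Hd h : H h -> exists S o1 o2 p, conic_data (fun x y => (f x y).[h]) n S o1 o2 p.
  by case/Hdata => S [ o1 [ o2 [p /data' D]]]; exists S, o1, o2, p.
have [s11 [s12 [s22 [m1 [m2 good]]]]] := conic_polys
  (restr_dX F Q E1 E2 w) (restr_dY F Q E1 E2 w) dH Hd.
pose k := s11 * s22 - s12 ^+ 2.
pose na := - (s22 * m1 - s12 * m2); pose nb := - (s11 * m2 - s12 * m1).
have kE h : k.[h] = s11.[h] * s22.[h] - s12.[h] ^+ 2.
  by rewrite /k !(hornerD, hornerN, hornerM, horner_exp).
have k0 : k != 0.
  have [h [[Hh]]] := good _ (oner_neq0 _).
  case: (Hd h Hh) => S [ o1 [ o2 [p D]]].
  move=> /(_ S o1 o2 p D) [kap kap0 [e1 e2 e3 _ _]] _.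
  apply: contraTneq (_ : k.[h] != 0) => [->|]; first by rewrite horner0 eqxx.
  rewrite kE e1 e2 e3 (_ : _ - _ = kap ^+ 2 * dets S); last by rewrite /dets; ring.
  by case: D => dS _ _; rewrite mulf_neq0 ?expf_neq0.
have good' := dense_poly good k0.
have centre h o1 o2 : k.[h] != 0 -> m1.[h] = - (s11.[h] * o1 + s12.[h] * o2) ->
    m2.[h] = - (s12.[h] * o1 + s22.[h] * o2) -> na.[h] / k.[h] = o1 /\ nb.[h] / k.[h] = o2.
  move=> kh e4 e5; split; apply: (mulIf kh); rewrite divfK // kE /na /nb
    !(hornerD, hornerN, hornerM) e4 e5; ring.
have [X0 [Y0 q0]] : exists X Y, qfp s11 s12 s22 X Y != 0.
  have [h [_ kh]] := dense_setT k0.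
  have [|X [Y qXY]] := @qf_neq0 s11.[h] s12.[h] s22.[h]; first by rewrite -kE.
  by exists X, Y; apply: contraNneq qXY => q0; rewrite -horner_qfp q0 horner0.
have size_data h S o1 o2 p : k.[h] != 0 -> data h S o1 o2 p ->
   forall kap, kap != 0 -> s11.[h] = kap * S.1.1 -> s12.[h] = kap * S.1.2 ->
   s22.[h] = kap * S.2 -> na.[h] / k.[h] = o1 -> nb.[h] / k.[h] = o2 ->
   forall X Y, (moving F Q E1 E2 w na nb k X Y).[h] =
     (k.[h] ^+ msize F *: (p \Po (kap^-1 *: 'X))).[(qfp s11 s12 s22 X Y).[h]].
  move=> kh [_ _ pE] kap kap0 e1 e2 e3 c1 c2 X Y.
  rewrite horner_moving // pE -c1 -c2 !addrK hornerZ horner_comp hornerZ hornerX.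
  congr (_ * _.[_]); rewrite horner_qfp e1 e2 e3 /qf /=.
  by field.
have [h|D' D'0 [Phi PhiE]] := @level_polys R (moving F Q E1 E2 w na nb k) s11 s12 s22 n
   _ X0 Y0 good' q0.
  move=> [[Hh g] kh]; case: (Hd h Hh) => S [ o1 [ o2 [p D]]].
  have [kap kap0 [e1 e2 e3 e4 e5]] := g S o1 o2 p D.
  have [c1 c2] := centre h o1 o2 kh e4 e5.
  exists (k.[h] ^+ msize F *: (p \Po (kap^-1 *: 'X))).
    case: D => _ /andP [_ sp] _.
    rewrite (leq_trans (size_scale_leq _ _)) // (leq_trans _ sp) //.
    by rewrite size_comp_poly2 // size_scale ?invr_eq0 // size_polyX.
  exact: (size_data h S o1 o2 p kh ((data' h S o1 o2 p).1 D) kap kap0 e1 e2 e3 c1 c2).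
exists s11, s12, s22, na, nb, k, (D' * k ^+ msize F), Phi.
have lev x y z : k.[z] != 0 ->
    (D' * k ^+ msize F).[z] * evalP F (pt Q E1 E2 w (x + evalr (na, k) z) (y + evalr (nb, k) z) z) =
    eval2 Phi z (qf (s11.[z], s12.[z], s22.[z]) x y).
  move=> kz; have := PhiE x y z; rewrite horner_moving // horner_qfp => <-.
  by rewrite hornerM horner_exp mulrA.
split; last first.
  apply: dense_sub good _ => h [Hh g]; split=> // S o1 o2 p /data' D.
  by have [kap kap0 [e1 e2 e3 _ _]] := g S o1 o2 p D; exists kap.
have Dk : D' * k ^+ msize F != 0 by rewrite mulf_neq0 ?expf_neq0.
split=> //; apply/eqP => Phi0.
have [h [[[Hh g] kh] Dh]] := good' _ (mulf_neq0 Dk k0).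
case: (Hd h Hh) => S [ o1 [ o2 [p D]]].
have [kap kap0 [e1 e2 e3 e4 e5]] := g S o1 o2 p D.
have [c1 c2] := centre h o1 o2 kh e4 e5.
have [c PhiC] : exists c, Phi = c%:P.
  exists Phi`_0; apply/polyP => -[|i]; first by rewrite coefC.
  have /polyP/(_ i) := Phi0; rewrite coef_deriv coef0 coefC /= => /eqP.
  rewrite -mulr_natr mulf_eq0 => /orP [/eqP->//|].
  by rewrite -polyC_natr polyC_eq0 pnatr_eq0.
have [dS /andP [sp _] _] := D.
have [X [Y qXY]] : exists X Y, qf S X Y != 0 by case: (S) dS => [[? ?] ?]; exact: qf_neq0.
rewrite hornerM mulf_eq0 negb_or (negPf kh) andbT in Dh.
have pc t : p.[t ^+ 2 * qf S X Y] = c.[h] / (D' * k ^+ msize F).[h].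
  have := lev (t * X) (t * Y) h kh; rewrite PhiC eval2C => <-.
  case: D => _ _; rewrite /f => pE.
  rewrite [_ * evalP _ _]mulrC mulfK //.
  rewrite /evalr /= c1 c2 -fE pE !addrK.
  by congr (_.[_]); rewrite -qfZ; congr qf; ring.
have pP : p \Po (qf S X Y *: 'X^2) = (c.[h] / (D' * k ^+ msize F).[h])%:P.
  apply: polyfun_inj => t; rewrite horner_comp hornerZ hornerXn hornerC -(pc t).
  by rewrite mulrC.
have := congr1 (fun q : {poly R} => (size q).-1) pP; rewrite size_polyC.
rewrite size_comp_poly size_scale // size_polyXn /= => /eqP.
rewrite (_ : (_ != _).-1 = 0)%N; last by case: (_ != _).
by rewrite muln_eq0 /= orbF -subn1 subn_eq0 leqNgt sp.
Qed.

(** The factor s is absorbed in Phi. *)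
Lemma level_form_const s na nb k D Phi (t11 t12 t22 : R) : s != 0 ->
  level_form (s * t11%:P) (s * t12%:P) (s * t22%:P) na nb k D Phi ->
  level_form t11%:P t12%:P t22%:P na nb k D (Phi \Po (s *: 'X)).
Proof.
move=> s0 [k0 D0 P0 t0 lev]; split=> //.
- rewrite deriv_comp derivZ derivX mulf_neq0 //; last first.
    by rewrite -mul_polyC mulr1 polyC_eq0.
  by rewrite comp_poly_eq0 // size_scale // size_polyX.
- by apply: contraNneq t0 => t0; apply/eqP; transitivity (s ^+ 2 * (t11%:P * t22%:P - t12%:P ^+ 2));
   [ring|rewrite t0 mulr0].
move=> x y z kz; rewrite lev // /eval2 horner_comp hornerZ hornerX.
have e (A : {poly {poly R}}) (u v : {poly R}) : u.[z] = v.[z] -> A.[u].[z] = A.[v].[z].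
  move=> uv; rewrite -!horner_evalE -!horner_map /=.
  by rewrite /= /horner_eval uv.
by apply: e; rewrite !(hornerC, hornerM) /qf /=; ring.
Qed.
End Central.

(** * Generic points and rational curves *)

Section Generic.
Variables (R : realType).
Local Notation point := 'cV[R]_3.
Variables (Q E1 E2 w : point).
Hypothesis fr : frame E1 E2 w.
Implicit Types (N : {mpoly R[3]}).

(** Up to a power of the denominator, N on the rational curve (X / d, Y / d) is a
    polynomial in the parameter, nonzero at u0; so T has infinitely many zeros. *)
Lemma curve_zero N (X Y d T : {poly R}) x0 y0 z u0 :
  d.[u0] != 0 ->
  evalP N (pt Q E1 E2 w (X.[u0] / d.[u0] + x0) (Y.[u0] / d.[u0] + y0) z) != 0 ->
  (forall u, d.[u] != 0 ->
    evalP N (pt Q E1 E2 w (X.[u] / d.[u] + x0) (Y.[u] / d.[u] + y0) z) != 0 -> T.[u] = 0) ->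
  T = 0.
Proof.
move=> d0 N0 hT.
pose q := numer_subst N (fun i => d * (pt Q E1 E2 w x0 y0 z i 0)%:P
  + X * (E1 i 0)%:P + Y * (E2 i 0)%:P) d.
have qE u : d.[u] != 0 -> q.[u] = d.[u] ^+ msize N *
    evalP N (pt Q E1 E2 w (X.[u] / d.[u] + x0) (Y.[u] / d.[u] + y0) z).
  move=> du; rewrite horner_numer_subst //; congr (_ * _); apply: meval_eq => i.
  by rewrite !(hornerD, hornerM, hornerC) /pt !mxE; field.
have q0 : d * q != 0.
  apply: contraTneq (_ : (d * q).[u0] != 0) => [->|]; first by rewrite horner0 eqxx.
  by rewrite hornerM qE // !mulf_neq0 ?expf_neq0.
suff /eqP : T * (d * q) = 0 by rewrite mulf_eq0 (negPf q0) orbF => /eqP.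
apply: polyfun_inj => u; rewrite horner0 hornerM.
have [du|du] := eqVneq d.[u] 0; first by rewrite hornerM du mul0r mulr0.
rewrite hornerM qE //.
have [->|n0] := eqVneq (evalP N (pt Q E1 E2 w (X.[u] / d.[u] + x0) (Y.[u] / d.[u] + y0) z)) 0.
  by rewrite !mulr0.
by rewrite hT // mul0r.
Qed.

Definition fibre (Phi : {poly {poly R}}) z : {poly R} := map_poly (horner_eval z) Phi.

Lemma horner_fibre Phi z r : (fibre Phi z).[r] = eval2 Phi z r.
Proof.
rewrite /eval2 -[RHS]/(horner_eval z _) -horner_map /=.
by rewrite /= /horner_eval hornerC.
Qed.

(** For almost every height there is a point of a fixed vertical line where N is
    nonzero, and another point where the form and Psi are nonzero.  On the line
    through these two points all three are polynomials that are not zero. *)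
Lemma generic_points N (H : R -> Prop) (s11 s12 s22 a b : R -> R) (Psi : {poly {poly R}}) :
  dense_set H -> N != 0 -> Psi != 0 ->
  (forall h, H h -> s11 h * s22 h - s12 h ^+ 2 != 0) ->
  dense_set (fun h => H h /\ exists x y,
    [/\ evalP N (pt Q E1 E2 w (x + a h) (y + b h) h) != 0,
     qf (s11 h, s12 h, s22 h) x y != 0 &
     eval2 Psi h (qf (s11 h, s12 h, s22 h) x y) != 0]).
Proof.
move=> dH N0 P0 dets0 q q0.
have [v] := meval_neq0 N0.
pose P : point := \col_i v i.
have -> : meval v N = evalP N P by apply: meval_eq => i; rewrite mxE.
rewrite (pt_frame Q fr P); set x1 := frame_x _ _ _; set y1 := frame_y _ _ _ => NP.
have r0 : restr N Q E1 E2 w x1 y1 != 0.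
  by apply: contraNneq NP => h; rewrite -horner_restr h horner0.
have l0 : lead_coef Psi != 0 by rewrite lead_coef_eq0.
have [h [Hh]] := dH _ (mulf_neq0 q0 (mulf_neq0 r0 l0)).
rewrite !hornerM !mulf_eq0 !negb_or horner_restr => /and3P [qh Nh lh].
exists h; split=> //; split=> //.
have f0 : fibre Psi h != 0.
  by rewrite -lead_coef_eq0 lead_coef_map_eq.
have [X [Y qXY]] := qf_neq0 (dets0 h Hh).
set S := (s11 h, s12 h, s22 h) in qXY *.
pose G : {poly R} := 'X * fibre Psi h.
have G0 : G != 0 by rewrite mulf_neq0 ?polyX_eq0.
(* At (t X, t Y) the form is t^2 times its value at (X, Y). *)
have [t] : exists t, (G \Po (qf S X Y *: 'X^2)).[t] != 0.
  have [|t [_ ht]] := @dense_setT R (G \Po (qf S X Y *: 'X^2)); last by exists t.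
  by rewrite comp_poly_eq0 // size_scale // size_polyXn.
rewrite horner_comp hornerZ hornerXn => Gt.
(* The line from the point where N is nonzero to (t X, t Y), relative to the
   centre. *)
pose A := x1 - a h; pose B := y1 - b h.
pose Xs : {poly R} := A%:P + (t * X - A) *: 'X.
pose Ys : {poly R} := B%:P + (t * Y - B) *: 'X.
pose rs : {poly R} := S.1.1 *: Xs ^+ 2 + (2 * S.1.2) *: (Xs * Ys) + S.2 *: Ys ^+ 2.
have rsE s : rs.[s] = qf S Xs.[s] Ys.[s].
  by rewrite /rs !(hornerD, hornerZ, hornerM, horner_exp) /qf; ring.
have X1 : Xs.[1] = t * X by rewrite /Xs !(hornerD, hornerC, hornerZ, hornerX); ring.
have Y1 : Ys.[1] = t * Y by rewrite /Ys !(hornerD, hornerC, hornerZ, hornerX); ring.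
have X0 : Xs.[0] = A by rewrite /Xs !(hornerD, hornerC, hornerZ, hornerX); ring.
have Y0 : Ys.[0] = B by rewrite /Ys !(hornerD, hornerC, hornerZ, hornerX); ring.
have [s hs] : exists s, evalP N (pt Q E1 E2 w (Xs.[s] + a h) (Ys.[s] + b h) h) != 0
    /\ G.[rs.[s]] != 0.
  apply: contrapT => /forallNP hN.
  have GP : G \Po rs = 0.
    apply: (@curve_zero N Xs Ys 1 _ (a h) (b h) h 0); rewrite ?hornerC ?oner_neq0 //.
      by rewrite X0 Y0 !divr1 !subrK.
    move=> u; rewrite hornerC !divr1 => _ Nu; rewrite horner_comp.
    by apply/eqP/negP => /negP Gu; apply: (hN u).
  move: Gt; rewrite mulrC -qfZ -X1 -Y1 -rsE -horner_comp GP horner0 eqxx //.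
exists Xs.[s], Ys.[s]; case: hs => Ns; rewrite /G hornerM hornerX horner_fibre rsE.
by rewrite mulf_eq0 negb_or => /andP [].
Qed.
End Generic.

(** * The equation of the axis *)

Section Axis.
Variables (R : realType).
Local Notation point := 'cV[R]_3.
Variables (F : {mpoly R[3]}) (gamma : 'cV[{fraction {mpoly R[3]}}]_3).
Hypothesis gamma_normal : affine_normal_field F gamma.
Variables (Q E1 E2 w : point).
Hypothesis fr : frame E1 E2 w.

(** The point is Q' + z w' + (x E1 + y E2), with Q' and w' the point and the
    direction of the line, so the field is the cross product of w' with
    x E1 + y E2. *)
Lemma field_at_center a0 a1 b0 b1 x y z :
  field_at (plucker (Q + a0 *: E1 + b0 *: E2) (a1 *: E1 + b1 *: E2 + w))
    (pt Q E1 E2 w (x + (a0 + a1 * z)) (y + (b0 + b1 * z)) z) =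
  vol E1 E2 w *: covec E1 E2 w (shear a1 b1 (- y, x, 0)).
Proof.
set Q' := Q + _ + _; set w' := _ + w.
have -> : field_at (plucker Q' w') (pt Q E1 E2 w (x + (a0 + a1 * z)) (y + (b0 + b1 * z)) z) =
   cross (vec E1 E2 w (a1, b1, 1)) (vec E1 E2 w (x, y, 0)).
  have -> : vec E1 E2 w (a1, b1, 1) = w' by rewrite /vec /= scale1r.
  have -> : pt Q E1 E2 w (x + (a0 + a1 * z)) (y + (b0 + b1 * z)) z =
     Q' + z *: w' + vec E1 E2 w (x, y, 0).
    by apply/colP => i; rewrite /pt /Q' /w' /vec !mxE /=; ring.
  rewrite /field_at /plucker /=; move: Q' w' (vec _ _ _ _) => {}Q' {}w' V.
  rewrite [cross Q' _]crossNC !crossDr crossZr crossvv scaler0 addr0.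
  by rewrite addrAC subrr add0r.
by rewrite (cross_vec fr); congr (_ *: covec _ _ _ _); rewrite /shear /cross3 /=; congr (_, _, _); ring.
Qed.

Variables (s11 s12 s22 na nb k D : {poly R}) (Phi : {poly {poly R}}).
Hypothesis lev : level_form F Q E1 E2 w s11 s12 s22 na nb k D Phi.

(** The level is chosen to contain the conic of radius r at the height z, so that the
    jet is the same at all the points of this conic. *)
Definition level_jet z r : jet R :=
  jet_at s11 s12 s22 na nb k (level_poly D Phi (eval2 Phi z r / D.[z])) z r.

Lemma frame_pt x y z : [/\ frame_x Q E1 (pt Q E1 E2 w x y z) = x,
  frame_y Q E2 (pt Q E1 E2 w x y z) = y & frame_z Q w (pt Q E1 E2 w x y z) = z].
Proof.
have w0 := frame_ww fr.
case: fr => -[e11 e22 e12] [e1w e2w _]; rewrite /frame_x /frame_y /frame_z /pt.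
rewrite !dot_lin e11 e22 e12 e1w e2w [dot E2 E1]dotC [dot w E1]dotC [dot w E2]dotC e12 e1w e2w.
by split; [ring|ring|field].
Qed.

Lemma level_defect x y z X p0 v :
  let r := qf (s11.[z], s12.[z], s22.[z]) x y in
  let P := pt Q E1 E2 w (x + evalr (na, k) z) (y + evalr (nb, k) z) z in
  local_parametrization F P X p0 -> gaussian_curvature X p0 != 0 ->
  k.[z] != 0 -> D.[z] != 0 -> r != 0 -> eval2 Phi^`() z r != 0 ->
  dot (affine_normal X p0) (covec E1 E2 w
    (shear (evalr (derivr (na, k)) z) (evalr (derivr (nb, k)) z) v)) = 0 <->
  jdefect (level_jet z r) v x y = 0.
Proof.
move=> r P lp K0 kz Dz r0 Phir; have [_ _ _ _ levE] := lev.
have [fx fy fz] := frame_pt (x + evalr (na, k) z) (y + evalr (nb, k) z) z.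
rewrite -/P in fx fy fz.
have := defect_at fr levE v lp K0; rewrite fx fy fz !addrK => h.
have cE : evalP F P = eval2 Phi z r / D.[z] by rewrite -levE // mulrC mulKf.
by rewrite /level_jet -cE; exact: h.
Qed.

Lemma axis_defect : solves_L gamma (plucker Q w) ->
  exists2 N : {mpoly R[3]}, N != 0 & forall x y z,
   let r := qf (s11.[z], s12.[z], s22.[z]) x y in
   evalP N (pt Q E1 E2 w (x + evalr (na, k) z) (y + evalr (nb, k) z) z) != 0 ->
   k.[z] != 0 -> D.[z] != 0 -> r != 0 -> eval2 Phi^`() z r != 0 ->
   jdefect (level_jet z r) (axisv (level_jet z r) x y) x y = 0.
Proof.
move=> /(normal_annihilates gamma_normal) [N N0 hN]; exists N => // x y z r /hN.
move=> [X [p0 [lp K0 h]]] kz Dz r0 Phir.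
apply/(level_defect _ lp K0 kz Dz r0 Phir); move: h.
have := field_at_center 0 0 0 0 (x + evalr (na, k) z) (y + evalr (nb, k) z) z.
rewrite !scale0r !addr0 add0r !mul0r !addr0 => ->; rewrite dotZr => /eqP.
rewrite mulf_eq0 (negPf (frame_vol_neq0 fr)) /= => /eqP h; rewrite -[RHS]h.
congr (dot _ (covec _ _ _ _)); rewrite /axisv /shear /level_jet /jet_at /rat_pair /=.
by congr (_, _, _); ring.
Qed.
End Axis.

(** * Hyperbolas whose asymptotes turn *)

Section JetMorphism.
Variables (K L : comNzRingType) (phi : {rmorphism K -> L}).
Definition map3 (v : K * K * K) : L * L * L := (phi v.1.1, phi v.1.2, phi v.2).
Definition map2 (v : K * K) : L * L := (phi v.1, phi v.2).
Definition map_jet (J : jet K) : jet L :=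
  Jet (map3 (S0 J)) (map3 (S1 J)) (map3 (S2 J)) (map3 (S3 J))
    (map2 (A0 J)) (map2 (A1 J)) (map2 (A2 J)) (map2 (A3 J))
    (phi (G1 J)) (phi (G2 J)) (phi (G3 J)).
Definition map_sym (H : sym3 K) : sym3 L :=
  Sym3 (phi (c11 H)) (phi (c12 H)) (phi (c13 H)) (phi (c22 H)) (phi (c23 H)) (phi (c33 H)).

Let mE := (rmorphD phi, rmorphB phi, rmorphN phi, rmorphM phi, rmorph_nat phi, rmorphXn phi).

Lemma rmorph_dot3 u v : phi (dot3 u v) = dot3 (map3 u) (map3 v).
Proof. by rewrite /dot3 /= !mE. Qed.
Lemma map_cross3 u v : map3 (cross3 u v) = cross3 (map3 u) (map3 v).
Proof. by rewrite /map3 /cross3 /= !mE. Qed.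
Lemma map_app3 H v : map3 (app3 H v) = app3 (map_sym H) (map3 v).
Proof. by rewrite /map3 /app3 /= !mE. Qed.
Lemma map_adj3 H : map_sym (adj3 H) = adj3 (map_sym H).
Proof. by rewrite /map_sym /adj3 /= !mE. Qed.
Lemma rmorph_defect W n H o v :
  phi (defect W n H o v) = defect (phi W) (map3 n) (map_sym H) (map3 o) (map3 v).
Proof.
by rewrite /defect !(rmorph_dot3, map_app3, map_cross3, map_adj3, mE).
Qed.
Lemma rmorph_qf S X Y : phi (qf S X Y) = qf (map3 S) (phi X) (phi Y).
Proof. by rewrite /qf /= !mE. Qed.
Lemma rmorph_sx S X Y : phi (sx S X Y) = sx (map3 S) (phi X) (phi Y).
Proof. by rewrite /sx /= !mE. Qed.
Lemma rmorph_sy S X Y : phi (sy S X Y) = sy (map3 S) (phi X) (phi Y).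
Proof. by rewrite /sy /= !mE. Qed.
Lemma rmorph_dets S : phi (dets S) = dets (map3 S).
Proof. by rewrite /dets /= !mE. Qed.
Lemma rmorph_dets' J : phi (dets' J) = dets' (map_jet J).
Proof. by rewrite /dets' /= !mE. Qed.
Lemma rmorph_qadj S X Y : phi (qadj S X Y) = qadj (map3 S) (phi X) (phi Y).
Proof. by rewrite /qadj /= !mE. Qed.
Lemma rmorph_badj S X Y X' Y' :
  phi (badj S X Y X' Y') = badj (map3 S) (phi X) (phi Y) (phi X') (phi Y').
Proof. by rewrite /badj /= !mE. Qed.
Let fE := (rmorph_qf, rmorph_sx, rmorph_sy, rmorph_dets, rmorph_dets', rmorph_qadj, rmorph_badj).
Lemma rmorph_jh33 J X Y : phi (jh33 J X Y) = jh33 (map_jet J) (phi X) (phi Y).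
Proof. by rewrite /jh33 !(fE, mE). Qed.
Lemma rmorph_jh33' J X Y : phi (jh33' J X Y) = jh33' (map_jet J) (phi X) (phi Y).
Proof. by rewrite /jh33' !(fE, mE). Qed.
Lemma rmorph_jQ J X Y : phi (jQ J X Y) = jQ (map_jet J) (phi X) (phi Y).
Proof. by rewrite /jQ !(fE, mE). Qed.
Lemma rmorph_jL J X Y : phi (jL J X Y) = jL (map_jet J) (phi X) (phi Y).
Proof. by rewrite /jL !(rmorph_jh33, fE, mE). Qed.
Lemma rmorph_jW J X Y : phi (jW J X Y) = jW (map_jet J) (phi X) (phi Y).
Proof. by rewrite /jW !(rmorph_jL, rmorph_jQ, fE, mE). Qed.

Lemma rmorph_jdefect J v X Y :
  phi (jdefect J v X Y) = jdefect (map_jet J) (map3 v) (phi X) (phi Y).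
Proof.
apply: (etrans (rmorph_defect _ _ _ _ _)); congr defect; first exact: rmorph_jW.
- by rewrite /jn /map3 /= !(fE, mE).
- by rewrite /jH /map_sym /= !(rmorph_jh33, fE, mE).
- by rewrite /jo /map3 /jo1 /jo2 /jo3 /= !(rmorph_jL, rmorph_jQ, rmorph_jh33', rmorph_jh33, fE, mE).
Qed.

Lemma map_axisv J X Y : map3 (axisv J X Y) = axisv (map_jet J) (phi X) (phi Y).
Proof. by rewrite /axisv /map3 /= !mE. Qed.

Lemma map_jscale u J : map_jet (jscale u J) = jscale (phi u) (map_jet J).
Proof. by rewrite /jscale /map_jet /map2 /= !mE. Qed.
End JetMorphism.

Section Rotating.
Variables (R : realType).
Local Notation point := 'cV[R]_3.
Variables (F : {mpoly R[3]}) (gamma : 'cV[{fraction {mpoly R[3]}}]_3).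
Hypothesis gamma_normal : affine_normal_field F gamma.
Variables (Q E1 E2 w : point).
Hypothesis fr : frame E1 E2 w.
Hypothesis sol : solves_L gamma (plucker Q w).
Variables (s11 s12 s22 na nb k D : {poly R}) (Phi : {poly {poly R}}).
Hypothesis lev : level_form F Q E1 E2 w s11 s12 s22 na nb k D Phi.

(** By [jdefect_scale], u^8 times the defect at (X / u, Y / u), for an indeterminate
    u. *)
Definition scaled_defect (J : jet R) (X Y : {poly R}) : {poly R} :=
  let J' := jscale 'X (map_jet (@polyC R) J) in jdefect J' (axisv J' X Y) X Y.

Lemma horner_scaled_defect J X Y u :
  (scaled_defect J X Y).[u] = jdefect (jscale u J) (axisv (jscale u J) X.[u] Y.[u]) X.[u] Y.[u].
Proof.
rewrite /scaled_defect -[LHS]/(horner_eval u _) rmorph_jdefect map_axisv.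
have -> : map_jet (horner_eval u) (jscale 'X (map_jet (@polyC R) J)) = jscale u J.
  rewrite map_jscale /= /map_jet /map3 /map2 /= /horner_eval !hornerC hornerX.
  by case: J => [[[? ?] ?] [[? ?] ?] [[? ?] ?] [[? ?] ?] [? ?] [? ?] [? ?] [? ?] ? ? ?].
by [].
Qed.

(** Let A and B be the coordinates of a point on the asymptotes.  The hyperbola
    through it is parametrized by (A / u, B u), and the equation of the axis,
    multiplied by u^8, is a polynomial that vanishes at u = 0 as well.  By
    [lead_rotating] the derivative of S vanishes in the asymptotic direction of S,
    so the two forms, of trace zero, are proportional. *)
Lemma rotating_direction (H : R -> Prop) : dense_set H -> s22 = - s11 ->
  (forall h, H h -> exists c n e, [/\ c ^+ 2 + n ^+ 2 = 1, s11.[h] = - (2 * c * n * e) &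
     s12.[h] = (c ^+ 2 - n ^+ 2) * e]) ->
  s11^`() * s12 = s11 * s12^`().
Proof.
move=> dH s22E rot; have [N N0 hN] := axis_defect gamma_normal fr lev sol.
have [k0 D0 P0 det0 levE] := lev.
have dH' := dense_poly dH (mulf_neq0 det0 (mulf_neq0 k0 D0)).
have dets_h h : H h /\ ((s11 * s22 - s12 ^+ 2) * (k * D)).[h] != 0 ->
    s11.[h] * s22.[h] - s12.[h] ^+ 2 != 0.
  move=> [_]; rewrite hornerM mulf_eq0 negb_or => /andP [+ _].
  by rewrite !(hornerD, hornerN, hornerM, horner_exp).
have dG := @generic_points R Q E1 E2 w fr N _ (horner s11) (horner s12) (horner s22)
  (evalr (na, k)) (evalr (nb, k)) Phi^`() dH' N0 P0 dets_h.
apply/eqP; rewrite -subr_eq0; apply/eqP; apply: (dense_eq0 dG).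
move=> h [[Hh]]; rewrite !hornerM !mulf_eq0 !negb_or => /and3P [_ kh Dh].
move=> [x [y []]]; set S := (s11.[h], s12.[h], s22.[h]); set r := qf S x y => Nxy r0 Phir.
have [c [n [e [cn e11 e12]]]] := rot h Hh.
have e22 : s22.[h] = 2 * c * n * e by rewrite s22E hornerN e11 opprK.
pose A := c * x + n * y; pose B := c * y - n * x.
have rE : r = 2 * A * B * e.
  rewrite /r /qf /= e11 e12 e22 /A /B; ring.
have xE : x = A * c - B * n.
  transitivity ((c ^+ 2 + n ^+ 2) * x); first by rewrite cn mul1r.
  by rewrite /A /B; ring.
have yE : y = A * n + B * c.
  transitivity ((c ^+ 2 + n ^+ 2) * y); first by rewrite cn mul1r.
  by rewrite /A /B; ring.
have A0 : A != 0 by apply: contraNneq r0 => A0; rewrite rE A0 mulr0 !mul0r.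
have e0 : e != 0 by apply: contraNneq r0 => e0; rewrite rE e0 mulr0.
clearbody A B.
pose Xp : {poly R} := (A * c)%:P - (B * n) *: 'X^2.
pose Yp : {poly R} := (A * n)%:P + (B * c) *: 'X^2.
have XpE u : Xp.[u] = A * c - B * n * u ^+ 2.
  by rewrite /Xp !(hornerD, hornerN, hornerC, hornerZ, hornerXn).
have YpE u : Yp.[u] = A * n + B * c * u ^+ 2.
  by rewrite /Yp !(hornerD, hornerN, hornerC, hornerZ, hornerXn).
pose J := level_jet s11 s12 s22 na nb k D Phi h r.
have T0 : scaled_defect J Xp Yp = 0.
  apply: (@curve_zero R Q E1 E2 w N Xp Yp 'X _ (evalr (na, k) h) (evalr (nb, k) h) h 1).
  - by rewrite hornerX oner_neq0.
  - by rewrite hornerX XpE YpE expr1n !mulr1 !divr1 -xE -yE.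
  move=> u; rewrite hornerX => u0 Nu; rewrite horner_scaled_defect.
  set xu := Xp.[u] / u in Nu; set yu := Yp.[u] / u in Nu.
  have -> : Xp.[u] = u * xu by rewrite /xu mulrC divfK.
  have -> : Yp.[u] = u * yu by rewrite /yu mulrC divfK.
  have ru : qf S xu yu = r.
    rewrite /xu /yu XpE YpE rE /qf /= e11 e12 e22.
    transitivity (2 * A * B * e * (c ^+ 2 + n ^+ 2) ^+ 2); first by field.
    by rewrite cn expr1n mulr1.
  rewrite jdefect_scale; have := hN xu yu h Nu kh Dh; rewrite -/S ru => /(_ r0 Phir).
  by rewrite -/J => ->; rewrite mulr0.
have := congr1 (horner^~ 0) T0; rewrite horner0 horner_scaled_defect XpE YpE.
rewrite expr0n /= !mulr0 subr0 addr0 => {}T0.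
have := @lead_rotating R (A * c) (A * n) (e / A ^+ 2) (s11^`()).[h] (s12^`()).[h]
  (sym_at s11 s12 s22 2 h) (sym_at s11 s12 s22 3 h).
have JE : jscale 0 J = Jet (- (2 * (A * c) * (A * n) * (e / A ^+ 2)),
    ((A * c) ^+ 2 - (A * n) ^+ 2) * (e / A ^+ 2), 2 * (A * c) * (A * n) * (e / A ^+ 2))
   ((s11^`()).[h], (s12^`()).[h], - (s11^`()).[h]) (sym_at s11 s12 s22 2 h) (sym_at s11 s12 s22 3 h)
   (0, 0) (0, 0) (0, 0) (0, 0) 0 0 0.
  have d1 : (derivn 1 s22).[h] = - (s11^`()).[h] by rewrite s22E derivn1 derivN hornerN.
  rewrite /jscale /J /level_jet /jet_at {1 2}/sym_at d1 /= e11 e12 e22.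
  rewrite expr0n /= !mul0r; congr (Jet (_, _, _) _ _ _ _ _ _ _ _ _ _); [by field|by field|by field|by rewrite /sym_at d1].
rewrite -JE; move: T0; rewrite /axisv JE /= !(addr0, mulr0) => -> /esym/eqP.
have -> : (A * c) ^+ 2 + (A * n) ^+ 2 = A ^+ 2 by rewrite -[RHS]mulr1 -cn; ring.
have eA : 8 * (e / A ^+ 2) ^+ 3 * (A ^+ 2) ^+ 3 != 0.
  by rewrite !(mulf_neq0, expf_neq0, invr_neq0) ?pnatr_eq0.
rewrite mulrAC mulf_eq0 (negPf eA) /= expf_eq0 /= => /eqP lam.
have {}lam : (s11^`()).[h] * (c ^+ 2 - n ^+ 2) + 2 * (s12^`()).[h] * c * n = 0.
  apply: (mulfI (expf_neq0 2 A0)); rewrite mulr0 -[RHS]lam; ring.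
rewrite !(hornerD, hornerN, hornerM) e11 e12.
transitivity (((s11^`()).[h] * (c ^+ 2 - n ^+ 2) + 2 * (s12^`()).[h] * c * n) * e); first by ring.
by rewrite lam mul0r.
Qed.
End Rotating.

(** * The centres run on a line *)

Section Constant.
Variables (R : realType).
Local Notation point := 'cV[R]_3.
Implicit Types (k D : {poly R}).

(** The numerator of (n / k)''. *)
Definition second_num (n k : {poly R}) : {poly R} :=
  (n^`() * k - n * k^`())^`() * k ^+ 2 - (n^`() * k - n * k^`()) * (k ^+ 2)^`().

Lemma second_derivr (n k : {poly R}) z : k.[z] != 0 ->
  (evalr (derivr (derivr (n, k))) z == 0) = ((second_num n k).[z] == 0).
Proof.
move=> kz; rewrite /evalr /derivr /second_num /=.
by rewrite mulf_eq0 invr_eq0 horner_exp expf_eq0 /= horner_exp expf_eq0 /= (negPf kz) orbF.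
Qed.

Definition affine_center (n k : {poly R}) := exists b0 b1, n = k * (b0%:P + b1 *: 'X).

Lemma second_num0 (n k : {poly R}) : k != 0 -> second_num n k = 0 -> affine_center n k.
Proof. by move=> k0 /eqP; rewrite subr_eq0 => /eqP; exact: rational_linear. Qed.

Lemma affine_center0 (k : {poly R}) : affine_center 0 k.
Proof. by exists 0, 0; rewrite scale0r addr0 mulr0. Qed.

Section Form.
Variables (F : {mpoly R[3]}) (gamma : 'cV[{fraction {mpoly R[3]}}]_3).
Hypothesis gamma_normal : affine_normal_field F gamma.
Variables (Q w : point).
Hypothesis sol : solves_L gamma (plucker Q w).

Lemma level_jet_const (t11 t12 t22 : R) na nb k D Phi z r :
  exists a1 a3 g1 g2 g3, level_jet t11%:P t12%:P t22%:P na nb k D Phi z r =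
    Jconst (t11, t12, t22) (rat_pair na nb k 0 z) a1 (rat_pair na nb k 2 z) a3 g1 g2 g3 /\
    a1 = rat_pair na nb k 1 z.
Proof.
do 5![eexists]; split; last reflexivity.
rewrite /level_jet /jet_at /sym_at /Jconst !derivnS !derivn0 !derivC ?deriv0 !hornerC ?horner0.
by [].
Qed.

Lemma constant_points E1 E2 (t11 t12 t22 : R) na nb k D Phi : frame E1 E2 w ->
  level_form F Q E1 E2 w t11%:P t12%:P t22%:P na nb k D Phi ->
  dense_set (fun h => k.[h] != 0 /\ exists x y r N,
    let J := level_jet t11%:P t12%:P t22%:P na nb k D Phi h r in
    [/\ r != 0, r = qf (t11, t12, t22) x y,
     evalP N (pt Q E1 E2 w (x + evalr (na, k) h) (y + evalr (nb, k) h) h) != 0 &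
     forall X Y, qf (t11, t12, t22) X Y = r ->
       evalP N (pt Q E1 E2 w (X + evalr (na, k) h) (Y + evalr (nb, k) h) h) != 0 ->
       jdefect J (axisv J X Y) X Y = 0]).
Proof.
move=> fr lev; have [N N0 hN] := axis_defect gamma_normal fr lev sol.
have [k0 D0 P0 det0 levE] := lev.
have dH := dense_poly (@dense_setT R) (mulf_neq0 k0 D0).
have dets_h h : True /\ (k * D).[h] != 0 -> t11 * t22 - t12 ^+ 2 != 0.
  move=> _; apply: contraNneq det0 => d0.
  by rewrite -!polyCM -polyC_exp -polyCB d0.
have dG := @generic_points R Q E1 E2 w fr N _ (fun=> t11) (fun=> t12) (fun=> t22)
  (evalr (na, k)) (evalr (nb, k)) Phi^`() dH N0 P0 dets_h.
apply: dense_sub dG _ => h [[_]]; rewrite hornerM mulf_eq0 negb_or => /andP [kh Dh].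
move=> [x [y [Nxy r0 Phir]]]; split=> //; exists x, y, (qf (t11, t12, t22) x y), N; split=> //.
move=> X Y XY NXY; have := hN X Y h NXY kh Dh.
rewrite !hornerC XY; exact.
Qed.

Lemma rmorph_hyp_defect (K L : comNzRingType) (phi : {rmorphism K -> L}) a0 a1 a2 a3 g1 g2 g3 x y u :
  phi (hyp_defect a0 a1 a2 a3 g1 g2 g3 x y u) =
  hyp_defect (map2 phi a0) (map2 phi a1) (map2 phi a2) (map2 phi a3)
   (phi g1) (phi g2) (phi g3) (phi x) (phi y) (phi u).
Proof.
by rewrite /hyp_defect /map2 /=; ring.
Qed.

Lemma rmorph_circ_defect (K L : comNzRingType) (phi : {rmorphism K -> L}) a0 a1 a2 a3 g1 g2 g3 r x y u :
  phi (circ_defect a0 a1 a2 a3 g1 g2 g3 r x y u) =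
  circ_defect (map2 phi a0) (map2 phi a1) (map2 phi a2) (map2 phi a3)
   (phi g1) (phi g2) (phi g3) (phi r) (phi x) (phi y) (phi u).
Proof.
by rewrite /circ_defect /map2 /=; ring.
Qed.

Lemma map2_polyC (a : R * R) u : map2 (horner_eval u) (map2 (@polyC R) a) = a.
Proof. by case: a => a b; rewrite /map2 /= /horner_eval !hornerC. Qed.

(** The hyperbola 2xy = r is parametrized by (x / u, y u).  At u = 0 the equation of
    the axis gives b (b'')^2 = 0 ([hyp_defect0]). *)
Lemma hyperbola_second E1 E2 na nb k D Phi : frame E1 E2 w ->
  level_form F Q E1 E2 w 0%:P 1%:P 0%:P na nb k D Phi -> affine_center nb k.
Proof.
move=> fr lev; have [k0 _ _ _ _] := lev.
suff /eqP : nb * second_num nb k = 0.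
  rewrite mulf_eq0 => /orP [/eqP->|/eqP]; [exact: affine_center0|exact: second_num0].
apply: (dense_eq0 (constant_points fr lev)) => h [kh [x [y [r [N [r0 rE Nxy hJ]]]]]].
have [a1 [a3 [g1 [g2 [g3 [JE _]]]]]] := level_jet_const 0 1 0 na nb k D Phi h r.
rewrite JE in hJ; set a0 := rat_pair _ _ _ 0 h in JE hJ; set a2 := rat_pair _ _ _ 2 h in JE hJ.
have rE' : r = 2 * x * y by rewrite rE /qf /=; ring.
pose T := hyp_defect (map2 (@polyC R) a0) (map2 (@polyC R) a1) (map2 (@polyC R) a2)
  (map2 (@polyC R) a3) g1%:P g2%:P g3%:P x%:P y%:P 'X.
have TE u : T.[u] = hyp_defect a0 a1 a2 a3 g1 g2 g3 x y u.
  rewrite -[LHS]/(horner_eval u T) /T rmorph_hyp_defect !map2_polyC.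
  by rewrite /= /horner_eval !hornerC hornerX.
have T0 : T = 0.
  apply: (@curve_zero R Q E1 E2 w N x%:P (y *: 'X^2) 'X _ (evalr (na, k) h) (evalr (nb, k) h) h 1).
  - by rewrite hornerX oner_neq0.
  - by rewrite hornerX hornerC hornerZ hornerXn expr1n mulr1 !divr1.
  move=> u; rewrite hornerX hornerC hornerZ hornerXn => u0.
  have -> : y * u ^+ 2 / u = y * u by field.
  move=> Nu; rewrite TE (hyp_defectE _ _ _ _ _ _ _ _ _ (mulVf u0)).
  rewrite hJ ?mulr0 //; rewrite rE' /qf /=; field; exact: u0.
have := TE 0; rewrite T0 horner0 hyp_defect0 => /esym/eqP.
have xy0 : (2 * x * y != 0) by rewrite -rE'.
have [x0 y0] : x != 0 /\ y != 0.
  by move: xy0; rewrite !mulf_eq0 !negb_or => /andP [/andP [_ ->] ->].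
have c0 : - 192 * (x * y) * x ^+ 3 != 0.
  apply: mulf_neq0; last exact: expf_neq0.
  by apply: mulf_neq0; [rewrite oppr_eq0 pnatr_eq0|exact: mulf_neq0].
rewrite mulf_eq0 mulf_eq0 (negPf c0) /= sqrf_eq0 => h0.
rewrite hornerM; apply/eqP; rewrite mulf_eq0.
have := second_derivr nb kh; rewrite /a0 /a2 /rat_pair /= in h0 *; move=> <-.
by move: h0; rewrite {1}/evalr /= mulf_eq0 invr_eq0 (negPf kh) orbF.
Qed.

Lemma frame_swap (E1 E2 : point) : frame E1 E2 w -> frame E2 E1 w.
Proof. by move=> [[h1 h2 h3] [h4 h5 h6]]; split; split=> //; rewrite dotC. Qed.

Lemma hyperbola_center E1 E2 na nb k D Phi : frame E1 E2 w ->
  level_form F Q E1 E2 w 0%:P 1%:P 0%:P na nb k D Phi ->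
  affine_center na k /\ affine_center nb k.
Proof.
move=> fr lev; split; last exact: hyperbola_second lev.
apply: (@hyperbola_second E2 E1 nb na k D Phi (frame_swap fr)).
have [k0 D0 P0 d0 levE] := lev; split=> // x y z kz.
have := levE y x z kz; rewrite !hornerC (_ : qf (0, 1, 0) y x = qf (0, 1, 0) x y); last first.
  by rewrite /qf /=; ring.
move=> <-; congr (_ * evalP F _); rewrite /pt.
by apply/colP => i; rewrite !mxE; ring.
Qed.

(** The circle through (x, y) has the rational parametrization by the tangent u of
    half the angle of rotation.  The equation of the axis, multiplied by
    (1 + u^2)^3, is a real polynomial in u, and its value at u = i, a circular
    point at infinity, is given by [circ_defect0].  As a, b, a'', b'' are real,
    either a = b = 0 or a'' = b'' = 0 at the height considered. *)
Lemma circle_center E1 E2 na nb k D Phi : frame E1 E2 w ->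
  level_form F Q E1 E2 w 1%:P 0%:P 1%:P na nb k D Phi ->
  affine_center na k /\ affine_center nb k.
Proof.
move=> fr lev; have [k0 _ _ _ _] := lev.
have main : forall h, (k.[h] != 0 /\ exists x y r N,
    let J := level_jet 1%:P 0%:P 1%:P na nb k D Phi h r in
    [/\ r != 0, r = qf (1, 0, 1) x y,
     evalP N (pt Q E1 E2 w (x + evalr (na, k) h) (y + evalr (nb, k) h) h) != 0 &
     forall X Y, qf (1, 0, 1) X Y = r ->
       evalP N (pt Q E1 E2 w (X + evalr (na, k) h) (Y + evalr (nb, k) h) h) != 0 ->
       jdefect J (axisv J X Y) X Y = 0]) ->
    (na.[h] = 0 /\ nb.[h] = 0) \/ ((second_num na k).[h] = 0 /\ (second_num nb k).[h] = 0).
  move=> h [kh [x [y [r [N [r0 rE Nxy hJ]]]]]].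
  have [a1 [a3 [g1 [g2 [g3 [JE _]]]]]] := level_jet_const 1 0 1 na nb k D Phi h r.
  rewrite JE in hJ; set a0 := rat_pair _ _ _ 0 h in JE hJ; set a2 := rat_pair _ _ _ 2 h in JE hJ.
  have rE' : r = x ^+ 2 + y ^+ 2 by rewrite rE /qf /=; ring.
  pose d : {poly R} := 1 + 'X^2.
  pose Xp : {poly R} := x *: (1 - 'X^2) - (2 * y) *: 'X.
  pose Yp : {poly R} := y *: (1 - 'X^2) + (2 * x) *: 'X.
  have dE u : d.[u] = 1 + u ^+ 2 by rewrite /d !(hornerD, hornerC, hornerXn).
  have XpE u : Xp.[u] = x * (1 - u ^+ 2) - 2 * y * u.
    by rewrite /Xp !(hornerD, hornerN, hornerC, hornerZ, hornerXn, hornerX).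
  have YpE u : Yp.[u] = y * (1 - u ^+ 2) + 2 * x * u.
    by rewrite /Yp !(hornerD, hornerN, hornerC, hornerZ, hornerXn, hornerX).
  pose T := circ_defect (map2 (@polyC R) a0) (map2 (@polyC R) a1) (map2 (@polyC R) a2)
    (map2 (@polyC R) a3) g1%:P g2%:P g3%:P r%:P Xp Yp d.
  have TE u : T.[u] = circ_defect a0 a1 a2 a3 g1 g2 g3 r Xp.[u] Yp.[u] d.[u].
    rewrite -[LHS]/(horner_eval u T) /T rmorph_circ_defect !map2_polyC.
    by rewrite /= /horner_eval !hornerC.
  have T0 : T = 0.
    apply: (@curve_zero R Q E1 E2 w N Xp Yp d _ (evalr (na, k) h) (evalr (nb, k) h) h 0).
    - by rewrite dE expr0n addr0 oner_neq0.
    - by rewrite XpE YpE dE expr0n /= !mulr0 !(subr0, addr0) !mulr1 !divr1.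
    move=> u du Nu; rewrite TE.
    have ru : (Xp.[u] / d.[u]) ^+ 2 + (Yp.[u] / d.[u]) ^+ 2 = r.
      by rewrite XpE YpE rE' dE in du *; field.
    rewrite -{1}ru (circ_defectE _ _ _ _ _ _ _ _ _ (mulVf du)).
    rewrite hJ ?mulr0 // -ru /qf /=; ring.
  pose i : complex R := complex.Complex 0 1.
  pose c : {rmorphism R -> complex R} := real_complex R.
  have i2 : i ^+ 2 = -1 by rewrite expr2; apply/eqP; rewrite eq_complex /= !(mul0r, mulr0, mulr1, add0r, sub0r, addr0) oppr0 !eqxx.
  have ci (a b : R) : c a + c b * i = 0 -> a = 0 /\ b = 0.
    move=> /eqP; rewrite eq_complex /= !(mul0r, mulr0, mulr1, add0r, sub0r, addr0, subr0).
    by move=> /andP [/eqP -> /eqP ->].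
  have [phi [phiC phi_i]] : exists phi : {rmorphism {poly R} -> complex R},
      (forall a, phi a%:P = c a) /\ phi 'X = i.
    exists (horner_eval i \o map_poly c); split=> [a|] /=.
      by rewrite /horner_eval map_polyC hornerC.
    by rewrite /horner_eval map_polyX hornerX.
  clearbody c i.
  have m2 a : map2 phi (map2 (@polyC R) a) = map2 c a.
    by rewrite /map2; congr (_, _); exact: phiC.
  have phid : phi d = 0 by rewrite /d rmorphD rmorphXn phi_i i2 rmorph1 subrr.
  have phiX : phi Xp = 2 * (c x - c y * i).
    transitivity (phi x%:P * (1 - phi 'X ^+ 2) - 2 * phi y%:P * phi 'X).
      by rewrite /Xp -!mul_polyC polyCM; ring.
    by rewrite !phiC phi_i i2; ring.
  (* The point tends to the circular point of direction (1, i). *)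
  have phiY : phi Yp = phi Xp * i.
    transitivity (phi y%:P * (1 - phi 'X ^+ 2) + 2 * phi x%:P * phi 'X).
      by rewrite /Yp -!mul_polyC polyCM; ring.
    by rewrite !phiC phi_i phiX i2; ring: i2.
  have : phi T = 0 by rewrite T0 rmorph0.
  rewrite /T rmorph_circ_defect !m2 !phiC phid phiY circ_defect0 // => /eqP.
  have i0 : i != 0 by apply: contraTneq (oner_neq0 (complex R)) => i0; rewrite -[1]opprK -i2 i0 expr0n /= oppr0 eqxx.
  have X0 : phi Xp != 0.
    rewrite phiX mulf_neq0 ?pnatr_eq0 //; apply: contraNneq r0.
    rewrite -mulNr -rmorphN => /ci [x0 y0]; rewrite rE' x0 expr0n add0r sqrf_eq0.
    by rewrite -oppr_eq0 y0.
  have r0c : c r != 0 by rewrite fmorph_eq0.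
  have lead0 : 96 * i * c r * phi Xp ^+ 3 != 0.
    apply: mulf_neq0; last exact: expf_neq0.
    by apply: mulf_neq0 => //; apply: mulf_neq0 => //; rewrite pnatr_eq0.
  rewrite mulf_eq0 mulf_eq0 (negPf lead0) /= sqrf_eq0.
  move=> /orP [/eqP/ci|/eqP/ci] [e1 e2]; [right|left].
    by split; apply/eqP; rewrite -second_derivr //; apply/eqP.
  move: e1 e2; rewrite /evalr /= => /eqP + /eqP; rewrite !mulf_eq0 invr_eq0 (negPf kh) !orbF.
  by move=> /eqP-> /eqP->.
have dG := constant_points fr lev.
have z (p q : {poly R}) : (forall h, k.[h] != 0 -> (na.[h] = 0 /\ nb.[h] = 0) \/
   ((second_num na k).[h] = 0 /\ (second_num nb k).[h] = 0) -> (p * q).[h] = 0) -> p * q = 0.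
  by move=> hpq; apply: (dense_eq0 dG) => h hh; apply: (hpq h hh.1); exact: main.
have z11 : na * second_num na k = 0.
  by apply: z => h _ [[e1 e2]|[e1 e2]]; rewrite hornerM e1 ?mul0r ?mulr0.
have z12 : na * second_num nb k = 0.
  by apply: z => h _ [[e1 e2]|[e1 e2]]; rewrite hornerM ?e1 ?e2 ?mul0r ?mulr0.
have z21 : nb * second_num na k = 0.
  by apply: z => h _ [[e1 e2]|[e1 e2]]; rewrite hornerM ?e1 ?e2 ?mul0r ?mulr0.
have z22 : nb * second_num nb k = 0.
  by apply: z => h _ [[e1 e2]|[e1 e2]]; rewrite hornerM ?e1 ?e2 ?mul0r ?mulr0.
have [a0|a0] := eqVneq na 0; last first.
  move/eqP: z11; rewrite mulf_eq0 (negPf a0) => /eqP s1.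
  move/eqP: z12; rewrite mulf_eq0 (negPf a0) => /eqP s2.
  by split; exact: second_num0.
have [b0|b0] := eqVneq nb 0; last first.
  move/eqP: z21; rewrite mulf_eq0 (negPf b0) => /eqP s1.
  move/eqP: z22; rewrite mulf_eq0 (negPf b0) => /eqP s2.
  by split; exact: second_num0.
by rewrite a0 b0; split; exact: affine_center0.
Qed.
End Form.
End Constant.

(** * Uniqueness of the axis *)

Section Fixed.
Variables (R : realType).
Local Notation point := 'cV[R]_3.
Variables (F : {mpoly R[3]}) (gamma : 'cV[{fraction {mpoly R[3]}}]_3).
Hypothesis gamma_normal : affine_normal_field F gamma.
Hypothesis D_eq1 : solution_dim gamma 1.
Variables (Q E1 E2 w : point).
Hypothesis fr : frame E1 E2 w.
Hypothesis sol : solves_L gamma (plucker Q w).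
Variables (t11 t12 t22 : R).

Lemma evalr_affine (k : {poly R}) a0 a1 z : k.[z] != 0 ->
  let r := (k * (a0%:P + a1 *: 'X), k) in
  [/\ evalr r z = a0 + a1 * z, evalr (derivr r) z = a1 & evalr (derivr (derivr r)) z = 0].
Proof.
move=> kz /=; have nE : (k * (a0%:P + a1 *: 'X))^`() * k - k * (a0%:P + a1 *: 'X) * k^`() = a1 *: k ^+ 2.
  by rewrite derivM derivD derivC derivZ derivX -!mul_polyC; ring.
split.
- rewrite /evalr /= !(hornerM, hornerD, hornerC, hornerZ, hornerX); field; exact: kz.
- rewrite /evalr /derivr /= nE hornerZ mulfK //.
  by rewrite horner_exp expf_neq0.
rewrite /evalr /derivr /= nE derivZ -!mul_polyC.
by rewrite (_ : _ - _ = 0) ?horner0 ?mul0r //; ring.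
Qed.

(** The second derivatives of the centre vanish, so the equation for the line of the
    centres is the identity [center_line]. *)
Lemma center_solves k D Phi a0 a1 b0 b1 :
  level_form F Q E1 E2 w t11%:P t12%:P t22%:P
    (k * (a0%:P + a1 *: 'X)) (k * (b0%:P + b1 *: 'X)) k D Phi ->
  solves_L gamma (plucker (Q + a0 *: E1 + b0 *: E2) (a1 *: E1 + b1 *: E2 + w)).
Proof.
set na := k * _; set nb := k * _ => lev; have [k0 D0 P0 det0 levE] := lev.
apply: (annihilated_solves gamma_normal) => N N0.
have dH := dense_poly (@dense_setT R) (mulf_neq0 k0 D0).
have dets_h h : True /\ (k * D).[h] != 0 -> t11 * t22 - t12 ^+ 2 != 0.
  move=> _; apply: contraNneq det0 => d0.
  by rewrite -!polyCM -polyC_exp -polyCB d0.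
have dG := @generic_points R Q E1 E2 w fr N _ (fun=> t11) (fun=> t12) (fun=> t22)
  (evalr (na, k)) (evalr (nb, k)) Phi^`() dH N0 P0 dets_h.
have [h [[[_ +] [x [y [Nxy r0 Phir]]]] _]] := dG _ (oner_neq0 _).
rewrite hornerM mulf_eq0 negb_or => /andP [kh Dh].
exists (pt Q E1 E2 w (x + evalr (na, k) h) (y + evalr (nb, k) h) h) => // X p0 lp K0.
have [ea ea1 ea2] := evalr_affine a0 a1 kh; have [eb eb1 eb2] := evalr_affine b0 b1 kh.
rewrite {1}ea {1}eb (field_at_center Q fr) dotZr.
have hd := @level_defect R F Q E1 E2 w fr _ _ _ na nb k D Phi lev x y h X p0 (- y, x, 0).
rewrite !hornerC in hd; have [_] := hd lp K0 kh Dh r0 Phir.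
rewrite ea1 eb1 => -> ; first by rewrite mulr0.
have [c1 [c3 [g1 [g2 [g3 [-> _]]]]]] := level_jet_const t11 t12 t22 na nb k D Phi h (qf (t11, t12, t22) x y).
rewrite {2}/rat_pair /= ea2 eb2; exact: center_line.
Qed.

Lemma solution_unique Q' w' : w != 0 -> solves_L gamma (plucker Q' w') ->
  exists c, plucker Q' w' = c *: plucker Q w.
Proof.
move=> w0 sol'; have [U [UE dU]] := D_eq1.
have u0 : plucker Q w != 0 by apply: contraNneq w0 => -[_ ->].
have UE' : U = <[plucker Q w]>%VS.
  apply/eqP; rewrite eq_sym eqEdim dU dim_vline u0 andbT.
  by rewrite -memvE; apply/UE.
have : plucker Q' w' \in U by apply/UE.
by rewrite UE' => /vlineP.
Qed.

(** The line of the centres and the axis have proportional coordinates.  Both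
    directions have the same component on w, so the factor is 1, and the
    horizontal components vanish. *)
Lemma center_trivial na nb k D Phi :
  level_form F Q E1 E2 w t11%:P t12%:P t22%:P na nb k D Phi ->
  affine_center na k -> affine_center nb k -> na = 0 /\ nb = 0.
Proof.
move=> lev [a0 [a1 naE]] [b0 [b1 nbE]]; rewrite naE nbE in lev.
have [[e11 e22 e12] [e1w e2w w0]] := fr.
have [c [cQ cw]] := solution_unique w0 (center_solves lev).
have dE (u v : point) : u = v -> forall e, dot e u = dot e v by move=> ->.
have ww := frame_ww fr.
have c1 : c = 1.
  have := dE _ _ cw w; rewrite !dot_lin [dot w E1]dotC [dot w E2]dotC e1w e2w !mulr0 !add0r => h.
  by apply: (mulIf ww); rewrite mul1r.
rewrite c1 !scale1r in cw cQ.
have a10 : a1 = 0.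
  by have := dE _ _ cw E1; rewrite !dot_lin e11 e12 e1w mulr1 mulr0 !addr0.
have b10 : b1 = 0.
  by have := dE _ _ cw E2; rewrite !dot_lin e22 [dot E2 E1]dotC e12 e2w mulr1 mulr0 add0r addr0.
rewrite {}cw in cQ.
have {}cQ : cross (vec E1 E2 w (a0, b0, 0)) (vec E1 E2 w (0, 0, 1)) = 0.
  have -> : vec E1 E2 w (0, 0, 1) = w by rewrite /vec /= !scale0r !add0r scale1r.
  have -> : vec E1 E2 w (a0, b0, 0) = a0 *: E1 + b0 *: E2 by rewrite /vec /= scale0r addr0.
  by apply: (addrI (cross Q w)); rewrite addr0 -crossDl addrA.
rewrite (cross_vec fr) in cQ; move/eqP: cQ; rewrite scaler_eq0 (negPf (frame_vol_neq0 fr)) /=.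
move=> /eqP cQ.
have cz s : dot3 (cross3 (a0, b0, 0) (0, 0, 1)) s = 0.
  rewrite -(dot_covec fr) cQ dotE /dot3 /= !mxE; ring.
have b00 : b0 = 0 by have := cz (1, 0, 0); rewrite /dot3 /cross3 /= => <-; ring.
have a00 : a0 = 0 by apply/eqP; rewrite -oppr_eq0; have := cz (0, 1, 0); rewrite /dot3 /cross3 /= => <-; apply/eqP; ring.
by rewrite naE nbE a00 a10 b00 b10 scale0r addr0 mulr0.
Qed.

Lemma level_invariant k D Phi :
  level_form F Q E1 E2 w t11%:P t12%:P t22%:P 0 0 k D Phi ->
  forall x y x' y' z, qf (t11, t12, t22) x y = qf (t11, t12, t22) x' y' ->
  evalP F (pt Q E1 E2 w x y z) = evalP F (pt Q E1 E2 w x' y' z).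
Proof.
move=> [k0 D0 _ _ lev] x y x' y' z xy; rewrite -!horner_restr; congr (_.[_]).
have h u v : k * (D * restr F Q E1 E2 w u v) = k * Phi.[(qf (t11, t12, t22) u v)%:P].
  apply: polyfun_inj => t; rewrite !hornerM.
  have [->|kt] := eqVneq k.[t] 0; first by rewrite !mul0r.
  have := lev u v t kt; rewrite /evalr /= !horner0 !mul0r !addr0 => e.
  by rewrite horner_restr e /eval2 !hornerC.
apply: (mulfI D0); apply: (mulfI k0); rewrite !h xy //.
Qed.
End Fixed.

(** * Sections that factor completely *)

Lemma size_psubst_line n (R : idomainType) (F : {mpoly R[n]}) (x : 'I_n -> {poly R}) :
  (forall i, (size (x i) <= 2)%N) -> (size (psubst F x) <= msize F)%N.
Proof.
move=> sx; rewrite /psubst /mmap; apply: (leq_trans (size_sum _ _ _)).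
apply/bigmax_leqP_seq => m mF _.
rewrite mul_polyC; apply: (leq_trans (size_scale_leq _ _)).
apply: leq_trans (msize_mdeg_lt mF).
have sX i : (size (x i ^+ m i) <= (m i).+1)%N.
  apply: (leq_trans (size_poly_exp_leq _ _)); rewrite ltnS.
  by have := sx i; case: (size (x i)) => [|[|[|]]] //= _; rewrite ?mul0n ?mul1n.
rewrite /mmap1 mdegE.
elim/big_rec2: _ => [|i d p _ sp]; first by rewrite size_poly1.
apply: (leq_trans (size_polyMleq _ _)).
by have := sX i; move: sp; case: (size (x i ^+ m i)) => [|u]; lia.
Qed.

Section Sections.
Variables (R : realType).
Local Notation point := 'cV[R]_3.
Local Notation C := (complex.complex R).
Let c : {rmorphism R -> C} := complex.real_complex R.
Let i : C := complex.Complex 0 1.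

(** The imaginary part of P vanishes at all squares. *)
Lemma real_poly (P : {poly C}) (y : R -> R) :
  (forall t, P.[c (t ^+ 2)] = c (y t)) -> exists p : {poly R}, P = map_poly c p.
Proof.
move=> hP; pose p : {poly R} := \poly_(j < size P) complex.Re P`_j.
pose q : {poly R} := \poly_(j < size P) complex.Im P`_j.
have PE : P = map_poly c p + i *: map_poly c q.
  apply/polyP => j; rewrite coefD coefZ !coef_map.
  case: (P`_j) => a b; apply/eqP; rewrite complex.eq_complex /=.
  by rewrite !(mul0r, mulr0, mul1r, subr0, sub0r, addr0, add0r, oppr0) !eqxx.
exists p; rewrite {1}PE (_ : q = 0) ?rmorph0 ?scaler0 ?addr0 //.
have q0 t : q.[t ^+ 2] = 0.
  have := hP t; rewrite {1}PE hornerD hornerZ !horner_map => /eqP.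
  rewrite complex.eq_complex /= !(mul0r, mulr0, mul1r, subr0, sub0r, addr0, add0r).
  by move=> /andP [_ /eqP].
apply/eqP; have : q \Po 'X^2 = 0.
  by apply: polyfun_inj => t; rewrite horner_comp hornerXn q0 horner0.
by move/eqP; rewrite comp_poly_eq0 // size_polyXn.
Qed.

Variables (F : {mpoly R[3]}).

Definition pair2 (K : Type) (s t : K) (j : 'I_2) : K := if j == ord0 then s else t.

(** The product of the factors takes real values at the values of the form, among
    which are all squares, so it is a real polynomial p although the factors need
    not be real.  On the line directed by (a, b) the section is p(t^2), which
    bounds the degree of p. *)
Lemma factors_real q (qv : R -> R -> R) O e1 e2 :
  (forall s t, meval (pair2 (c s) (c t)) q = c (qv s t)) ->
  (exists a b, forall t, qv (t * a) (t * b) = t ^+ 2) ->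
  factors_into q F O e1 e2 ->
  exists p : {poly R}, (1 < size p <= msize F)%N /\
    forall s t, evalP F (O + s *: e1 + t *: e2) = p.[qv s t].
Proof.
move=> qE [a [b qab]] [k [rhos [k0 sr _ FE]]].
have sE s t : meval (pair2 s t) (section F O e1 e2) = evalP F (O + s *: e1 + t *: e2).
  rewrite /section comp_mpoly_meval; apply: meval_eq => j.
  rewrite tnth_mktuple !mevalD !mevalZ mevalC /X0 /X1 !mevalXU /pair2 /= !mxE.
  by ring.
pose P : {poly C} := k *: \prod_(rho <- rhos) ('X - rho%:P).
have PE s t : P.[c (qv s t)] = c (evalP F (O + s *: e1 + t *: e2)).
  have := congr1 (meval (pair2 (c s) (c t))) FE.
  have -> : meval (pair2 (c s) (c t)) (map_mpoly c (section F O e1 e2)) = c (evalP F (O + s *: e1 + t *: e2)).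
    rewrite -sE /map_mpoly /meval (rmorph_mmap c) rmorph_mmap.
    apply: eq_mmap => [x|j] /=; first by rewrite mmapC.
    by rewrite mmapX mmap1U /pair2; case: ifP.
  move=> ->; rewrite /P mevalZ hornerZ; congr (_ * _).
  rewrite horner_prod (rmorph_prod (meval (pair2 (c s) (c t)))) /=.
  by apply: eq_bigr => rho _; rewrite hornerXsubC mevalB mevalC qE.
have [p pP] : exists p, P = map_poly c p.
  apply: (@real_poly _ (fun t => evalP F (O + (t * a) *: e1 + (t * b) *: e2))) => t.
  by rewrite -PE qab.
have pE s t : evalP F (O + s *: e1 + t *: e2) = p.[qv s t].
  by have := PE s t; rewrite pP horner_map => /(fmorph_inj c) <-.
exists p; split=> //.
have sP : size p = (size rhos).+1.
  rewrite -(size_map_poly c) -pP /P size_scale // size_prod_XsubC //.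
rewrite sP ltnS sr /=.
pose x (j : 'I_3) : {poly R} := (O j 0)%:P + (a * e1 j 0 + b * e2 j 0) *: 'X.
have xE : psubst F x = p \Po 'X^2.
  apply: polyfun_inj => t; rewrite horner_psubst horner_comp hornerXn -qab -pE.
  apply: meval_eq => j; rewrite !(hornerD, hornerC, hornerZ, hornerX) !mxE; ring.
have sx j : (size (x j) <= 2)%N.
  rewrite /x (leq_trans (size_polyD _ _)) // geq_max (leq_trans (size_polyC_leq1 _)) //=.
  by rewrite (leq_trans (size_scale_leq _ _)) // size_polyX.
have := size_psubst_line F sx; rewrite xE.
rewrite -[X in (X <= _)%N -> _]prednK; last first.
  by rewrite size_poly_gt0 comp_poly_eq0 ?size_polyXn // -size_poly_gt0 sP.
rewrite size_comp_poly size_polyXn sP /=; apply: leq_trans; lia.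
Qed.

End Sections.

Section Planes.
Variables (R : realType) (F : {mpoly R[3]}).
Local Notation point := 'cV[R]_3.

Lemma plane_frame_frame (Q w : point) h (O e1 e2 : point) : w != 0 -> plane_frame Q w h O e1 e2 -> frame e1 e2 w.
Proof. by move=> w0 [[_ h1 h2] [h3 h4 h5]]; split. Qed.

(** The sign s compares the orientations of the two frames. *)
Lemma frame_change (E1 E2 w e1 e2 : point) : frame E1 E2 w -> frame e1 e2 w ->
  exists c n s, [/\ c ^+ 2 + n ^+ 2 = 1, s ^+ 2 = 1,
    E1 = c *: e1 + (- (s * n)) *: e2 & E2 = n *: e1 + (s * c) *: e2].
Proof.
move=> fr fr'; have [[E11 E22 E12] [E1w E2w _]] := fr.
have [[e11 e22 e12] [e1w e2w _]] := fr'.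
have dec u : dot u w = 0 -> u = dot e1 u *: e1 + dot e2 u *: e2.
  by move=> uw; rewrite {1}(frame_decomp fr' u) [dot w u]dotC uw mul0r scale0r addr0.
have prod u v : dot u w = 0 -> dot v w = 0 ->
    dot u v = dot e1 u * dot e1 v + dot e2 u * dot e2 v.
  move=> uw vw; rewrite {1}(dec u uw) {1}(dec v vw) !dot_lin e11 e22 e12 [dot e2 e1]dotC e12.
  by ring.
have p1 := prod _ _ E1w E1w; have p2 := prod _ _ E2w E2w; have p3 := prod _ _ E1w E2w.
rewrite E11 in p1; rewrite E22 in p2; rewrite E12 in p3.
move: (dec E1 E1w) (dec E2 E2w) p1 p2 p3.
move: (dot e1 E1) (dot e2 E1) (dot e1 E2) (dot e2 E2) => c m n l dE1 dE2 p1 p2 p3.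
pose s := c * l - m * n.
have s2 : s ^+ 2 = 1.
  transitivity ((c * c + m * m) * (n * n + l * l) - (c * n + m * l) ^+ 2); first by rewrite /s; ring.
  by rewrite -p1 -p2 -p3; ring.
have lE : l = s * c.
  transitivity (l * (c * c + m * m)); first by rewrite -p1 mulr1.
  transitivity (s * c + m * (c * n + m * l)); first by rewrite /s; ring.
  by rewrite -p3 mulr0 addr0.
have mE : m = - (s * n).
  transitivity (m * (n * n + l * l)); first by rewrite -p2 mulr1.
  transitivity (- (s * n) + l * (c * n + m * l)); first by rewrite /s; ring.
  by rewrite -p3 mulr0 addr0.
exists c, n, s; split=> //; last by rewrite -lE.
  by rewrite p1 mE -!expr2 sqrrN exprMn s2 mul1r.
by rewrite -mE.
Qed.

Lemma section_plane (Q E1 E2 w : point) h (O e1 e2 : point) : frame E1 E2 w -> plane_frame Q w h O e1 e2 ->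
  exists c n s o1 o2, [/\ c ^+ 2 + n ^+ 2 = 1, s ^+ 2 = 1 &
    forall x y, pt Q E1 E2 w x y h = O + (c * (x - o1) + n * (y - o2)) *: e1
      + (s * (- n * (x - o1) + c * (y - o2))) *: e2].
Proof.
move=> fr pf; have w0 : w != 0 by case: fr => _ [].
have [c [n [s [cn s2 dE1 dE2]]]] := frame_change fr (plane_frame_frame w0 pf).
exists c, n, s, (frame_x Q E1 O), (frame_y Q E2 O); split=> // x y.
have zO : frame_z Q w O = h.
  case: pf => -[/= pO _ _] _; rewrite /frame_z; have ww := frame_ww fr.
  apply: (mulIf ww); rewrite divfK //; apply/eqP; rewrite subr_eq; apply/eqP.
  move: pO; rewrite /normal_plane /= dotC !dot_lin => /eqP; rewrite subr_eq0 => /eqP ->.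
  by rewrite addrC.
rewrite {1}(pt_frame Q fr O) zO; move: (frame_x Q E1 O) (frame_y Q E2 O) => o1 o2.
rewrite /pt dE1 dE2; apply/colP => i; rewrite !mxE; ring.
Qed.

Lemma section_circle (Q E1 E2 w : point) h : frame E1 E2 w ->
  section_concentric_circles F Q w h -> exists o1 o2 p,
  conic_data (fun x y => evalP F (pt Q E1 E2 w x y h)) (msize F) (1, 0, 1) o1 o2 p.
Proof.
move=> fr [ O [e1 [e2 [pf fac]]]].
have [c [n [s [ o1 [ o2 [cn s2 ptE]]]]]] := section_plane fr pf.
have [||p [sp pE]] := factors_real (qv := fun s t => s ^+ 2 + t ^+ 2) _ _ fac.
- by move=> u v; rewrite mevalD !rmorphXn /= /X0 /X1 !mevalXU /pair2 /= rmorphD !rmorphXn.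
- by exists 1, 0 => t; ring.
exists o1, o2, p; split=> //; first by rewrite /dets /= mulr1 expr0n subr0 oner_neq0.
move=> x y; rewrite ptE pE; congr (_.[_]); rewrite /qf /=.
move: (x - o1) (y - o2) => X Y.
rewrite exprMn s2; transitivity ((c ^+ 2 + n ^+ 2) * (X ^+ 2 + Y ^+ 2)); first by ring.
by rewrite cn; ring.
Qed.

Lemma section_hyperbola (Q E1 E2 w : point) h : frame E1 E2 w ->
  section_rectangular_hyperbolas F Q w h -> exists c n s o1 o2 p,
  [/\ c ^+ 2 + n ^+ 2 = 1, s ^+ 2 = 1 &
  conic_data (fun x y => evalP F (pt Q E1 E2 w x y h)) (msize F)
    (- (s * c * n), s * (c ^+ 2 - n ^+ 2) / 2, s * c * n) o1 o2 p].
Proof.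
move=> fr [ O [e1 [e2 [pf fac]]]].
have [c [n [s [ o1 [ o2 [cn s2 ptE]]]]]] := section_plane fr pf.
have [||p [sp pE]] := factors_real (qv := fun s t => s * t) _ _ fac.
- by move=> u v; rewrite mevalM /X0 /X1 !mevalXU /pair2 /= rmorphM.
- by exists 1, 1 => t; ring.
exists c, n, s, o1, o2, p; split=> //; split=> //.
  rewrite /dets /= (_ : _ - _ = - (s ^+ 2 * (c ^+ 2 + n ^+ 2) ^+ 2 / 4)); last by field.
  by rewrite s2 cn expr1n !mul1r oppr_eq0 invr_eq0 pnatr_eq0.
move=> x y; rewrite ptE pE; congr (_.[_]); rewrite /qf /=.
by move: (x - o1) (y - o2) => X Y; field.
Qed.

(** The last condition on the four numbers says that the double angles of (c, n) and
    (c0, n0) agree modulo pi, that is, that the asymptotes of the section are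
    directed by (c0, n0) and (- n0, c0).  By the identity of Lagrange m is 1/2 up
    to sign. *)
Lemma rotate_hyperbola (c n s c0 n0 : R) (Q E1 E2 w : point) h o1 o2 p :
  c ^+ 2 + n ^+ 2 = 1 -> s ^+ 2 = 1 -> c0 ^+ 2 + n0 ^+ 2 = 1 ->
  c * n * (c0 ^+ 2 - n0 ^+ 2) = c0 * n0 * (c ^+ 2 - n ^+ 2) ->
  conic_data (fun x y => evalP F (pt Q E1 E2 w x y h)) (msize F)
    (- (s * c * n), s * (c ^+ 2 - n ^+ 2) / 2, s * c * n) o1 o2 p ->
  exists m a b, conic_data (fun x y => evalP F
     (pt Q (c0 *: E1 + n0 *: E2) (- n0 *: E1 + c0 *: E2) w x y h)) (msize F) (0, m, 0) a b p.
Proof.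
move=> cn s2 cn0 par [dS sp pE].
pose m := s * (4 * c * n * c0 * n0 + (c ^+ 2 - n ^+ 2) * (c0 ^+ 2 - n0 ^+ 2)) / 2.
have m2 : m ^+ 2 = 1 / 4.
  rewrite /m; transitivity (s ^+ 2 * ((c ^+ 2 + n ^+ 2) ^+ 2 * (c0 ^+ 2 + n0 ^+ 2) ^+ 2 / 4
    - (c * n * (c0 ^+ 2 - n0 ^+ 2) - c0 * n0 * (c ^+ 2 - n ^+ 2)) ^+ 2)); first by field.
  by rewrite s2 cn cn0 par subrr !expr1n expr0n /= subr0 !mul1r.
exists m, (c0 * o1 + n0 * o2), (- n0 * o1 + c0 * o2); split=> //.
  by rewrite /dets /= mulr0 sub0r m2 oppr_eq0 mulf_neq0 ?oner_neq0 // invr_eq0 pnatr_eq0.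
move=> x y.
have -> : pt Q (c0 *: E1 + n0 *: E2) (- n0 *: E1 + c0 *: E2) w x y h =
    pt Q E1 E2 w (c0 * x - n0 * y) (n0 * x + c0 * y) h.
  by apply/colP => i; rewrite !mxE; ring.
rewrite pE; congr (_.[_]); rewrite /qf /=.
have -> : c0 * x - n0 * y - o1 = c0 * (x - (c0 * o1 + n0 * o2)) - n0 * (y - (- n0 * o1 + c0 * o2)).
  transitivity (c0 * x - n0 * y - (c0 ^+ 2 + n0 ^+ 2) * o1); last by ring.
  by rewrite cn0 mul1r.
have -> : n0 * x + c0 * y - o2 = n0 * (x - (c0 * o1 + n0 * o2)) + c0 * (y - (- n0 * o1 + c0 * o2)).
  transitivity (n0 * x + c0 * y - (c0 ^+ 2 + n0 ^+ 2) * o2); last by ring.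
  by rewrite cn0 mul1r.
move: (x - _) (y - _) => X Y.
have -> : 0 * X ^+ 2 + 2 * m * X * Y + 0 * Y ^+ 2 = 2 * m * X * Y by ring.
rewrite /m; transitivity (s * ((c ^+ 2 - n ^+ 2) * (c0 ^+ 2 - n0 ^+ 2) + 4 * c * n * c0 * n0) * X * Y
  - s * (c * n * (c0 ^+ 2 - n0 ^+ 2) - c0 * n0 * (c ^+ 2 - n ^+ 2)) * (X ^+ 2 - Y ^+ 2)); first by field.
by rewrite par subrr; field.
Qed.

Lemma frame_rotate c0 n0 (E1 E2 w : point) : c0 ^+ 2 + n0 ^+ 2 = 1 -> frame E1 E2 w ->
  frame (c0 *: E1 + n0 *: E2) (- n0 *: E1 + c0 *: E2) w.
Proof.
move=> cn [[e11 e22 e12] [e1w e2w w0]].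
split; split=> //; rewrite !dot_lin ?e11 ?e22 ?e12 ?[dot E2 E1]dotC ?e12 ?e1w ?e2w.
- by rewrite -[RHS]cn; ring.
- by rewrite -[RHS]cn; ring.
- by ring.
- by ring.
- by ring.
Qed.
End Planes.

(** * The polynomial depends on the height and on the form only *)

Section Invariance.
Variables (R : realType) (F : {mpoly R[3]}) (gamma : 'cV[{fraction {mpoly R[3]}}]_3).
Local Notation point := 'cV[R]_3.
Hypothesis gamma_normal : affine_normal_field F gamma.
Hypothesis D_eq1 : solution_dim gamma 1.
Variables (Q w : point).
Hypothesis w0 : w != 0.
Hypothesis sol : solves_L gamma (plucker Q w).

Definition form_invariant (e : R) (E1 E2 : point) :=
  forall x y x' y' z, x ^+ 2 + e * y ^+ 2 = x' ^+ 2 + e * y' ^+ 2 ->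
  evalP F (pt Q E1 E2 w x y z) = evalP F (pt Q E1 E2 w x' y' z).

Lemma circle_invariant : dense_set (section_concentric_circles F Q w) ->
  exists E1 E2, frame E1 E2 w /\ form_invariant 1 E1 E2.
Proof.
move=> dH; have [h0 [[ O [E1 [E2 [pf _]]]] _]] := dH _ (oner_neq0 _).
have fr := plane_frame_frame w0 pf; exists E1, E2; split=> //.
have data h (Hh : section_concentric_circles F Q w h) := section_circle fr Hh.
have [|s11 [s12 [s22 [na [nb [k [D [Phi [lev good]]]]]]]]] := @central_level R F Q E1 E2 w (msize F) _ dH.
  by move=> h /data [ o1 [ o2 [p]]]; exists (1, 0, 1), o1, o2, p.
have forms h : section_concentric_circles F Q w h /\ (forall S o1 o2 p,
     conic_data (fun x y => evalP F (pt Q E1 E2 w x y h)) (msize F) S o1 o2 p ->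
     exists2 kap, kap != 0 & [/\ s11.[h] = kap * S.1.1, s12.[h] = kap * S.1.2 & s22.[h] = kap * S.2]) ->
   s12.[h] = 0 /\ s22.[h] = s11.[h].
  move=> [/data [ o1 [ o2 [p D1]]] /(_ _ _ _ _ D1) [kap _ /= [-> -> ->]]].
  by rewrite mulr0.
have z12 : s12 = 0 by apply: (dense_eq0 good) => h /forms [].
have z22 : s22 = s11.
  apply/eqP; rewrite -subr_eq0; apply/eqP; apply: (dense_eq0 good) => h /forms [_].
  by rewrite !hornerE => ->; rewrite subrr.
have s0 : s11 != 0.
  by case: lev => _ _ _ + _; apply: contraNneq => s0; rewrite z22 z12 s0 mul0r expr0n subr0.
have {}lev : level_form F Q E1 E2 w (s11 * 1%:P) (s11 * 0%:P) (s11 * 1%:P) na nb k D Phi.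
  by rewrite polyC1 polyC0 mulr1 mulr0 -{2}z22 -z12.
have {}lev := level_form_const s0 lev.
have [ca cb] := circle_center gamma_normal sol fr lev.
have [a0 b0] := center_trivial gamma_normal D_eq1 fr sol lev ca cb.
rewrite a0 b0 in lev; move=> x y x' y' z xy; apply: (level_invariant lev).
by rewrite /qf /= !(mul1r, mulr0, mul0r, addr0) in xy *.
Qed.

(** By [rotating_direction] all the sections have parallel asymptotes, so the frame
    may be directed by those of one section. *)
Lemma hyperbola_frame : dense_set (section_rectangular_hyperbolas F Q w) ->
  exists E1 E2, frame E1 E2 w /\ dense_set (fun h => exists m o1 o2 p,
    conic_data (fun x y => evalP F (pt Q E1 E2 w x y h)) (msize F) (0, m, 0) o1 o2 p).
Proof.
move=> dH; have [h0 [[ O [E1 [E2 [pf _]]]] _]] := dH _ (oner_neq0 _).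
have fr := plane_frame_frame w0 pf.
have data h (Hh : section_rectangular_hyperbolas F Q w h) := section_hyperbola fr Hh.
have [|s11 [s12 [s22 [na [nb [k [D [Phi [lev good]]]]]]]]] := @central_level R F Q E1 E2 w (msize F) _ dH.
  by move=> h /data [c [n [s [ o1 [ o2 [p [_ _ D1]]]]]]]; do 4!eexists; exact: D1.
pose S (s c n : R) := (- (s * c * n), s * (c ^+ 2 - n ^+ 2) / 2, s * c * n).
have {}good : dense_set (fun h => exists kap c n s o1 o2 p,
    [/\ kap != 0, c ^+ 2 + n ^+ 2 = 1, s ^+ 2 = 1,
        conic_data (fun x y => evalP F (pt Q E1 E2 w x y h)) (msize F) (S s c n) o1 o2 p &
        [/\ s11.[h] = - (kap * (s * c * n)), s12.[h] = kap * (s * (c ^+ 2 - n ^+ 2) / 2) &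
            s22.[h] = kap * (s * c * n)]]).
  apply: dense_sub good _ => h [/data [c [n [s [ o1 [ o2 [p [cn s2 D1]]]]]]] /(_ _ _ _ _ D1)].
  move=> [kap kap0 /= [e1 e2 e3]]; exists kap, c, n, s, o1, o2, p; split=> //; split=> //.
  by rewrite e1 mulrN.
have z22 : s22 = - s11.
  apply/eqP; rewrite -subr_eq0; apply/eqP; apply: (dense_eq0 good).
  move=> h [kap [c [n [s [ o1 [ o2 [p [_ _ _ _ [e1 e2 e3]]]]]]]]].
  by rewrite opprK hornerD e1 e3 subrr.
have par : s11^`() * s12 = s11 * s12^`().
  apply: (rotating_direction gamma_normal fr sol lev good z22).
  move=> h [kap [c [n [s [ o1 [ o2 [p [_ cn _ _ [e1 e2 e3]]]]]]]]].
  by exists c, n, (kap * s / 2); split=> //; rewrite ?e1 ?e2; field.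
have [g0 [[kap0 [c0 [n0 [t0 [a0 [b0 [p0 [k00 cn0 t02 _ [f1 f2 f3]]]]]]]]] _]] := good _ (oner_neq0 _).
have cross h : s11.[h] * s12.[g0] = s11.[g0] * s12.[h].
  have [s0|s0] := eqVneq s12 0; first by rewrite s0 !horner0 !mulr0.
  have [b ->] := proportional_deriv s0 par.
  by rewrite !hornerZ; ring.
exists (c0 *: E1 + n0 *: E2), (- n0 *: E1 + c0 *: E2); split; first exact: frame_rotate.
apply: dense_sub good _ => h [kap [c [n [s [ o1 [ o2 [p [k0 cn s2 D1 [e1 e2 e3]]]]]]]]].
have [|m [a [b Dm]]] := rotate_hyperbola cn s2 cn0 _ D1; last by exists m, a, b, p.
have := cross h; rewrite e1 e2 f1 f2 => E.
have nz : kap * s * kap0 * t0 != 0.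
  have t00 : t0 != 0 by rewrite -sqrf_eq0 t02 oner_neq0.
  have s0 : s != 0 by rewrite -sqrf_eq0 s2 oner_neq0.
  by rewrite !mulf_neq0.
apply: (mulfI nz).
transitivity (- 2 * (- (kap * (s * c * n)) * (kap0 * (t0 * (c0 ^+ 2 - n0 ^+ 2) / 2)))); first by field.
by rewrite E; field.
Qed.

Lemma hyperbola_invariant : dense_set (section_rectangular_hyperbolas F Q w) ->
  exists E1 E2, frame E1 E2 w /\ form_invariant (-1) E1 E2.
Proof.
move=> /hyperbola_frame [E1 [E2 [fr dH]]].
have [|s11 [s12 [s22 [na [nb [k [D [Phi [lev good]]]]]]]]] := @central_level R F Q E1 E2 w (msize F) _ dH.
  by move=> h [m [ o1 [ o2 [p D1]]]]; do 4!eexists; exact: D1.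
have {}good : dense_set (fun h => s11.[h] = 0 /\ s22.[h] = 0).
  apply: dense_sub good _ => h [[m [ o1 [ o2 [p D1]]]] /(_ _ _ _ _ D1) [kap _ /= [-> _ ->]]].
  by rewrite mulr0.
have z11 : s11 = 0 by apply: (dense_eq0 good) => h [].
have z22 : s22 = 0 by apply: (dense_eq0 good) => h [].
have s0 : s12 != 0.
  by case: lev => _ _ _ + _; apply: contraNneq => s0; rewrite z11 s0 mul0r expr0n subr0.
have {}lev : level_form F Q E1 E2 w (s12 * 0%:P) (s12 * 1%:P) (s12 * 0%:P) na nb k D Phi.
  by rewrite polyC1 polyC0 mulr1 mulr0 -{1}z11 -z22.
have {}lev := level_form_const s0 lev.
have [ca cb] := hyperbola_center gamma_normal sol fr lev.
have [a0 b0] := center_trivial gamma_normal D_eq1 fr sol lev ca cb.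
rewrite a0 b0 in lev.
(* A rotation by pi / 4 turns the form 2 x y into x^2 - y^2. *)
pose r : R := Num.sqrt 2^-1.
have r2 : r ^+ 2 = 2^-1 by rewrite sqr_sqrtr // invr_ge0 ler0n.
have r1 : r ^+ 2 + r ^+ 2 = 1 by rewrite r2; field.
exists (r *: E1 + r *: E2), (- r *: E1 + r *: E2); split; first exact: frame_rotate.
have ptE x y z : pt Q (r *: E1 + r *: E2) (- r *: E1 + r *: E2) w x y z =
    pt Q E1 E2 w (r * (x - y)) (r * (x + y)) z.
  by apply/colP => i; rewrite !mxE; ring.
move=> x y x' y' z xy; rewrite !ptE; apply: (level_invariant lev); rewrite /qf /=.
transitivity (2 * r ^+ 2 * (x ^+ 2 + -1 * y ^+ 2)); first by ring.
by rewrite xy; ring.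
Qed.
End Invariance.

(** * Invariance under the rotation groups *)

Section Groups.
Variables (R : realType) (F : {mpoly R[3]}).
Local Notation point := 'cV[R]_3.
Variables (Q w : point).

Definition preserves_form (e : R) (G : R -> 'M[R]_3) := forall t x y,
  exists x' y', x' ^+ 2 + e * y' ^+ 2 = x ^+ 2 + e * y ^+ 2 /\
    forall z, G t *m vec3 x y z = vec3 x' y' z /\ G (- t) *m vec3 x' y' z = vec3 x y z.

Lemma mulmx_vec3 (a : seq (seq R)) x y z : mx3 a *m vec3 x y z =
  let f i := nth 0 (nth [::] a i) 0 * x + nth 0 (nth [::] a i) 1 * y + nth 0 (nth [::] a i) 2 * z in
  vec3 (f 0%N) (f 1%N) (f 2%N).
Proof.
by apply: col3P; rewrite /coords !mxE; congr (_, _, _); rewrite sum3E !mxE.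
Qed.

Lemma elliptic_preserves : preserves_form 1 (@elliptic_mx R).
Proof.
move=> t x y; exists (cos t * x - sin t * y), (sin t * x + cos t * y); split.
  transitivity ((cos t ^+ 2 + sin t ^+ 2) * (x ^+ 2 + 1 * y ^+ 2)); first by ring.
  by rewrite cos2Dsin2 mul1r.
move=> z; rewrite !mulmx_vec3 /=; split; congr vec3; rewrite ?cosN ?sinN; try ring.
  transitivity ((cos t ^+ 2 + sin t ^+ 2) * x); first by ring.
  by rewrite cos2Dsin2 mul1r.
transitivity ((cos t ^+ 2 + sin t ^+ 2) * y); first by ring.
by rewrite cos2Dsin2 mul1r.
Qed.

Lemma hyperbolic_preserves : preserves_form (-1) (@hyperbolic_mx R).
Proof.
move=> t x y.
have hE : coshR t ^+ 2 - sinhR t ^+ 2 = 1.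
  by rewrite /coshR /sinhR -[RHS](expRxMexpNx_1 t); field.
have cN : coshR (- t) = coshR t by rewrite /coshR opprK addrC.
have sN : sinhR (- t) = - sinhR t by rewrite /sinhR opprK -opprB mulNr.
exists (coshR t * x + sinhR t * y), (sinhR t * x + coshR t * y); split.
  transitivity ((coshR t ^+ 2 - sinhR t ^+ 2) * (x ^+ 2 + -1 * y ^+ 2)); first by ring.
  by rewrite hE mul1r.
move=> z; rewrite !mulmx_vec3 /=; split; congr vec3; rewrite ?cN ?sN; try ring.
  transitivity ((coshR t ^+ 2 - sinhR t ^+ 2) * x); first by ring.
  by rewrite hE mul1r.
transitivity ((coshR t ^+ 2 - sinhR t ^+ 2) * y); first by ring.
by rewrite hE mul1r.
Qed.

(** The rows of the rigid motion are E1, E2 and E1 x E2, so it preserves the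
    orientation even if E1, E2, w is a negative frame; the axis is then
    reversed. *)
Lemma invariant_rotation_surface e E1 E2 G : frame E1 E2 w -> preserves_form e G ->
  form_invariant F Q w e E1 E2 -> rotation_surface G (line Q w) (zero_set F).
Proof.
move=> fr pG inv; pose d := vol E1 E2 w.
have [E3 E3E] : exists E3, E3 = cross E1 E2 by exists (cross E1 E2).
have d0 : d != 0 := frame_vol_neq0 fr.
have [[e11 e22 e12] _] := fr.
have e13 : dot E1 E3 = 0 by rewrite E3E dot_cross_l.
have e23 : dot E2 E3 = 0 by rewrite E3E dot_cross_r.
have e33 : dot E3 E3 = 1 by rewrite E3E dot_cross2 e11 e22 e12 expr0n subr0 mulr1.
have wE : w = d *: E3 by rewrite E3E; exact: frame_w.
pose row (u : point) := [:: u i0 0; u i1 0; u i2 0].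
pose M : 'M[R]_3 := mx3 [:: row E1; row E2; row E3].
have ME u : M *m u = vec3 (dot E1 u) (dot E2 u) (dot E3 u).
  apply: col3P; rewrite /coords; congr (_, _, _);
    by rewrite mxE sum3E [RHS]mxE /= dotE /dot3 /coords !mxE.
have MM : M *m M^T = 1%:M.
  have rowE i j : (M *m M^T) i j = dot (nth 0 [:: E1; E2; E3] i) (nth 0 [:: E1; E2; E3] j).
    rewrite mxE sum3E dotE /dot3 /coords; move: i; apply: ord3P; move: j;
      by apply: ord3P; rewrite !mxE.
  apply/matrixP => i j; rewrite rowE mxE; move: i; apply: ord3P; move: j;
    by apply: ord3P; rewrite /= ?e11 ?e22 ?e33 ?[dot E2 E1]dotC
    ?[dot E3 E1]dotC ?[dot E3 E2]dotC ?e12 ?e13 ?e23.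
pose T P := M *m P + - (M *m Q).
have TE x y z : T (pt Q E1 E2 w x y z) = vec3 x y (z * d).
  rewrite /T -mulmxN -mulmxDr ME /pt wE !dot_lin e11 e22 e12 e13 e23 e33.
  rewrite [dot E2 E1]dotC [dot E3 E1]dotC [dot E3 E2]dotC e12 e13 e23.
  by congr vec3; ring.
have lineE t : Q + t *: w = pt Q E1 E2 w 0 0 t by rewrite /pt !scale0r !addr0.
have zE s : 0 + s *: vec3 0 0 1 = vec3 0 0 s :> point.
  by apply: col3P; rewrite /coords !mxE /= !mulr0 !add0r mulr1.
exists T; split.
- exists M, (- (M *m Q)); split=> //; first exact: mulmx1C.
  rewrite -[LHS]/(det3 E1 E2 E3) det3E E3E cross_cross e22 [dot E2 E1]dotC e12.
  by rewrite scale1r scale0r subr0 e11.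
- rewrite predeqE => P; split.
    move=> [_ [t _ <-] <-]; rewrite lineE TE; exists (t * d) => //.
  move=> [s _ <-]; exists (Q + (s / d) *: w); first by exists (s / d).
  by rewrite lineE TE divfK // zE.
move=> t; rewrite predeqE => P.
have key x y z x' y' : x' ^+ 2 + e * y' ^+ 2 = x ^+ 2 + e * y ^+ 2 ->
    zero_set F (pt Q E1 E2 w x y z) -> zero_set F (pt Q E1 E2 w x' y' z).
  by rewrite /zero_set /= => xy <-; exact: inv.
split.
  move=> [_ [X SX <-] <-]; rewrite (pt_frame Q fr X) in SX *; rewrite TE.
  have [x' [y' [xy /(_ (frame_z Q w X * d)) [-> _]]]] := pG t (frame_x Q E1 X) (frame_y Q E2 X).
  by rewrite -TE; exists (pt Q E1 E2 w x' y' (frame_z Q w X)) => //; exact: key xy SX.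
move=> [X SX <-]; rewrite (pt_frame Q fr X) in SX *; rewrite TE.
have [x' [y' [xy /(_ (frame_z Q w X * d)) [_]]]] := pG (- t) (frame_x Q E1 X) (frame_y Q E2 X).
rewrite opprK => Gt; exists (vec3 x' y' (frame_z Q w X * d)) => //.
by rewrite -TE; exists (pt Q E1 E2 w x' y' (frame_z Q w X)) => //; exact: key xy SX.
Qed.
End Groups.

(** If H is not dense, some nonzero polynomial vanishes at all its points. *)
Lemma generic_or_dense (R : realType) (H : R -> Prop) (C : Prop) :
  (dense_set H -> C) -> generic_normal_plane (fun h => H h -> C).
Proof.
move=> HC; have [dH|/existsNP [q /not_implyP [q0 hq]]] := pselect (dense_set H).
  by exists 1; [exact: oner_neq0|move=> h _ _; exact: HC].
by exists q => // h qh Hh; case: hq; exists h.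
Qed.

Theorem theorem21 (R : realType) (F : {mpoly R[3]})
  (F_irreducible : irreducible_mpoly F)
  (S_dim2 : has_dim (zero_set F) 2)
  (S_curved : curvature_not_identically_zero F)
  (gamma : 'cV[{fraction {mpoly R[3]}}]_3)
  (gamma_normal : affine_normal_field F gamma)
  (D_eq1 : solution_dim gamma 1)
  (Q w : 'cV[R]_3) (w_neq0 : w != 0)
  (A_solution : solves_L gamma (plucker Q w)) :
  generic_normal_plane (fun h =>
    section_concentric_circles F Q w h ->
    elliptic_rotation_surface (line Q w) (zero_set F))
  /\
  generic_normal_plane (fun h =>
    section_rectangular_hyperbolas F Q w h ->
    hyperbolic_rotation_surface (line Q w) (zero_set F)).
Proof.
split; apply: generic_or_dense => dH.
  have [E1 [E2 [fr inv]]] := circle_invariant gamma_normal D_eq1 w_neq0 A_solution dH.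
  exact: invariant_rotation_surface fr (@elliptic_preserves R) inv.
have [E1 [E2 [fr inv]]] := hyperbola_invariant gamma_normal D_eq1 w_neq0 A_solution dH.
exact: invariant_rotation_surface fr (@hyperbolic_preserves R) inv.
Qed.
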